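(* Let $H,J$ be 2-subdivisions of multigraphs $H_0,J_0$ respectively. Then $\{H,\overline{J}\}$ has the Erdős–Hajnal property.
   Context: Graphs are finite, with no loops or parallel edges; multigraphs are finite and may have parallel edges but not loops. $|G|$ denotes the number of vertices of $G$, and $\overline{G}$ denotes the complement graph of $G$. A graph $G$ is $H$-free if it has no induced subgraph isomorphic to $H$; for a set $\mathcal{H}$ of graphs, $G$ is $\mathcal{H}$-free if it is $H$-free for all $H\in\mathcal{H}$. A set $\mathcal{H}$ of graphs has the Erdős–Hajnal property if there exists $c>0$ such that every $\mathcal{H}$-free graph $G$ has a clique or stable set (a set of pairwise nonadjacent vertices) of cardinality at least $|G|^c$. $k$-subdividing an edge with ends $u,v$ means deleting the edge and adding a path of length $k+1$ between $u$ and $v$ whose internal vertices are new. A $k$-subdivision of a multigraph is the graph obtained by $k$-subdividing every edge. *)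

(* Defs.v *)
(* This development uses MathComp and MathComp-Analysis. *)
From mathcomp Require Import all_boot all_order all_algebra.
From mathcomp Require Import reals exp.

Set Implicit Arguments.
Unset Strict Implicit.
Unset Printing Implicit Defensive.

Record sgraph := SGraph {
  svertex :> finType;
  sadj : rel svertex;
  sadj_sym : symmetric sadj;
  sadj_irr : irreflexive sadj
}.

Definition giso (G H : sgraph) : Prop :=
  exists2 f : G -> H, bijective f & forall x y, sadj (f x) (f y) = sadj x y.

Section Constructions.
Variable G : sgraph.

Definition compl_adj : rel G := fun x y => (x != y) && ~~ sadj x y.

Lemma compl_adj_sym : symmetric compl_adj.
Proof. by move=> x y; rewrite /compl_adj eq_sym sadj_sym. Qed.

Lemma compl_adj_irr : irreflexive compl_adj.
Proof. by move=> x; rewrite /compl_adj eqxx. Qed.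

Definition compl : sgraph := SGraph compl_adj_sym compl_adj_irr.

Variable S : {set G}.

Definition induced_adj : rel {x : G | x \in S} :=
  fun x y => sadj (val x) (val y).

Lemma induced_adj_sym : symmetric induced_adj.
Proof. by move=> x y; exact: sadj_sym. Qed.

Lemma induced_adj_irr : irreflexive induced_adj.
Proof. by move=> x; exact: sadj_irr. Qed.

Definition induced : sgraph := SGraph induced_adj_sym induced_adj_irr.

Definition clique : Prop :=
  forall x y, x \in S -> y \in S -> x != y -> sadj x y.

Definition stable : Prop :=
  forall x y, x \in S -> y \in S -> ~~ sadj x y.

End Constructions.

Definition free (H G : sgraph) : Prop :=
  forall S : {set G}, ~ giso (induced S) H.

(* A set of graphs is a predicate, since the universe level of
   [classical_sets.set] is too low to contain [set sgraph]. *)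
Definition graph_set := sgraph -> Prop.

Definition graph_pair (H1 H2 : sgraph) : graph_set :=
  fun H => H = H1 \/ H = H2.

Definition set_free (F : graph_set) (G : sgraph) : Prop :=
  forall H, F H -> free H G.

(* [powR] gives 0 `^ c = 0 for c > 0, so the null graph is harmless. *)
Definition erdos_hajnal (R : realType) (F : graph_set) : Prop :=
  exists2 c : R, (0 < c)%R &
    forall G : sgraph, set_free F G ->
      exists2 S : {set G}, clique S \/ stable S &
        (#|G|%:R `^ c <= #|S|%:R :> R)%R.

(* Each edge is stored with an arbitrary ordering of its two ends; reversing
   it does not change the subdivisions below, up to isomorphism. *)
Record multigraph := MultiGraph {
  mvertex : finType;
  medge : finType;
  end1 : medge -> mvertex;
  end2 : medge -> mvertex;
  end_neq : forall e, end1 e != end2 e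
}.

Section Subdivision.
Variables (k : nat) (M : multigraph).

(* [inr (e, j)] is the [j]-th new vertex on the path replacing [e]. *)
Definition subdiv_vertex : finType := (mvertex M + medge M * 'I_k)%type.

(* The path end1 e, (e, 0), ..., (e, k - 1), end2 e replacing [e], indexed
   by 0, ..., k + 1. *)
Definition subdiv_path (e : medge M) (i : nat) : subdiv_vertex :=
  if i is j.+1 then
    if insub j is Some j' then inr (e, j') else inl (end2 e)
  else inl (end1 e).

Definition subdiv_adj : rel subdiv_vertex := fun u v =>
  [exists e : medge M, exists i : 'I_k.+1,
     ((u == subdiv_path e i) && (v == subdiv_path e i.+1)) ||
     ((v == subdiv_path e i) && (u == subdiv_path e i.+1))].

Lemma subdiv_adj_sym : symmetric subdiv_adj.
Proof.
move=> u v; rewrite /subdiv_adj.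
by apply: eq_existsb => e; apply: eq_existsb => i; rewrite orbC.
Qed.

Lemma subdiv_path_neq e i : i <= k -> subdiv_path e i != subdiv_path e i.+1.
Proof.
case: i => [_|j ltjk] /=.
  by case: insubP => [//|_]; have := end_neq e; apply: contra => /eqP[->].
rewrite insubT; case: insubP => [j' _ j'E|//].
by apply/eqP => -[/(congr1 val)]; rewrite /= j'E => /eqP; rewrite ltn_eqF.
Qed.

Lemma subdiv_adj_irr : irreflexive subdiv_adj.
Proof.
move=> u; apply/negbTE/existsP => -[e /existsP[i]]; rewrite orbb.
move=> /andP[/eqP uE /eqP]; rewrite uE => /eqP; apply/negP.
by apply: subdiv_path_neq; rewrite -ltnS.
Qed.

Definition subdivision : sgraph := SGraph subdiv_adj_sym subdiv_adj_irr.

End Subdivision.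

Definition is_subdivision (k : nat) (M : multigraph) (G : sgraph) : Prop :=
  giso G (subdivision k M).

(* Main.v *)
Require Import Defs.
From mathcomp Require Import all_boot all_order all_algebra.
From mathcomp Require Import reals exp.
From mathcomp Require Import zify.

Set Implicit Arguments.
Unset Strict Implicit.
Unset Printing Implicit Defensive.

(* Let S be a minimal counterexample to |S| <= k0 (alpha omega)^C.  Then K pairwise anticomplete subsets of S
   never all have size at least |S| / K^C, and the same holds in the complement.  By Rödl's theorem a linear part
   of S is sparse in the graph or in its complement, say in the graph.  There one finds many vertices (apexes)
   with private neighbourhoods (teeth) of comparable size D, very sparse to each other.  The anticomplete-sets
   property yields, inside any family of dense subsets of teeth, R pairwise anticomplete sets in distinct teeth
   (a group of hubs), each of which covers dense subsets of many other teeth.  Iterate, going down to the covered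
   subsets, and choose elements b in the teeth of the hubs; each later element b has a neighbour f_h(b) in the set
   of every earlier hub h.  Deleting few vertices and using the pigeonhole principle, the unwanted adjacencies
   among elements and their images disappear, except that f_h(b) and f_h(b') may be adjacent.  If this happens
   for many hubs h of one group and enough elements b, these elements are the branch vertices and the paths
   b - f_h(b) - f_h(b') - b', one hub h for each edge, give the subdivision.  Otherwise one can pick hubs where it
   does not happen, and the apexes are the branch vertices, with paths apex - f_h(b) - b - apex. *)

(** All sizes are measured at one scale [k]: densities are powers [k^-x] relative to [D], and each
    of a bounded number of operations changes the exponents by amounts depending on the pattern
    only, while fixed factors are absorbed by [k] being large. So the exponents come from the
    pattern alone and [C] is taken last, above all of them. For this, [k] is chosen so that |S| is
    at most a fixed power of [k] times [D]; then criticality of S for [K = k] speaks about sets of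
    size comparable to [D].

    The obstacle is that sparsity is available only between different teeth; nothing is known inside
    one. Since f_h(b) and f_h(b') lie in the same tooth, their adjacency cannot be removed by
    deletion, only made uniform; hence the patterns [p] and [beta]. For the same reason several
    pairwise nonadjacent elements b need not exist in one tooth. The greedy choice fails only on a
    dense subset in which every vertex is adjacent to almost all others. If this happens in many
    teeth, the subdivision is found directly: one such near-clique for each edge supplies the two
    inner vertices of its path. *)

Section Graph.
Variables (T : finType) (e : rel T).
Definition nb (A : {set T}) : {set T} := [set y | [exists x in A, e x y]].
Definition anti (A B : {set T}) : Prop := forall x y, x \in A -> y \in B -> ~~ e x y.

Definition apart (A B : {set T}) : Prop := anti A B /\ [disjoint A & B].

Lemma nbP (A : {set T}) y : reflect (exists2 x, x \in A & e x y) (y \in nb A).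
Proof. by rewrite inE; apply: (iffP exists_inP). Qed.

Lemma antiS (A B A' B' : {set T}) : A' \subset A -> B' \subset B -> anti A B -> anti A' B'.
Proof. by move=> /subsetP sA /subsetP sB h x y /sA xA /sB; apply: h. Qed.

Lemma anti_sym (A B : {set T}) : symmetric e -> anti A B -> anti B A.
Proof. by move=> es h x y xB yA; rewrite es; apply: h. Qed.

Lemma anti_nb (A B : {set T}) : anti A (B :\: nb A).
Proof.
by move=> x y xA /setDP[_]; apply: contra => exy; apply/nbP; exists x.
Qed.

Lemma nbU (A B : {set T}) : nb (A :|: B) = nb A :|: nb B.
Proof.
apply/setP => y; rewrite in_setU; apply/nbP/orP => [[x] /setUP[]|].
- by move=> xA exy; left; apply/nbP; exists x.
- by move=> xA exy; right; apply/nbP; exists x.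
- by case=> /nbP[x xA exy]; exists x => //; rewrite inE xA ?orbT.
Qed.

Lemma nb1 x : nb [set x] = [set y | e x y].
Proof.
apply/setP => y; rewrite in_set; apply/nbP/idP => [[x' /set1P->]//|exy].
by exists x; rewrite ?set11.
Qed.
End Graph.

(** * Counting in families of disjoint sets *)

Section Disjoint.
Variables (T L : finType) (P : L -> {set T}).
Hypothesis Pd : forall u v x, x \in P u -> x \in P v -> u = v.

Lemma sum_cap (g : {set L}) (A : {set T}) : \sum_(v in g) #|A :&: P v| <= #|A|.
Proof.
have -> : \sum_(v in g) #|A :&: P v| = \sum_(x in A) #|[set v in g | x \in P v]|.
  under eq_bigr do rewrite -sum1_card.
  under [RHS]eq_bigr do rewrite -sum1_card.
  rewrite (exchange_big_dep (mem A)) /=; last by move=> v x _ /setIP[].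
  apply: eq_bigr => x xA; apply: eq_bigl => v.
  by rewrite !inE xA.
rewrite -sum1_card; apply: leq_sum => x _.
apply/card_le1_eqP => u v; rewrite !inE => /andP[_ xu] /andP[_ xv].
by apply: Pd xv xu.
Qed.

Lemma sum_cap_eq (g : {set L}) (A : {set T}) : A \subset \bigcup_(v in g) P v ->
  #|A| <= \sum_(v in g) #|A :&: P v|.
Proof.
move=> sA; have {1}-> : A = \bigcup_(v in g) (A :&: P v) by rewrite -big_distrr /= (setIidPl sA).
elim/big_rec2: _ => [|v n B _ h]; first by rewrite cards0.
by rewrite (leq_trans (leq_card_setU _ _)) // leq_add2l.
Qed.

Lemma few_heavy (g : {set L}) (A : {set T}) m D :
  #|[set v in g | D <= #|A :&: P v| * m]| * D <= #|A| * m.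
Proof.
apply: leq_trans (leq_mul (sum_cap g A) (leqnn m)).
rewrite big_distrl /= -sum_nat_const.
rewrite [X in _ <= X](bigID (fun v => D <= #|A :&: P v| * m)) /=.
apply: leq_trans (leq_addr _ _).
rewrite (eq_bigl (fun v => (v \in g) && (D <= #|A :&: P v| * m))); last by move=> v; rewrite inE.
by apply: leq_sum => v /andP[].
Qed.

(** The classes holding less than [D / (2 * q)] of [A] account for at most half of the guaranteed
    [nu * D / q]; the others hold at most [D] each, so they must be numerous. *)
Lemma many_heavy (g : {set L}) (A : {set T}) q nu D : 0 < D ->
  A \subset \bigcup_(v in g) P v -> (forall v, v \in g -> #|A :&: P v| <= D) ->
  #|g| = nu -> nu * D <= #|A| * q ->
  nu <= 2 * q * #|[set v in g | D <= #|A :&: P v| * (2 * q)]|.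
Proof.
move=> D0 sA AD gnu h.
have h1 : \sum_(v in g) #|A :&: P v| * (2 * q) <= nu * D + #|[set v in g | D <= #|A :&: P v| * (2 * q)]| * (D * (2 * q)).
  rewrite -gnu -!sum_nat_const [X in X <= _](bigID (fun v => D <= #|A :&: P v| * (2*q))) /=.
  rewrite addnC; apply: leq_add.
    rewrite [X in _ <= X](bigID (fun v => D <= #|A :&: P v| * (2*q))) /= (leq_trans _ (leq_addl _ _)) //.
    by apply: leq_sum => v /andP[_]; rewrite -ltnNge => /ltnW.
  rewrite [X in _ <= X](eq_bigl (fun v => (v \in g) && (D <= #|A :&: P v| * (2 * q)))); last by move=> v; rewrite inE.
  by apply: leq_sum => v /andP[vg _]; rewrite leq_mul2r AD ?orbT.
have h2 := leq_trans (leq_mul (sum_cap_eq sA) (leqnn (2*q))) _.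
rewrite -big_distrl /= in h1; have {}h1 := h2 _ h1; clear h2.
set H := #|_| in h1 *; rewrite -(leq_pmul2r D0).
nia.
Qed.
End Disjoint.

Lemma equal_parts (L : finType) (J : {set L}) N nu : nu * N <= #|J| ->
  exists g : nat -> {set L}, [/\ forall i, g i \subset J,
    forall i, i < N -> #|g i| = nu & forall i j v, v \in g i -> v \in g j -> i = j].
Proof.
move=> h.
case: (posnP nu) => [->|nu0].
  by exists (fun=> set0); split=> [i|i|i j v]; rewrite ?sub0set ?cards0 // inE.
exists (fun i => [set v in J | index v (enum J) %/ nu == i]); split.
- by move=> i; apply/subsetP => v; rewrite inE => /andP[].
- move=> i iN.
  have sz : size (enum J) = #|J| by rewrite cardE.
  have lt : i * nu + nu <= size (enum J).
    by rewrite sz; apply: leq_trans h; rewrite addnC -mulSn mulnC leq_mul2l iN orbT.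
  transitivity (size (take nu (drop (i * nu) (enum J)))); last first.
    by rewrite size_takel // size_drop; lia.
  rewrite -(card_uniqP _) ?take_uniq ?drop_uniq ?enum_uniq //.
  apply: eq_card => v; rewrite !inE.
  have [vJ|vJ] := boolP (v \in J); last first.
    by apply/esym/negbTE; apply: contra vJ => /mem_take /mem_drop; rewrite mem_enum.
  rewrite /=.
  have u : uniq (enum J) by exact: enum_uniq.
  have vE : v \in enum J by rewrite mem_enum.
  move: (enum J) u vE lt => E u vE lt {sz}.
  apply/eqP/idP => [ix|].
    have ii := divn_eq (index v E) nu; rewrite ix in ii.
    have lm := ltn_pmod (index v E) nu0; move: (index v E %% nu) ii lm => r ii lm.
    rewrite -[v](nth_index v vE) ii -nth_drop -(nth_take _ lm).
    have ls : nu <= size (drop (i * nu) E) by rewrite size_drop leq_subRL // (leq_trans (leq_addr _ _) lt).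
    by apply: mem_nth; rewrite size_takel.
  move=> vt; have := vt; rewrite -index_mem size_takel; last by rewrite size_drop leq_subRL // (leq_trans (leq_addr _ _) lt).
  set r := index _ _ => rl.
  have vr : v = nth v E (i * nu + r) by rewrite -nth_drop -(nth_take _ rl) nth_index.
  rewrite {1}vr index_uniq //; last by rewrite (leq_trans _ lt) // ltn_add2l.
  by rewrite divnMDl // divn_small ?addn0.
- by move=> i j v; rewrite !inE => /andP[_ /eqP<-] /andP[_ /eqP].
Qed.

Lemma card_bigcup (I T : finType) (p : pred I) (B : I -> {set T}) :
  #|\bigcup_(i | p i) B i| <= \sum_(i | p i) #|B i|.
Proof.
elim/big_rec2: _ => [|i n A _ h]; first by rewrite cards0.
by rewrite (leq_trans (leq_card_setU _ _)) // leq_add2l.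
Qed.

Lemma leq_sum_const (I : finType) (p : pred I) (F : I -> nat) m :
  (forall i, p i -> F i <= m) -> \sum_(i | p i) F i <= #|p| * m.
Proof. by move=> h; rewrite -sum_nat_const; apply: leq_sum. Qed.

Lemma leq_sum_ord n (F : 'I_n -> nat) m : (forall i, F i <= m) -> \sum_(i < n) F i <= n * m.
Proof. by move=> h; apply: leq_trans (leq_sum_const (fun i _ => h i)) _; rewrite card_ord. Qed.

(** * Teeth *)

(* The [P v] are disjoint sets of size about [D], sparse to each other at the scale [k^-s]; the last field is
   what a minimal counterexample to the polynomial bound provides. *)
Record teeth (T L : finType) (e : rel T) (P : L -> {set T}) (D k s c : nat) : Prop := Teeth {
  teeth_sym : symmetric e;
  teeth_irr : irreflexive e;
  teeth_k : 2 <= k;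
  teeth_big : k ^ s <= D;
  teeth_disj : forall u v x, x \in P u -> x \in P v -> u = v;
  teeth_size : forall v, #|P v| <= D;
  teeth_deg : forall x, x \in \bigcup_v P v -> #|[set y in \bigcup_v P v | e x y]| <= D;
  teeth_sparse : forall u v x, u != v -> x \in P u -> #|[set y in P v | e x y]| * k ^ s <= D;
  teeth_crit : forall X : nat -> {set T}, (forall i, i < k -> X i \subset \bigcup_v P v) ->
    (forall i j, i < j -> j < k -> apart e (X i) (X j)) -> exists2 i, i < k & #|X i| * k ^ c < D
}.

Section Teeth.
Variables (T L : finType) (e : rel T) (P : L -> {set T}) (D k s c : nat).
Hypothesis tP : teeth e P D k s c.
Let k2 := teeth_k tP.
Let Pd := teeth_disj tP.

Lemma teeth_D0 : 0 < D.
Proof.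
have [i|i j _ _|i _] := @teeth_crit _ _ _ _ _ _ _ _ tP (fun=> set0).
- by rewrite sub0set.
- by split; [move=> x y; rewrite inE | rewrite -setI_eq0 set0I].
- by apply: leq_ltn_trans.
Qed.

Let k0 : 0 < k. Proof. exact: leq_trans k2. Qed.
Let kx x : 0 < k ^ x. Proof. by rewrite expn_gt0 k0. Qed.

(** Otherwise one class can be picked greedily in every family so that the traces [Q] hardly see
    each other; cleaning them leaves [k] pairwise anticomplete sets of size at least
    [D / (4 * k ^ x)], against [teeth_crit]. The exponent [2 * x + 6] leaves room for the fewer than
    [k] earlier picks, for the proportion [1 / (2 * k ^ x)] of heavy classes, and for the tolerance
    [1 / (4 * k ^ x.+1)] per earlier pick. *)
Lemma teeth_cross (F : nat -> {set T}) (g : nat -> {set L}) nu x z :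
  (forall i, i < k -> F i \subset \bigcup_(v in g i) P v) -> (forall i, i < k -> #|g i| = nu) ->
  (forall i j v, i < k -> j < k -> v \in g i -> v \in g j -> i = j) ->
  0 < nu -> (forall i, i < k -> nu * D <= #|F i| * k ^ x) -> x + 2 <= c -> 2 * x + 6 <= z ->
  exists i j v, [/\ i < k, j < k, i != j, v \in g i &
    #|F j| <= #|nb e (P v :&: F i) :&: F j| * k ^ z].
Proof.
move=> Fg gnu gd nu0 Fx xc xz.
have D0 := teeth_D0.
case: (boolP [exists i : 'I_k, exists j : 'I_k, (i != j) && [exists v in g i,
    #|F j| <= #|nb e (P v :&: F i) :&: F j| * k ^ z]]) => [/existsP[i /existsP[j /andP[ij /existsP[v /andP[vg h]]]]]|].
  by exists i, j, v; split.
rewrite negb_exists => /forallP H.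
have {}H i j v : i < k -> j < k -> i != j -> v \in g i ->
    #|nb e (P v :&: F i) :&: F j| * k ^ z < #|F j|.
  move=> ik jk ij vg; rewrite ltnNge; apply/negP => h.
  have := H (Ordinal ik); rewrite negb_exists => /forallP /(_ (Ordinal jk)).
  rewrite negb_and negbK -val_eqE (negbTE ij) /= negb_exists => /forallP /(_ v).
  by rewrite vg h.
pose Q (vs : nat -> L) i := F i :&: P (vs i).
have [vs vsP] : exists vs : nat -> L, forall i, i < k ->
   [/\ vs i \in g i, D <= #|Q vs i| * (2 * k ^ x) & forall j, j < i -> #|nb e (Q vs j) :&: Q vs i| * (4 * k ^ x.+1) <= D].
  suff: forall n, n <= k -> exists vs : nat -> L, forall i, i < n ->
   [/\ vs i \in g i, D <= #|Q vs i| * (2 * k ^ x) & forall j, j < i -> #|nb e (Q vs j) :&: Q vs i| * (4 * k ^ x.+1) <= D] by apply.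
  elim=> [_|n IH nk].
    have := gnu 0 k0; move: nu0 => /[swap] <- /card_gt0P[v _].
    by exists (fun=> v).
  have [vs vsP] := IH (ltnW nk).
  have h1 : nu <= 2 * k ^ x * #|[set v in g n | D <= #|F n :&: P v| * (2 * k ^ x)]|.
    apply: many_heavy (D0) (Fg n nk) _ (gnu n nk) (Fx n nk) => v _.
    by apply: leq_trans (teeth_size tP v); rewrite subset_leq_card ?subsetIr.
  have h2 j : j < n -> #|[set v in g n | D <= #|nb e (Q vs j) :&: F n :&: P v| * (4 * k ^ x.+1)]| * k ^ z <= nu * (4 * k ^ x.+1).
    move=> jn; have jk := ltn_trans jn nk.
    rewrite -(leq_pmul2r D0).
    have [vg _ _] := vsP j jn; have := H j n (vs j) jk nk (negbT (ltn_eqF jn)).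
    rewrite [P _ :&: _]setIC -/(Q vs j) => /(_ vg) /ltnW hb.
    have hh := few_heavy Pd (g n) (nb e (Q vs j) :&: F n) (4 * k ^ x.+1) D.
    have hF : #|F n| <= nu * D.
      have hs := sum_cap_eq (Fg n nk); apply: leq_trans hs _.
      rewrite -(gnu n nk) -sum_nat_const; apply: leq_sum => v _.
      by apply: leq_trans (teeth_size tP v); rewrite subset_leq_card ?subsetIr.
    apply: (@leq_trans (#|nb e (Q vs j) :&: F n| * k ^ z * (4 * k ^ x.+1))).
      by rewrite mulnAC [X in _ <= X]mulnAC leq_mul2r hh orbT.
    by rewrite [X in _ <= X]mulnAC leq_mul2r (leq_trans hb hF) orbT.
  pose bad j := [set v in g n | D <= #|nb e (Q vs j) :&: F n :&: P v| * (4 * k ^ x.+1)].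
  have [v vh vb] : exists2 v, v \in [set v in g n | D <= #|F n :&: P v| * (2 * k ^ x)] &
      v \notin \bigcup_(j < n) bad j.
    apply/subsetPn/negP => /subset_leq_card.
    have hb : #|\bigcup_(j < n) bad j| * k ^ z <= n * (nu * (4 * k ^ x.+1)).
      have /(fun h => leq_mul h (leqnn (k ^ z))) := card_bigcup xpredT (fun j : 'I_n => bad j).
      move/leq_trans; apply.
      by rewrite big_distrl /=; apply: leq_sum_ord => j; apply: h2.
    move=> hc.
    have hc2 : nu * k ^ z <= nu * (2 * k ^ x * (n * (4 * k ^ x.+1))).
      have := leq_mul (leq_trans h1 (leq_mul (leqnn _) hc)) (leqnn (k ^ z)); have := leq_mul (leqnn (2 * k ^ x)) hb.
      by lia.
    rewrite leq_pmul2l // in hc2.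
    have : 2 * k ^ x * (n * (4 * k ^ x.+1)) < k ^ (2 * x + 6).
      have -> : k ^ (2 * x + 6) = k ^ x * k ^ x * k * k * (k * k * k * k) by rewrite mul2n -addnn !expnD -!mulnA; do !congr (_ * _); rewrite !mulnA -expnSr.
      rewrite expnS.
      have : 8 * n < k * (k * k * k * k).
        have e4 : 2 * 2 * 2 * 2 <= k * k * k * k by rewrite !leq_mul.
        apply: leq_trans (leq_mul (leqnn k) e4); lia.
      have := kx x; set y := k ^ x; move: (k * k * k * k) => w y0 hw.
      have -> : 2 * y * (n * (4 * (k * y))) = y * y * k * (8 * n) by lia.
      rewrite -!mulnA !ltn_pmul2l ?k0 //.
    by rewrite ltnNge (leq_trans _ hc2) // leq_pexp2l.
  exists (fun i => if i == n then v else vs i) => i; rewrite ltnS leq_eqVlt => /orP[/eqP->|ni].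
    rewrite /Q eqxx; move: vh; rewrite inE => /andP[vg vh]; split=> // j jn.
    rewrite (ltn_eqF jn); rewrite leqNgt; apply/negP => hj; case/negP: vb.
    apply/bigcupP; exists (Ordinal jn) => //; rewrite inE vg /=.
    by rewrite -setIA ltnW.
  rewrite /Q (ltn_eqF ni); have [a b d] := vsP i ni; split=> // j ji.
  by rewrite (ltn_eqF (ltn_trans ji ni)); apply: d.
pose X i := Q vs i :\: \bigcup_(j < i) nb e (Q vs j).
have [i ik|i j ij jk|i ik] := @teeth_crit _ _ _ _ _ _ _ _ tP X.
- apply/subsetP => u /setDP[/setIP[_ uP] _]; by apply/bigcupP; exists (vs i).
- split.
    move=> u w /setDP[uQ _] /setDP[_ wQ]; apply: contra wQ => euw; apply/bigcupP; exists (Ordinal ij) => //.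
    by apply/nbP; exists u.
  rewrite -setI_eq0; apply/eqP/setP => u; rewrite in_set0; apply/negP => /setIP[].
  move=> /setDP[/setIP[_ ui] _] /setDP[/setIP[_ uj] _].
  have ik := ltn_trans ij jk; have [vi _ _] := vsP i ik; have [vj _ _] := vsP j jk.
  by have := gd i j (vs i) ik jk vi; rewrite (Pd ui uj) => /(_ vj) eq; rewrite eq ltnn in ij.
have [vg h1 h2] := vsP i ik.
have hX : #|Q vs i| <= #|X i| + \sum_(j < i) #|nb e (Q vs j) :&: Q vs i|.
  rewrite -(cardsID (\bigcup_(j < i) nb e (Q vs j)) (Q vs i)) addnC leq_add2l.
  rewrite big_distrr /=; apply: leq_trans (card_bigcup _ _) _.
  by apply: leq_sum => j _; rewrite setIC.
(* Fewer than [k] deletions of at most [D / (4 * k ^ x.+1)] take away at most half of the guaranteed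
   [D / (2 * k ^ x)]. *)
have hs : \sum_(j < i) #|nb e (Q vs j) :&: Q vs i| * (4 * k ^ x.+1) <= k * D.
  apply: (@leq_trans (i * D)); last by rewrite leq_mul2r ltnW ?orbT.
  by apply: leq_sum_ord => j; apply: h2.
rewrite -big_distrl /= expnS in hs.
have hs2 : (\sum_(j < i) #|nb e (Q vs j) :&: Q vs i|) * (4 * k ^ x) <= D.
  by rewrite -(leq_pmul2l k0); move: (\sum_(j < i) _) (k ^ x) hs => a b; lia.
have : D <= #|X i| * (4 * k ^ x).
  have := leq_mul hX (leqnn (4 * k ^ x)).
  by move: (\sum_(j < i) _) (k ^ x) hs2 h1 => S b; lia.
move=> hD hc; have := leq_trans hc hD; rewrite ltn_pmul2l; last first.
  by case: #|X i| hD D0 => //; lia.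
have : k ^ (x + 2) <= k ^ c by rewrite leq_pexp2l.
rewrite expnD.
have : 4 <= k ^ 2 by rewrite -[4]/(2 ^ 2) leq_exp2r.
by have := kx x; nia.
Qed.
End Teeth.

(** * Covering many teeth by pairwise anticomplete sets *)

(* A family carrying [l] covering sets has kept a proportion [k ^- gc_exp R x l] of its vertices. *)
Fixpoint gc_exp (R x l : nat) : nat :=
  if l is l'.+1 then gc_exp R x l' + (2 * gc_exp R x l' + 6 + R) else x.+1.
(** The part [2 * _ + 6] is the exponent demanded by [teeth_cross]. The extra [R] keeps the loss of
    a family that is not being covered below [1 / (N + #|Act|)], where [N = k * 2 ^ R.+1]. *)
Definition gc_loss R x l := 2 * gc_exp R x l + 6 + R.

Lemma gc_expS R x l : gc_exp R x l.+1 = gc_exp R x l + gc_loss R x l.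
Proof. by []. Qed.

Lemma gc_exp_mono R x : {homo gc_exp R x : l l' / l <= l'}.
Proof. by apply: homo_leq leq_trans _ => // l; rewrite gc_expS leq_addr. Qed.

Lemma gc_loss_mono R x : {homo gc_loss R x : l l' / l <= l'}.
Proof. by move=> l l' /(gc_exp_mono R x) h; rewrite /gc_loss !leq_add2r leq_mul2l h. Qed.

Section Window.
Variables (T : finType) (e : rel T) (I : finType) (F : I -> {set T}) (D q : nat).

(** Take [S] minimal among the sets covering a proportion [1 / q] of some family: without one vertex
    [w] it covers at most [1 / q] of each family, and [w] alone adds at most [1 / q]. Hence one
    family can be restricted to the neighbours of [S] while all others can afford to lose them. *)
Lemma minimal_cover (A : {set I}) (Q : {set T}) :
  (forall i, i \in A -> 0 < #|F i|) ->
  (forall x i, x \in Q -> i \in A -> #|[set y | e x y] :&: F i| * q <= #|F i|) ->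
  (exists2 i, i \in A & #|F i| <= #|nb e Q :&: F i| * q) ->
  exists2 S : {set T}, S \subset Q & exists2 i, i \in A &
    #|F i| <= #|nb e S :&: F i| * q /\
    (forall i', i' \in A -> #|nb e S :&: F i'| * q <= 2 * #|F i'|).
Proof.
move=> F0 deg hQ.
pose p S := [exists i in A, #|F i| <= #|nb e S :&: F i| * q].
have pQ : p Q by apply/exists_inP.
have [S /minsetP[/exists_inP[i iA hi] Smin] SQ] := minset_exists pQ.
exists S => //; exists i => //; split=> // i' i'A.
have [S0|[w wS]] := set_0Vmem S.
  have : #|nb e S :&: F i| = 0.
    by apply/eqP; rewrite cards_eq0 -subset0; apply/subsetP => y /setIP[/nbP[x]]; rewrite S0 inE.
  by move=> h; rewrite h mul0n leqNgt F0 in hi.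
have np : ~~ p (S :\ w).
  apply/negP => h; have := Smin _ h (subsetDl _ _).
  by move/setP/(_ w); rewrite !inE eqxx wS.
have h1 : #|nb e (S :\ w) :&: F i'| * q <= #|F i'|.
  by rewrite leqNgt; apply: contra np => /ltnW h; apply/exists_inP; exists i'.
have : nb e S :&: F i' \subset (nb e (S :\ w) :&: F i') :|: ([set y | e w y] :&: F i').
  by rewrite -setIUl setSI // -{1}(setD1K wS) setUC nbU nb1.
move/subset_leq_card => /leq_trans /(_ (leq_card_setU _ _)) => h2.
have := deg w i' (subsetP SQ _ wS) i'A; move: h1; have := leq_mul h2 (leqnn q).
by rewrite mulnDl; clear; lia.
Qed.
End Window.

Section Groups.
Variables (T L : finType) (e : rel T) (P : L -> {set T}) (D k s c : nat).
Hypothesis tP : teeth e P D k s c.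
Let k2 := teeth_k tP.
Let Pd := teeth_disj tP.
Let D0 := teeth_D0 tP.
Let k0 : 0 < k. Proof. exact: leq_trans k2. Qed.
Let kx x : 0 < k ^ x. Proof. by rewrite expn_gt0 k0. Qed.

Variables (R x : nat) (J : {set L}) (C : L -> {set T}).
Hypothesis CP : forall v, v \in J -> C v \subset P v.
Hypothesis xc : gc_exp R x R + 2 <= c.
Local Notation X := (gc_exp R x).
Local Notation Z := (gc_loss R x).

Variables (N nu : nat) (g : 'I_N -> {set L}).
Hypothesis gJ : forall i, g i \subset J.
Hypothesis gnu : forall i, #|g i| = nu.
Hypothesis gd : forall i j v, v \in g i -> v \in g j -> i = j.
Hypothesis Nk : N = k * 2 ^ R.+1.
Hypothesis nuX : k ^ X R <= nu.

(* Each active family [F i] remembers in [lv i] the labelled sets already known to cover it.  A step sacrifices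
   one family to provide a set for another one; the weight [\sum_i 2 ^ size (lv i)] does not decrease, so
   some family collects [R] sets before the families run out. *)
Record config (Act : {set 'I_N}) (F : 'I_N -> {set T}) (lv : 'I_N -> seq (L * {set T})) : Prop := Config {
  cfg_sub : forall i, i \in Act -> F i \subset \bigcup_(v in g i) C v;
  cfg_mass : forall i, i \in Act -> nu * D * (N + #|Act|) <= #|F i| * k ^ X (size (lv i)) * N;
  cfg_leaf : forall i l, i \in Act -> l \in lv i -> [/\ l.1 \in J, l.2 \subset C l.1 & F i \subset nb e l.2];
  cfg_lab : forall i i' l, i \in Act -> i' \in Act -> l \in lv i -> l.1 \notin g i';
  cfg_uniq : forall i, i \in Act -> uniq (map fst (lv i));
  cfg_anti : forall i l l', i \in Act -> l \in lv i -> l' \in lv i -> l.1 != l'.1 -> anti e l.2 l'.2;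
  cfg_cross : forall i i' l, i \in Act -> i' \in Act -> i != i' -> l \in lv i -> anti e l.2 (F i')
}.

Definition weight (Act : {set 'I_N}) (lv : 'I_N -> seq (L * {set T})) :=
  \sum_(i in Act) 2 ^ size (lv i).

Lemma N0 : 0 < N. Proof. by rewrite Nk muln_gt0 k0 expn_gt0. Qed.

Lemma cfg_mass1 Act F lv i : config Act F lv -> i \in Act ->
  nu * D <= #|F i| * k ^ X (size (lv i)).
Proof.
move=> h iA; rewrite -(leq_pmul2r N0); apply: leq_trans (cfg_mass h iA).
by rewrite leq_mul2l leq_addr orbT.
Qed.

(** Among [k] families of the lowest level [j], [teeth_cross] finds a family [a] with a class
    covering much of another one; [minimal_cover] shrinks the covering set to [S], which may serve a
    different family [tau]. Giving up [a] costs [2 ^ j]; the term of [tau], whose level is at least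
    [j], doubles and makes up for it. *)
Lemma config_step Act F lv j : config Act F lv ->
  (forall i, i \in Act -> j <= size (lv i) < R) -> k <= #|[set i in Act | size (lv i) == j]| ->
  exists Act' F' lv', [/\ config Act' F' lv', #|Act'| < #|Act|,
    forall i, i \in Act' -> j <= size (lv' i) <= R & weight Act lv <= weight Act' lv'].
Proof.
move=> h lvj kA.
have jR : j < R.
  have : 0 < #|[set i in Act | size (lv i) == j]| by apply: leq_trans kA.
  by case/card_gt0P => i; rewrite inE => /andP[/lvj /andP[a b] _]; apply: leq_ltn_trans b.
pose E := enum [set i in Act | size (lv i) == j].
have szE : k <= size E by rewrite -cardE.
have [d0 _] : exists d0 : 'I_N, True by exists (Ordinal N0).
pose en i := nth d0 E i.
have enP i : i < k -> en i \in Act /\ size (lv (en i)) = j.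
  move=> ik; have : en i \in E by rewrite mem_nth // (leq_trans ik).
  by rewrite mem_enum inE => /andP[a /eqP].
have subP i : i \in Act -> F i \subset \bigcup_(v in g i) P v.
  move=> iA; apply: subset_trans (cfg_sub h iA) _.
  apply/bigcupsP => v vg; apply: subset_trans (CP _) (bigcup_sup v vg).
  exact: subsetP (gJ i) _ vg.
have nu0 : 0 < nu by apply: leq_trans nuX.
have Xj : X j + 2 <= c by apply: leq_trans xc; rewrite leq_add2r gc_exp_mono // ltnW.
have [|||||||i0 [j0 [v [i0k j0k ij0 vg hv]]]] := teeth_cross (F := fun i => F (en i)) (g := fun i => g (en i)) (nu := nu) (x := X j) (z := Z j) tP.
- by move=> i /enP[/subP].
- by move=> i _; apply: gnu.
- move=> i i2 w ik jk wi wj; apply/eqP; have /eqP := gd wi wj.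
  by rewrite nth_uniq ?enum_uniq // (leq_trans _ szE).
- by [].
- by move=> i /enP[iA <-]; apply: cfg_mass1 iA.
- by [].
- by rewrite /gc_loss leq_addr.
have [aA aj] := enP _ i0k; have [bA bj] := enP _ j0k.
have ab : en i0 != en j0.
  apply: contra ij0; rewrite nth_uniq ?enum_uniq //; exact: leq_trans szE.
set a := en i0 in aA aj ab vg hv *; set b := en j0 in bA bj ab hv *.
have F0 i : i \in Act -> 0 < #|F i|.
  move=> /(cfg_mass1 h); have : 0 < nu * D by rewrite muln_gt0 nu0.
  move=> q1 q2; rewrite lt0n; apply: contraTneq q2 => ->; by rewrite mul0n -ltnNge.
(* Degrees are at most [D], so this lower bound makes a single vertex cover at most a proportion
   [1 / k ^ Z j] of each family, as [minimal_cover] requires. *)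
have Fz i : i \in Act -> D * k ^ Z j <= #|F i|.
  move=> iA; have /andP[l1 l2] := lvj _ iA.
  have h1 := cfg_mass1 h iA; rewrite -(leq_pmul2r (kx (X (size (lv i))))).
  apply: leq_trans h1; rewrite -mulnA -expnD mulnC leq_mul2r.
  apply/orP; right; apply: leq_trans nuX; rewrite leq_pexp2l //.
  apply: leq_trans (gc_exp_mono R x l2); rewrite gc_expS addnC leq_add2l.
  exact: gc_loss_mono.
have Uin y i : i \in Act -> y \in F i -> y \in \bigcup_v P v.
  by move=> /subP/subsetP iA /iA/bigcupP[w _ yw]; apply/bigcupP; exists w.
have [|||S SQ [tau tA [hS oS]]] := @minimal_cover _ e _ F (k ^ Z j) (Act :\ a) (P v :&: F a).
- by move=> i /setD1P[_ /F0].
- move=> y i /setIP[yP _] /setD1P[_ iA]; apply: leq_trans (Fz i iA).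
  rewrite leq_mul2r; apply/orP; right.
  have yU : y \in \bigcup_v P v by apply/bigcupP; exists v.
  apply: leq_trans (teeth_deg tP yU); apply: subset_leq_card.
  by apply/subsetP => w; rewrite !inE => /andP[-> /(Uin _ _ iA) ->].
- by exists b => //; rewrite !inE eq_sym ab.
have vJ : v \in J by apply: subsetP vg.
have SC : S \subset C v.
  apply/subsetP => y yS; have /setIP[yP yF] := subsetP SQ _ yS.
  have /bigcupP[w wg yC] := subsetP (cfg_sub h aA) _ yF.
  by rewrite (Pd yP (subsetP (CP (subsetP (gJ a) _ wg)) _ yC)).
have SF : S \subset F a by apply: subset_trans SQ (subsetIr _ _).
have [ta tAct] := setD1P tA.
exists (Act :\ a), (fun i => if i == tau then F i :&: nb e S else F i :\: nb e S),
  (fun i => if i == tau then (v, S) :: lv i else lv i).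
have F'F i : (if i == tau then F i :&: nb e S else F i :\: nb e S) \subset F i.
  by case: ifP => _; rewrite ?subsetIl ?subsetDl.
have cA : #|Act| = #|Act :\ a|.+1 by rewrite (cardsD1 a) aA.
split.
- split.
  + by move=> i /setD1P[_ iA]; apply: subset_trans (F'F i) (cfg_sub h iA).
  (* A family other than [tau] loses at most a proportion [1 / (N + #|Act|)]. This is paid for by
     the factor [N + #|Act|], which drops by one; over the whole run it stays between [N] and
     [2 * N], so all these losses together cost a factor 2. *)
  + move=> i iA'; have /setD1P[_ iA] := iA'; have hm := cfg_mass h iA.
    rewrite cA addnS in hm; set n := N + _ in hm *.
    case: eqP => [->|_].
      have hm' := cfg_mass h tAct; rewrite cA addnS -/n in hm'.
      rewrite /= expnD -/(gc_loss R x _) setIC.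
      have l1 : k ^ Z j <= k ^ Z (size (lv tau)).
        by rewrite leq_pexp2l // gc_loss_mono //; have /andP[l1 _] := lvj _ tAct.
      have l2 := leq_trans hS (leq_mul (leqnn #|nb e S :&: F tau|) l1).
      apply: (@leq_trans (nu * D * n.+1)); first by rewrite leq_mul2l leqnSn orbT.
      apply: leq_trans hm' _; rewrite leq_mul2r; apply/orP; right.
      by rewrite mulnCA mulnC leq_mul2l l2 orbT.
    have h1 := oS i iA'.
    have h2 : #|F i| = #|nb e S :&: F i| + #|F i :\: nb e S| by rewrite setIC cardsID.
    have hN : 2 * n.+1 <= k ^ Z j.
      have e1 : n.+1 <= 2 * N.
        have : #|Act| <= N by rewrite -[N in _ <= N]card_ord max_card.
        rewrite cA /n => a1; clear - a1; lia.
      have e2 : k ^ (R.+1 + 3) <= k ^ Z j by rewrite leq_pexp2l // /gc_loss; clear; lia.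
      apply: leq_trans e2; rewrite expnD expnS Nk in e1 *.
      have e3 : 2 ^ R.+1 <= k ^ R.+1 by rewrite leq_exp2r.
      have e4 : k * 2 * 2 <= k ^ 3 by rewrite !expnS muln1 -!mulnA leq_mul2l leq_mul ?orbT.
      apply: (@leq_trans (2 ^ R.+1 * (k * 2 * 2))); first by move: (n.+1) (2 ^ R.+1) e1 => n1 w e1; clear - e1; lia.
      by rewrite -expnS leq_mul.
    move: hm; rewrite h2; move: #|nb e S :&: F i| #|F i :\: _| (k ^ X _) h1 h2 => A B y h1 h2 hm.
    rewrite h2 in h1.
    have h3 : A * n.+1 <= A + B.
      have := leq_mul (leqnn A) hN; rewrite mulnCA => h4; have := leq_trans h4 h1.
      by rewrite leq_pmul2l.
    have h4 : (A + B) * n <= B * n.+1 by rewrite mulnS in h3; rewrite mulnS mulnDl; clear - h3; lia.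
    rewrite -(leq_pmul2r (ltn0Sn n)).
    have := leq_mul hm (leqnn n); have := leq_mul h4 (leqnn (y * N)).
    set q := nu * D; move: (n.+1) => n'.
    have -> : (A + B) * n * (y * N) = (A + B) * y * N * n by clear; lia.
    have -> : B * n' * (y * N) = B * y * N * n' by clear; lia.
    have -> : q * n' * n = q * n * n' by clear; lia.
    by move=> a1 a2; apply: leq_trans a2 a1.
  + move=> i l /setD1P[ia iA]; case: (eqVneq i tau) => [-> |nt].
      rewrite inE => /orP[/eqP->|/(cfg_leaf h tAct)[e1 e2 e3]] /=; split=> //; first exact: subsetIr.
      exact: subset_trans (subsetIl _ _) e3.
    move=> /(cfg_leaf h iA)[e1 e2 e3]; split=> //; exact: subset_trans (subsetDl _ _) e3.
  + move=> i i' l /setD1P[_ iA] /setD1P[i'a i'A]; case: eqVneq => [->|_].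
      rewrite inE => /orP[/eqP->|/(cfg_lab h tAct i'A)//] /=.
      by apply: contra i'a => vi; apply/eqP; apply: gd vi vg.
    exact: (cfg_lab h iA i'A).
  + move=> i /setD1P[_ iA]; case: eqVneq => [->|_]; last exact: (cfg_uniq h iA).
    rewrite /= (cfg_uniq h tAct) andbT; apply/negP => /mapP[l lt vl].
    by have := cfg_lab h tAct aA lt; rewrite -vl vg.
  + have key l : l \in lv tau -> anti e l.2 S.
      by move=> lt; apply: antiS (cfg_cross h tAct aA ta lt).
    move=> i l l' /setD1P[_ iA]; case: eqVneq => [->|_]; last by move=> lt l1t; apply: (cfg_anti h iA lt l1t).
    rewrite !inE => /orP[/eqP->|lt] /orP[/eqP->|l't] //=.
    * by rewrite eqxx.
    * by move=> _; apply/(anti_sym (teeth_sym tP))/key.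
    * by move=> _; apply: key.
    * exact: (cfg_anti h tAct).
  + move=> i i' l /setD1P[_ iA] /setD1P[_ i'A] ii'; case: (eqVneq i tau) => [ei|_].
      rewrite -ei eq_sym (negbTE ii').
      rewrite inE => /orP[/eqP->|lt] /=; first exact: anti_nb.
      exact: antiS (subsetDl _ _) (cfg_cross h iA i'A ii' lt).
    by move=> lt; apply: antiS (F'F i') (cfg_cross h iA i'A ii' lt).
- by rewrite cA.
- move=> i /setD1P[_ iA]; have /andP[h1 h2] := lvj _ iA.
  by case: eqP => _ /=; rewrite ?h2 ?(ltnW h2) ?h1 // ltnW ?ltnS.
- rewrite /weight (big_setD1 a) //= [X in _ + X](big_setD1 tau) //=.
  rewrite [X in _ <= X](big_setD1 tau) //= eqxx /= expnS aj.
  have /andP[h1 _] := lvj _ tAct.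
  have h2 : 2 ^ j <= 2 ^ size (lv tau) by rewrite leq_exp2l.
  have -> : \sum_(i in Act :\ a :\ tau) 2 ^ size (if i == tau then (v, S) :: lv i else lv i) =
     \sum_(i in Act :\ a :\ tau) 2 ^ size (lv i).
    by apply: eq_bigr => i /setD1P[/negbTE-> _].
  by rewrite addnA leq_add2r mul2n -addnn leq_add2r.
Qed.

(** Steps are made at the lowest level [j] while [k] families are there. The fewer than [k] left
    over are then dropped; this costs at most [k * 2 ^ j], exactly the slack gained in the invariant
    when [j] becomes [j.+1]. At [j = R] the weight is still at least [k * 2 ^ R], so an active
    family of level [R] exists. *)
Lemma config_loop n (Act : {set 'I_N}) F lv j : #|Act| + (R - j) <= n -> j <= R -> config Act F lv ->
  (forall i, i \in Act -> j <= size (lv i) <= R) -> k * 2 ^ R.+1 <= weight Act lv + k * 2 ^ j ->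
  exists Act F lv i, [/\ config Act F lv, i \in Act & size (lv i) = R].
Proof.
elim: n Act F lv j => [|n IH] Act F lv j.
  rewrite leqn0 addn_eq0 cards_eq0 => /andP[/eqP-> /eqP Rj] jR _ _.
  rewrite /weight big_set0 add0n leq_pmul2l // leq_exp2l // leqNgt.
  by rewrite ltnS jR.
move=> hn jR h hj hw.
case: (boolP [exists i in Act, R <= size (lv i)]) => [/exists_inP[i iA hi]|].
  by exists Act, F, lv, i; split=> //; apply/eqP; rewrite eqn_leq hi; case/andP: (hj i iA) => _ ->.
rewrite negb_exists => /forallP hR.
have {}hR i : i \in Act -> size (lv i) < R by move=> iA; have := hR i; rewrite iA -ltnNge.
have [kA|kA] := leqP k #|[set i in Act | size (lv i) == j]|.
  have [|Act' [F' [lv' [h' cA' hj' hw']]]] := @config_step Act F lv j h _ kA.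
    by move=> i iA; rewrite hR //; case/andP: (hj i iA) => ->.
  apply: (IH Act' F' lv' j) => //; first by move: cA' hn; clear; lia.
  by apply: leq_trans hw _; rewrite leq_add2r.
have [jR'|jR'] := eqVneq j R.
  case: (set_0Vmem Act) => [A0|[i iA]]; last by have := hR i iA; rewrite -jR' ltnNge; case/andP: (hj i iA) => ->.
  move: hw; rewrite A0 /weight big_set0 add0n leq_pmul2l // leq_exp2l // leqNgt.
  by rewrite ltnS jR.
have jR2 : j < R by rewrite ltn_neqAle jR'.
set B := [set i in Act | size (lv i) == j] in kA.
have BA : B \subset Act by apply/subsetP => i; rewrite inE => /andP[].
have sub i : i \in Act :\: B -> i \in Act by move=> /setDP[].
apply: (IH (Act :\: B) F lv j.+1) => //.
- have := subset_leq_card (subsetDl Act B); move: hn jR2; clear; lia.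
- case: h => h1 h2 h3 h4 h5 h6 h7; split.
  + by move=> i /sub; apply: h1.
  + move=> i /sub iA; apply: leq_trans (h2 i iA).
    by rewrite leq_mul2l leq_add2l subset_leq_card ?subsetDl ?orbT.
  + by move=> i l /sub; apply: h3.
  + by move=> i i' l /sub iA /sub; apply: h4.
  + by move=> i /sub; apply: h5.
  + by move=> i l l' /sub; apply: h6.
  + by move=> i i' l /sub iA /sub; apply: h7.
- move=> i /setDP[iA]; rewrite inE iA /= => ne; case/andP: (hj i iA) => h1 ->; by rewrite ltn_neqAle eq_sym ne h1.
- apply: leq_trans hw _; rewrite /weight (big_setID B) /= (setIidPr BA).
  rewrite -addnA addnCA leq_add2l expnS.
  have : \sum_(i in B) 2 ^ size (lv i) <= k * 2 ^ j.
    apply: (@leq_trans (#|B| * 2 ^ j)); last by rewrite leq_mul2r ltnW ?orbT.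
    by rewrite -sum_nat_const; apply: leq_sum => i; rewrite inE => /andP[_ /eqP->].
  by rewrite mul2n -addnn mulnDr leq_add2r.
Qed.
End Groups.

Definition gc_out R x := (gc_exp R x R).+1.
Definition gc_lab R x := gc_exp R x R + R + 4.

(** The labels are cut into [N] equal parts, one family for each. The family that reaches level [R]
    yields the [R] sets, and [many_heavy] turns its remaining mass into many labels whose classes
    are still dense. The exponent [gc_lab] pays for keeping one part out of [N] and for this last
    selection. *)
Lemma group_creation (T L : finType) (e : rel T) (P : L -> {set T}) (D k s c R x : nat)
    (J : {set L}) (C : L -> {set T}) :
  teeth e P D k s c -> gc_exp R x R + 2 <= c ->
  (forall v, v \in J -> C v \subset P v) -> (forall v, v \in J -> D <= #|C v| * k ^ x) ->
  k ^ gc_lab R x <= #|J| ->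
  exists (vs : nat -> L) (S : nat -> {set T}) (J' : {set L}) (C' : L -> {set T}),
  [/\ forall t, t < R -> vs t \in J /\ S t \subset C (vs t),
      forall t t', t < R -> t' < R -> t != t' -> vs t != vs t' /\ anti e (S t) (S t'),
      J' \subset J /\ (forall t, t < R -> vs t \notin J'), #|J| <= #|J'| * k ^ gc_lab R x &
      forall v, v \in J' -> [/\ C' v \subset C v, D <= #|C' v| * k ^ gc_out R x &
        forall t, t < R -> C' v \subset nb e (S t)]].
Proof.
move=> tP xc CP Cx hJ.
have k2 := teeth_k tP; have Pd := teeth_disj tP; have D0 := teeth_D0 tP.
have k0 : 0 < k by apply: leq_trans k2.
have kx y : 0 < k ^ y by rewrite expn_gt0 k0.
pose N := k * 2 ^ R.+1; pose nu := #|J| %/ N.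
have N0' : 0 < N by rewrite muln_gt0 k0 expn_gt0.
have Nk : N <= k ^ (R + 2).
  by rewrite addn2 expnS leq_mul2l leq_exp2r ?k2 ?orbT.
have nuX : k ^ gc_exp R x R <= nu.
  rewrite leq_divRL //; apply: leq_trans hJ.
  apply: leq_trans (leq_mul (leqnn _) Nk) _; rewrite -expnD leq_pexp2l // /gc_lab; clear; lia.
have nu0 : 0 < nu by apply: leq_trans nuX.
have [g [gJ gnu gd]] : exists g : nat -> {set L}, [/\ forall i, g i \subset J,
    forall i, i < N -> #|g i| = nu & forall i j v, v \in g i -> v \in g j -> i = j].
  by apply: equal_parts; rewrite leq_divM.
pose g' (i : 'I_N) := g i.
have gJ' i : g' i \subset J by apply: gJ.
have gnu' i : #|g' i| = nu by apply: gnu.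
have gd' i j v : v \in g' i -> v \in g' j -> i = j by move=> vi vj; apply/val_inj/(gd _ _ v).
pose F (i : 'I_N) := \bigcup_(v in g' i) C v.
have Cg i v : v \in g' i -> C v \subset F i :&: P v.
  move=> vg; rewrite subsetI CP ?(subsetP (gJ' i)) // andbT.
  exact: bigcup_sup vg.
have FP i : F i \subset \bigcup_(v in g' i) P v.
  apply/bigcupsP => v vg; apply: subset_trans (CP _ (subsetP (gJ' i) _ vg)) _.
  exact: bigcup_sup vg.
have [|||||Act [F' [lv [i [h iA hi]]]]] := config_loop tP CP xc gJ' gnu' gd' (erefl N) nuX
   (n := N + R) (Act := setT) (F := F) (lv := fun=> [::]) (j := 0).
- by rewrite subn0 leq_add2r -[X in _ <= X]card_ord max_card.
- by [].
- split=> //.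
  (* At the start all families are active and the factor is [2 * N]; this 2 is why [gc_exp] starts
     at [x.+1] rather than [x]. *)
  + move=> i _ /=; rewrite cardsT card_ord.
    have h1 : nu * D <= #|F i| * k ^ x.
      apply: (@leq_trans ((\sum_(v in g' i) #|F i :&: P v|) * k ^ x)); last by rewrite leq_mul2r sum_cap ?orbT.
      rewrite big_distrl /= -(gnu' i) -sum_nat_const; apply: leq_sum => v vg.
      apply: leq_trans (Cx _ (subsetP (gJ' i) _ vg)) _; rewrite leq_mul2r subset_leq_card ?orbT //.
      exact: Cg.
    rewrite addnn -muln2 mulnA [_ * N * 2]mulnAC leq_mul2r; apply/orP; right.
    by rewrite expnS [_ * 2]mulnC [X in _ <= X]mulnCA leq_mul.
- by [].
- rewrite /weight sum_nat_const cardsT card_ord muln1.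
  exact: leq_addr.
have [v0 _] : exists v0, v0 \in J.
  by apply/card_gt0P; apply: leq_trans hJ; apply: kx.
pose d := (v0, set0 : {set T}).
have dP t : t < R -> nth d (lv i) t \in lv i by move=> tR; rewrite mem_nth // hi.
have F'P : F' i \subset \bigcup_(v in g' i) P v.
  apply: subset_trans (cfg_sub h iA) _; apply/bigcupsP => v vg.
  apply: subset_trans (CP _ (subsetP (gJ' i) _ vg)) _; exact: bigcup_sup vg.
have hm := cfg_mass1 tP (erefl N) h iA; rewrite hi in hm.
pose q := k ^ gc_exp R x R.
have vu t t' : t < R -> t' < R -> t != t' -> (nth d (lv i) t).1 != (nth d (lv i) t').1.
  move=> tR t'R tt'; rewrite -!(nth_map d v0 fst) ?hi // nth_uniq ?size_map ?hi //.
  exact: (cfg_uniq h iA).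
exists (fun t => (nth d (lv i) t).1), (fun t => (nth d (lv i) t).2),
  [set v in g' i | D <= #|F' i :&: P v| * (2 * q)], (fun v => F' i :&: P v); split.
- by move=> t /dP /(cfg_leaf h iA)[].
- move=> t t' tR t'R tt'; split; first exact: vu.
  by apply: (cfg_anti h iA (dP _ tR) (dP _ t'R)); apply: vu.
- split; first by apply/subsetP => v; rewrite inE => /andP[/(subsetP (gJ' i))].
  by move=> t /dP tR; rewrite inE (negbTE (cfg_lab h iA iA tR)).
- have h1 : nu <= 2 * q * #|[set v in g' i | D <= #|F' i :&: P v| * (2 * q)]|.
    apply: many_heavy D0 F'P _ (gnu' i) hm => v _.
    by apply: leq_trans (teeth_size tP v); rewrite subset_leq_card ?subsetIr.
  set J' := #|_| in h1 *.
  have h2 : #|J| <= 2 * (nu * N).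
    have := divn_eq #|J| N; have := ltn_pmod #|J| N0'; rewrite -/nu => l1 l2.
    have := leq_mul nu0 (leqnn N); rewrite mul1n; clear - l1 l2; lia.
  apply: leq_trans h2 _.
  have h3 : 4 * N * q <= k ^ gc_lab R x.
    rewrite /gc_lab -addnA expnD -/q mulnC leq_mul2l; apply/orP; right.
    have -> : R + 4 = 2 + (R + 2) by clear; lia.
    by rewrite expnD leq_mul // -[4]/(2 ^ 2) leq_exp2r.
  apply: (@leq_trans (J' * (4 * N * q))); last by rewrite leq_mul2l h3 orbT.
  have := leq_mul h1 (leqnn N); move: (nu * N) => w hw; clear - hw; lia.
- move=> v; rewrite inE => /andP[vg hv]; split.
  + apply/subsetP => y /setIP[yF yP]; have /bigcupP[w wg yC] := subsetP (cfg_sub h iA) _ yF.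
    by rewrite (Pd _ _ _ yP (subsetP (CP _ (subsetP (gJ' i) _ wg)) _ yC)).
  + apply: leq_trans hv _; rewrite leq_mul2l /gc_out expnS leq_mul2r k2; by rewrite !orbT.
  + move=> t /dP /(cfg_leaf h iA)[_ _ hs]; apply: subset_trans hs; exact: subsetIl.
Qed.

(** * Models of 2-subdivisions, and superdense teeth *)

Section Model.
Variables (V E : finType) (e1 e2 : E -> V).

(** The path replacing [a] is [b (e1 a)], [p a], [q a], [b (e2 a)]. Injectivity is asked of [b]
    because isolated branch vertices look alike; all other vertices are told apart by their
    neighbours. *)
Definition sub2_model (T : finType) (e : rel T) : Prop :=
  exists (b : V -> T) (p q : E -> T),
  [/\ injective b, (forall u w, ~~ e (b u) (b w)) /\
      (forall u a, e (b u) (p a) = (u == e1 a) /\ e (b u) (q a) = (u == e2 a)),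
      forall a a', ~~ e (p a) (p a') /\ ~~ e (q a) (q a') &
      forall a a', e (p a) (q a') = (a == a')].


(** Every branch vertex [x u] has one private leaf [y a u] for each edge [a], and leaves of
    different edges never meet. So only the two leaves of index [a] at the ends of [a] are used, and
    how the remaining leaves of index [a] meet each other does not matter. *)
Lemma star_model (T : finType) (e : rel T) (x : V -> T) (y : E -> V -> T) :
  irreflexive e -> injective x ->
  (forall u w, ~~ e (x u) (x w)) -> (forall u a w, e (x u) (y a w) = (u == w)) ->
  (forall a a' u w, a != a' -> ~~ e (y a u) (y a' w)) ->
  (forall a, e (y a (e1 a)) (y a (e2 a))) -> sub2_model e.
Proof.
move=> irr xinj xx xy yy ye.
exists x, (fun a => y a (e1 a)), (fun a => y a (e2 a)); split.
- by [].
- by split=> // u a; rewrite !xy.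
- by move=> a a'; case: (eqVneq a a') => [->|aa']; [rewrite !irr | split; apply: yy].
- by move=> a a'; case: (eqVneq a a') => [->|aa']; [rewrite ye | apply/negbTE/yy].
Qed.
End Model.

Section Superdense.
Variables (T L : finType) (e : rel T) (P : L -> {set T}) (D k s c : nat).
Hypothesis tP : teeth e P D k s c.
Let k2 := teeth_k tP.
Let Pd := teeth_disj tP.
Let D0 := teeth_D0 tP.
Let k0 : 0 < k. Proof. exact: leq_trans k2. Qed.
Let kx x : 0 < k ^ x. Proof. by rewrite expn_gt0 k0. Qed.
Variables (m r x a : nat) (J : {set L}) (O : L -> {set T}).
Hypothesis OP : forall v, v \in J -> O v \subset P v.
Hypothesis Ox : forall v, v \in J -> D <= #|O v| * k ^ x.
Hypothesis Od : forall v y, v \in J -> y \in O v -> #|O v :\: [set z | e y z]| * k ^ (r * a + 2) <= #|O v|.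
Hypothesis Ja : #|J| <= k ^ a.
Hypothesis Jl : k ^ (gc_lab r x.+1).+1 <= #|J|.
Hypothesis mk : m * r.+1 <= k.
Hypothesis hc : gc_exp r x.+1 r + 2 <= c.
Hypothesis hs : x + (r * a + 2) <= s.

(* A tuple [vs] of classes is good if deleting a small proportion of each class leaves claws centred in many
   classes, with one leaf in each [O (vs i)].  If no tuple were good, deleting the witnesses for all tuples at
   once would contradict [group_creation]. *)
Definition claw (Z : {set T}) (vs : 'I_r -> L) (w : L) (b : T) (y : 'I_r -> T) : bool :=
  [&& b \in O w, b \notin Z & [forall i, [&& y i \in O (vs i), y i \notin Z, e b (y i) &
     [forall j, (i != j) ==> ~~ e (y i) (y j)]]]].

Definition claw_labels Z (vs : 'I_r -> L) :=
  [set w in J | [forall i, vs i != w] && [exists b, [exists y : {ffun 'I_r -> T}, claw Z vs w b y]]].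

Definition small_set (Z : {set T}) := [forall v in J, #|Z :&: O v| * k ^ (r * a).+1 <= #|O v|].

Lemma good_tuple : exists vs : 'I_r -> L, [/\ injective vs, forall i, vs i \in J &
  forall Z, small_set Z -> m <= #|claw_labels Z vs|].
Proof.
case: (boolP [exists vs : {ffun 'I_r -> L}, [&& injectiveb vs, [forall i, vs i \in J] &
  [forall Z, small_set Z ==> (m <= #|claw_labels Z vs|)]]]).
  move=> /existsP[vs /and3P[/injectiveP h1 /forallP h2 /forallP h3]].
  by exists vs; split=> // Z sZ; apply: (implyP (h3 Z)).
rewrite negb_exists => /forallP H.
have : forall vs : {ffun 'I_r -> L}, exists Z, (injective vs -> (forall i, vs i \in J) ->
   #|claw_labels Z vs| < m) /\ small_set Z.
  move=> vs; have := H vs; rewrite !negb_and => /or3P[h|h|h].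
  - exists set0; split; first by move/injectiveP => h'; rewrite h' in h.
    by apply/forall_inP => v _; rewrite set0I cards0.
  - exists set0; split; first by move=> _ /forallP h'; rewrite h' in h.
    by apply/forall_inP => v _; rewrite set0I cards0.
  - move: h; rewrite negb_forall => /existsP[Z]; rewrite negb_imply -ltnNge => /andP[sZ hZ].
    by exists Z.
move=> /fin_all_exists[Zf hZf].
pose tup := [set vs : {ffun 'I_r -> L} | [forall i, vs i \in J]].
pose Z := \bigcup_(vs in tup) Zf vs.
have ctup : #|tup| = #|J| ^ r.
  rewrite -[r in RHS]card_ord -card_ffun_on; apply: eq_card => vs; rewrite inE.
  by apply/forallP/ffun_onP.
(* There are at most [k ^ (r * a)] tuples, and each witness removes at most a proportion
   [1 / k ^ (r * a).+1] of a class; together they remove at most [1 / k]. *)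
have hZ v : v \in J -> #|Z :&: O v| * k <= #|O v|.
  move=> vJ; rewrite -(leq_pmul2r (kx (r * a))) -mulnA -expnS big_distrl /=.
  have h1 := leq_mul (card_bigcup (mem tup) (fun vs => Zf vs :&: O v)) (leqnn (k ^ (r * a).+1)).
  apply: leq_trans h1 _; rewrite big_distrl /=.
  apply: (@leq_trans (#|tup| * #|O v|)).
    rewrite -sum_nat_const; apply: leq_sum => vs _.
    by have [_ /forall_inP] := hZf vs; apply.
  rewrite mulnC leq_mul2l; apply/orP; right; rewrite ctup mulnC expnM.
  by case: (r) => // r'; rewrite leq_exp2r.
have [|||vs [S [J' [C' [h1 h2 [h3a h3b] h4 h5]]]]] := group_creation (C := fun v => O v :\: Z) (x := x.+1) (R := r) (J := J) tP hc.
- by move=> v vJ; apply: subset_trans (subsetDl _ _) (OP vJ).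
- move=> v vJ; have z1 := hZ v vJ; have z2 := Ox vJ.
  have z3 : #|O v| <= 2 * #|O v :\: Z|.
    have := leq_trans (leq_mul (leqnn #|Z :&: O v|) k2) z1; rewrite setIC.
    have := cardsID Z (O v); clear; lia.
  apply: leq_trans z2 _; rewrite expnS mulnA leq_mul2r; apply/orP; right.
  by apply: leq_trans z3 _; rewrite mulnC leq_mul2l k2 orbT.
- by apply: leq_trans Jl; rewrite leq_pexp2l.
have J'm : m <= #|J'|.
  apply: (@leq_trans k); first by apply: leq_trans mk; rewrite leq_pmulr.
  rewrite -(leq_pmul2r (kx (gc_lab r x.+1))); apply: leq_trans h4.
  by rewrite -expnS.
pose vf : {ffun 'I_r -> L} := [ffun i : 'I_r => vs i].
have [hlt sZ] := hZf vf.
have vfJ i : vf i \in J by rewrite ffunE; have [] := h1 i (ltn_ord i).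
have vfi : injective vf.
  move=> i j; rewrite !ffunE => vij; apply/eqP; apply: contraT => ij.
  by have [/eqP] := h2 i j (ltn_ord i) (ltn_ord j) ij.
case/negP: (ltnn m); apply: leq_ltn_trans (hlt vfi vfJ); apply: leq_trans J'm _.
apply: subset_leq_card; apply/subsetP => w wJ'.
rewrite inE (subsetP h3a) //=; apply/andP; split.
  by apply/forallP => i; rewrite ffunE; apply: contraNneq (h3b i (ltn_ord i)) => ->.
have [C1 C2 C3] := h5 w wJ'.
have [b bC] : exists b, b \in C' w.
  apply/card_gt0P; rewrite lt0n; apply: contraTneq C2 => ->.
  by rewrite mul0n -ltnNge.
have : forall i : 'I_r, exists y, y \in S i /\ e y b.
  by move=> i; have /nbP[y yS eyb] := subsetP (C3 i (ltn_ord i)) _ bC; exists y.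
move=> /fin_all_exists[y hy].
have /setDP[bO bZ] := subsetP C1 _ bC.
have Zsub : Zf vf \subset Z.
  by apply: (bigcup_sup vf); rewrite inE; apply/forallP.
apply/existsP; exists b; apply/existsP; exists [ffun i => y i].
apply/and3P; split=> //; first by apply: contra bZ; apply: subsetP.
apply/forallP => i; have [yS eyb] := hy i.
have [_ /subsetP/(_ _ yS)/setDP[yO yZ]] := h1 i (ltn_ord i).
rewrite !ffunE; apply/and4P; split=> //.
- by apply: contra yZ; apply: subsetP.
- by rewrite (teeth_sym tP).
- apply/forallP => j; rewrite ffunE; apply/implyP => ij.
  have [_ an] := h2 i j (ltn_ord i) (ltn_ord j) ij.
  by apply: an => //; have [] := hy j.
Qed.

Definition star_partial (vs : 'I_r -> L) n (w : nat -> L) (b : nat -> T) (y : nat -> 'I_r -> T) :=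
  (forall u, u < n -> [/\ w u \in J /\ (forall i, vs i != w u), b u \in O (w u),
      forall i, y u i \in O (vs i) /\ e (b u) (y u i) & forall i j, i != j -> ~~ e (y u i) (y u j)]) /\
  (forall u u', u < u' -> u' < n -> [/\ w u != w u', ~~ e (b u) (b u'),
      forall i, ~~ e (b u) (y u' i) /\ ~~ e (y u i) (b u') &
      forall i j, e (y u i) (y u' j) = (i == j)]).

(** Claws are picked one after another, and [Z] collects the vertices with a wrong adjacency to an
    earlier claw. In the class containing leaf [i] of an earlier claw, the vertices wrong for that
    leaf are its non-neighbours, few because the class is superdense; in every other class they are
    its neighbours, few by [teeth_sparse]. Nothing is known inside the class of an earlier centre,
    so a new centre must avoid the labels already taken: this is why a good tuple offers [m] labels
    and not just one. *)
Lemma star_select vs n : injective vs -> (forall i, vs i \in J) ->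
  (forall Z, small_set Z -> m <= #|claw_labels Z vs|) -> n <= m ->
  exists w b y, star_partial vs n w b y.
Proof.
move=> vinj vJ good; elim: n => [_|n IH nm].
  have [w wJ] : exists w, w \in J by apply/card_gt0P; apply: leq_trans Jl; apply: kx.
  have [t _] : exists t, t \in O w.
    by apply/card_gt0P; rewrite lt0n; apply: contraTneq (Ox wJ) => ->; rewrite mul0n -ltnNge.
  by exists (fun=> w), (fun=> t), (fun _ _ => t).
have [w [b [y [h1 h2]]]] := IH (ltnW nm).
have bad (u : 'I_n) v : v \in J -> w u != v ->
   #|[set z in O v | e (b u) z || [exists i, (if vs i == v then ~~ e (y u i) z else e (y u i) z)]]| * k ^ (r * a + 2) <= r.+1 * #|O v|.
  move=> vJ' wv; have [[wJ wvs] bO yO _] := h1 u (ltn_ord u).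
  have tiny v' t : v' \in J -> v' != v -> t \in O v' -> #|[set z in O v | e t z]| * k ^ (r * a + 2) <= #|O v|.
    move=> v'J v'v tO; rewrite -(leq_pmul2r (kx x)) -mulnA -expnD.
    apply: leq_trans (Ox vJ'); apply: leq_trans (teeth_sparse tP v'v (subsetP (OP v'J) _ tO)).
    apply: leq_mul; last by rewrite leq_pexp2l // addnC.
    apply: subset_leq_card; apply/subsetP => z; rewrite !inE => /andP[zO ->]; rewrite andbT.
    exact: subsetP (OP vJ') _ zO.
  pose B i := [set z in O v | if vs i == v then ~~ e (y u i) z else e (y u i) z].
  have hB i : #|B i| * k ^ (r * a + 2) <= #|O v|.
    rewrite /B; case: eqVneq => [vv|vv]; last by have [yi _] := yO i; apply: tiny yi.
    have [yi _] := yO i; rewrite vv in yi; apply: leq_trans (Od vJ' yi).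
    rewrite leq_mul2r; apply/orP; right; apply: subset_leq_card.
    by apply/subsetP => z; rewrite !inE andbC.
  have cov : [set z in O v | e (b u) z || [exists i, (if vs i == v then ~~ e (y u i) z else e (y u i) z)]]
     \subset [set z in O v | e (b u) z] :|: \bigcup_i B i.
    apply/subsetP => z; rewrite !inE => /andP[zO /orP[->|/existsP[i hi]]]; rewrite zO //.
    by rewrite orbC; apply/orP; left; apply/bigcupP; exists i => //; rewrite inE zO.
  move/subset_leq_card: cov => /leq_trans /(_ (leq_card_setU _ _)) => cov.
  apply: leq_trans (leq_mul cov (leqnn _)) _; rewrite mulnDl mulSn leq_add ?(tiny (w u)) //.
  apply: leq_trans (leq_mul (card_bigcup _ _) (leqnn _)) _.
  by rewrite big_distrl /=; apply: leq_sum_ord.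
pose Z := [set z | [exists u : 'I_n, exists v, [&& v \in J, w u != v, z \in O v &
   e (b u) z || [exists i, (if vs i == v then ~~ e (y u i) z else e (y u i) z)]]]].
have sZ : small_set Z.
  apply/forall_inP => v vJ'.
  have cov : Z :&: O v \subset \bigcup_(u < n) (if w u != v then [set z in O v | e (b u) z || [exists i, (if vs i == v then ~~ e (y u i) z else e (y u i) z)]] else set0).
    apply/subsetP => z; rewrite !inE => /andP[/existsP[u /existsP[v' /and4P[v'J wv' zO' hz]]] zO].
    have vv : v' = v by apply: Pd (subsetP (OP v'J) _ zO') (subsetP (OP vJ') _ zO).
    by apply/bigcupP; exists u => //; rewrite -vv wv' inE zO' hz.
  rewrite -(leq_pmul2r k0) -mulnA -expnSr.
  have -> : (r * a).+2 = r * a + 2 by rewrite addn2.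
  apply: leq_trans (leq_mul (subset_leq_card cov) (leqnn _)) _.
  apply: leq_trans (leq_mul (card_bigcup _ _) (leqnn _)) _.
  rewrite big_distrl /=; apply: (@leq_trans (n * (r.+1 * #|O v|))).
    apply: leq_sum_ord => u; case: ifP => [wv|_]; first exact: bad.
    by rewrite cards0.
  rewrite mulnA mulnC leq_mul2l; apply/orP; right; apply: leq_trans mk.
  by rewrite leq_mul2r ltnW ?orbT.
have [wn wnC wnn] : exists2 wn, wn \in claw_labels Z vs & forall u, u < n -> w u != wn.
  have hg := good _ sZ; pose W := [set w u | u : 'I_n].
  have : ~~ (claw_labels Z vs \subset W).
    apply/negP => /subset_leq_card h; have := leq_trans hg h.
    apply/negP; rewrite -ltnNge; apply: leq_ltn_trans (leq_imset_card _ _) _.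
    by rewrite card_ord.
  case/subsetPn => wn wnC wnW; exists wn => // u un; apply: contra wnW => /eqP<-.
  by apply/imsetP; exists (Ordinal un).
move: wnC; rewrite inE => /and3P[wnJ /forallP wnvs /existsP[bn /existsP[yn /and3P[bnO bnZ /forallP ynP]]]].
exists (fun u => if u == n then wn else w u), (fun u => if u == n then bn else b u), (fun u => if u == n then (fun i => yn i) else y u).
split=> [u|u u' uu']; rewrite ltnS leq_eqVlt => /orP[/eqP eu|un].
- rewrite eu eqxx; split=> //.
  + by move=> i; have /and4P[] := ynP i.
  + by move=> i j ij; have /and4P[_ _ _ /forallP/(_ j)/implyP] := ynP i; apply.
- by rewrite (ltn_eqF un); apply: h1.
- rewrite eu in uu' *; rewrite eqxx (ltn_eqF uu'); have un := uu'.
  have notZ v z : v \in J -> w u != v -> z \in O v -> z \notin Z ->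
     ~~ e (b u) z /\ forall i, if vs i == v then e (y u i) z else ~~ e (y u i) z.
    move=> vJ' wv zO; rewrite inE negb_exists => /forallP/(_ (Ordinal un)).
    rewrite negb_exists => /forallP/(_ v); rewrite vJ' wv zO /= negb_or negb_exists.
    move=> /andP[-> /forallP h]; split=> // i; have := h i; case: ifP => //.
    by rewrite negbK.
  have [[wuJ wuvs] _ _ _] := h1 u un.
  have [z1 z2] := notZ wn bn wnJ (wnn u un) bnO bnZ.
  split=> //; first exact: wnn.
    move=> i; have /and4P[yO yZ _ _] := ynP i.
    have [|-> _] := notZ (vs i) (yn i) (vJ i) _ yO yZ; first by rewrite eq_sym.
    by split=> //; have := z2 i; rewrite (negbTE (wnvs i)).
  move=> i j; have /and4P[yO yZ _ _] := ynP j.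
  have [|_ /(_ i)] := notZ (vs j) (yn j) (vJ j) _ yO yZ; first by rewrite eq_sym.
  by rewrite (inj_eq vinj); case: ifP => // _ /negbTE.
- by rewrite (ltn_eqF un) (ltn_eqF (ltn_trans uu' un)); apply: h2.
Qed.
End Superdense.

(** One claw is taken for each branch vertex and one leaf class for each edge. Leaves with the same
    index are adjacent across claws, so the two at the ends of an edge complete its path. *)
Lemma superdense (V E : finType) (e1 e2 : E -> V) (T L : finType) (e : rel T) (P : L -> {set T})
    (D k s c x a : nat) (J : {set L}) (O : L -> {set T}) :
  (forall i, e1 i != e2 i) -> teeth e P D k s c ->
  (forall v, v \in J -> O v \subset P v) -> (forall v, v \in J -> D <= #|O v| * k ^ x) ->
  (forall v y, v \in J -> y \in O v -> #|O v :\: [set z | e y z]| * k ^ (#|E| * a + 2) <= #|O v|) ->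
  #|J| <= k ^ a -> k ^ (gc_lab #|E| x.+1).+1 <= #|J| -> #|V| * #|E|.+1 <= k ->
  gc_exp #|E| x.+1 #|E| + 2 <= c -> x + (#|E| * a + 2) <= s -> sub2_model e1 e2 e.
Proof.
move=> e12 tP OP Ox Od Ja Jl mk hc hs.
have [vs [vinj vJ good]] := good_tuple tP OP Ox Ja Jl mk hc.
have [w [b [y [h1 h2]]]] := star_select tP OP Ox Od Jl mk hs vinj vJ good (leqnn _).
have rV (u : V) : enum_rank u < #|V| by exact: ltn_ord.
pose xx (u : V) := b (enum_rank u); pose yy (i : E) (u : V) := y (enum_rank u) (enum_rank i).
have sy := teeth_sym tP; have irr := teeth_irr tP.
have key (Q : V -> V -> Prop) : (forall u v, Q u v -> Q v u) -> (forall u v : V, enum_rank u < enum_rank v -> Q u v) ->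
    forall u v, u != v -> Q u v.
  move=> Qs h u v uv; case: (ltngtP (enum_rank u) (enum_rank v)) => [|lt|/val_inj/enum_rank_inj e'].
  - exact: h.
  - by apply: Qs; apply: h.
  - by rewrite e' eqxx in uv.
have xnx u v : u != v -> ~~ e (xx u) (xx v).
  apply: (key (fun u v => ~~ e (xx u) (xx v))) => {}u {}v; first by rewrite sy.
  by move=> lt; have [] := h2 _ _ lt (rV v).
have xny u v : u != v -> forall i, ~~ e (xx u) (yy i v).
  move=> uv i; have : ~~ e (xx u) (yy i v) /\ ~~ e (xx v) (yy i u); last by case.
  apply: (key (fun u v => ~~ e (xx u) (yy i v) /\ ~~ e (xx v) (yy i u))) uv => {}u {}v; first by case.
  by move=> lt; have [_ _ /(_ (enum_rank i))[z1 z2] _] := h2 _ _ lt (rV v); rewrite [e (xx v) _]sy.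
have yny u v i j : u != v -> e (yy i u) (yy j v) = (i == j).
  move=> uv; have : forall i j, e (yy i u) (yy j v) = (i == j); last by apply.
  apply: (key (fun u v => forall i j, e (yy i u) (yy j v) = (i == j))) uv => {}u {}v.
    by move=> h i' j'; rewrite sy h eq_sym.
  move=> lt i' j'; have [_ _ _ h] := h2 _ _ lt (rV v).
  by rewrite h (inj_eq enum_rank_inj).
apply: (@star_model V E e1 e2 T e xx yy) => //.
- move=> u v xuv; apply/eqP; apply: contraT => uv; move: uv xuv.
  suff h a' b' : a' != b' -> xx a' <> xx b' by move=> /h.
  move: a' b'; apply: key => [u' v' h /esym //|].
  move=> {}u {}v lt xuv; have [/eqP wn _ _ _] := h2 _ _ lt (rV v); apply: wn.
  have [[wu _] bu _ _] := h1 _ (rV u); have [[wv _] bv _ _] := h1 _ (rV v).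
  rewrite -/(xx u) xuv in bu.
  by apply: (@teeth_disj _ _ _ _ _ _ _ _ tP _ _ (xx v)); [apply: subsetP (OP _ wu) _ bu | apply: subsetP (OP _ wv) _ bv].
- by move=> u v; case: (eqVneq u v) => [->|/xnx]; rewrite ?irr.
- move=> u i v; case: eqVneq => [->|uv]; last exact/negbTE/xny.
  by have [_ _ /(_ (enum_rank i))[]] := h1 _ (rV v).
- move=> i j u v ij; case: (eqVneq u v) => [->|uv]; last by rewrite yny.
  by have [_ _ _ h] := h1 _ (rV v); apply: h; rewrite (inj_eq enum_rank_inj).
- by move=> i; rewrite yny // eqxx.
Qed.

(** * Adding a group of hubs *)

Lemma tiny_remove (T I : finType) (X : {set T}) (B : I -> {set T}) D k y i z :
  0 < k -> D <= #|X| * k ^ y -> (forall j, #|B j| * k ^ z <= D) -> 2 * #|I| <= k ^ i -> y + i <= z ->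
  #|X| <= 2 * #|X :\: \bigcup_j B j|.
Proof.
move=> k0 hX hB hI hz.
have kp : 0 < k ^ (y + i) by rewrite expn_gt0 k0.
have h1 : #|\bigcup_j B j| * k ^ z <= #|I| * D.
  apply: leq_trans (leq_mul (card_bigcup _ _) (leqnn _)) _.
  by rewrite big_distrl /=; apply: leq_sum_const.
have h2 : #|\bigcup_j B j| * k ^ (y + i) <= #|I| * #|X| * k ^ y.
  rewrite -mulnA; apply: leq_trans (leq_mul (leqnn _) hX).
  by apply: leq_trans h1; rewrite leq_mul2l leq_pexp2l ?orbT.
have h3 : #|\bigcup_j B j| * k ^ i <= #|I| * #|X|.
  rewrite -(@leq_pmul2r (k ^ y)) ?expn_gt0 ?k0 //; apply: leq_trans h2.
  by rewrite expnD -mulnA [_ ^ i * _]mulnC.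
have h4 : 2 * #|\bigcup_j B j| <= #|X|.
  case: (posnP #|I|) => [I0|I0].
    move: h3; rewrite I0 mul0n leqn0 muln_eq0 => /orP[/eqP->//|].
    by rewrite expn_eq0 (gtn_eqF k0).
  rewrite -(leq_pmul2l I0); apply: leq_trans h3; rewrite mulnA mulnC leq_mul2l.
  by rewrite [#|I| * 2]mulnC hI orbT.
have := cardsID (\bigcup_j B j) X.
have : #|X :&: \bigcup_j B j| <= #|\bigcup_j B j| by rewrite subset_leq_card ?subsetIr.
by move: h4; clear; lia.
Qed.

Lemma majority (T K : finType) (vec : T -> K) (X : {set T}) : 0 < #|X| ->
  exists q, #|X| <= #|K| * #|[set x in X | vec x == q]|.
Proof.
case/card_gt0P => x0 x0X.
case: (boolP [exists q, #|X| <= #|K| * #|[set x in X | vec x == q]|]) => [/existsP//|].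
rewrite negb_exists => /forallP h; exfalso.
have s1 : #|X| = \sum_q #|[set x in X | vec x == q]|.
  under eq_bigr do rewrite -sum1_card.
  rewrite (exchange_big_dep (mem X)) /=; last by move=> q x _; rewrite inE => /andP[].
  rewrite -sum1_card; apply: eq_bigr => x xX.
  by rewrite (eq_bigl (pred1 (vec x))) ?big_pred1_eq // => q; rewrite !inE xX eq_sym.
have K0 : 0 < #|K| by apply/card_gt0P; exists (vec x0).
have : \sum_q (#|K| * #|[set x in X | vec x == q]|).+1 <= \sum_(q : K) #|X|.
  by apply: leq_sum => q _; have := h q; rewrite -ltnNge.
rewrite sum_nat_const.
under eq_bigr do rewrite -addn1.
rewrite big_split /= -big_distrr /= -s1 sum1_card.
by rewrite -{2}[#|K| * #|X|]addn0 leq_add2l leqNgt K0.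
Qed.

Lemma homogeneous_subfamily (K : finType) M M' (vec : 'I_M' -> K) :
  0 < M * #|K| -> M * #|K| <= M' ->
  exists (phi : 'I_M -> 'I_M') q, injective phi /\ forall j, vec (phi j) = q.
Proof.
move=> MK hM; have M'0 := leq_trans MK hM.
have [|q hq] := majority vec (X := setT); first by rewrite cardsT card_ord.
set X := [set x in setT | vec x == q] in hq.
have MX : M <= #|X|.
  rewrite -(@leq_pmul2r #|K|); last by apply/card_gt0P; exists q.
  by apply: leq_trans hM _; rewrite mulnC; move: hq; rewrite cardsT card_ord mulnC.
exists (fun j => enum_val (widen_ord MX j)), q; split.
  by move=> i j /enum_val_inj/(congr1 val)/= /val_inj.
by move=> j; have := enum_valP (widen_ord MX j); rewrite inE => /andP[_ /eqP].
Qed.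

(** This is the exponent [r * a + 2] of [superdense], with [k ^ a] the least number of labels that
    lemma accepts for classes of density [1 / k ^ y]. *)
Definition pre_rho r y := r * (gc_lab r y.+1).+1 + 2.
Fixpoint pre_exp r x n := if n is n'.+1 then pre_exp r x n' + pre_rho r (pre_exp r x n') + 1 else x.

Lemma pre_exp_mono r x : {homo pre_exp r x : n n' / n <= n'}.
Proof. by apply: homo_leq leq_trans _ => // n /=; rewrite -addnA leq_addr. Qed.

Lemma gc_exp_monox R l : {homo gc_exp R ^~ l : x x' / x <= x'}.
Proof.
move=> x x' xx'; elim: l => //= l IH.
by rewrite leq_add // !leq_add2r leq_mul2l IH orbT.
Qed.

Lemma gc_lab_mono R : {homo gc_lab R : x x' / x <= x'}.
Proof. by move=> x x' xx'; rewrite /gc_lab !leq_add2r gc_exp_monox. Qed.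

Lemma subset_of_card (L : finType) (B : {set L}) n : n <= #|B| ->
  exists Jd : {set L}, Jd \subset B /\ #|Jd| = n.
Proof.
move=> h; exists [set x in take n (enum B)]; split.
  by apply/subsetP => x; rewrite inE => /mem_take; rewrite mem_enum.
by rewrite cardsE (card_uniqP _) ?take_uniq ?enum_uniq // size_takel // -cardE.
Qed.

Section Old.
Variables (T L : finType) (e : rel T) (P : L -> {set T}) (D k s c : nat).
Hypothesis tP : teeth e P D k s c.
Let k2 := teeth_k tP.
Let D0 := teeth_D0 tP.
Let k0 : 0 < k. Proof. exact: leq_trans k2. Qed.
Let kx x : 0 < k ^ x. Proof. by rewrite expn_gt0 k0. Qed.

Variables (A : finType) (act : pred A) (grp : A -> nat) (fo : A -> T -> T) (labo : A -> L).
Variables (sg sg' : nat) (J : {set L}) (C : L -> {set T}).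

(* A hub [h] with [act h] comes with a map [fo h] sending each vertex of the current sets [C v] to a neighbour
   in the tooth [P (labo h)]; the last two fields survive shrinking [J] and the [C v] since [D] is fixed. *)
Record oldhubs : Prop := OldHubs {
  oh_sub : forall v, v \in J -> C v \subset P v;
  oh_lab : forall h w v, act h -> v \in J -> w \in C v -> fo h w \in P (labo h) /\ labo h \notin J;
  oh_Q : forall h u v v', act h -> v \in J -> v' \in J -> u \in C v ->
    #|[set b in C v' | e (fo h b) u]| * k ^ sg <= D;
  oh_Q' : forall h h' b v v', act h -> act h' -> grp h != grp h' -> v \in J -> v' \in J -> b \in C v ->
    #|[set w in C v' | e (fo h w) (fo h' b)]| * k ^ sg' <= D
}.

(* No adjacency among [z], [b] and their images, except that [fo h z], [fo h b] under the same hub are adjacent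
   according to [p h], and that nothing is said about distinct hubs of one group. *)
Definition sep (p : A -> bool) (z b : T) : bool :=
  [&& z != b, ~~ e z b, [forall h, act h ==> [&& ~~ e z (fo h b), ~~ e (fo h z) b & e (fo h z) (fo h b) == p h]] &
   [forall h, forall h', (act h && act h' && (grp h != grp h')) ==> ~~ e (fo h z) (fo h' b)]].

Hypothesis oh : oldhubs.
Hypothesis sgs : sg <= s.
Hypothesis sg's : sg' <= sg.
Variables (r x : nat).
Hypothesis Cx : forall v, v \in J -> D <= #|C v| * k ^ x.
Hypothesis Ak : 2 * (1 + #|A| + #|A| + #|A| * #|A|) <= k.
Hypothesis Ak2 : 2 * 2 ^ #|A| <= k.

Local Notation Y := (pre_exp r x).

(* Greedy choice of elements with many non-neighbours in one class; it can only get stuck on a superdense set. *)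
Definition presel v n (b : nat -> T) (par : nat -> A -> bool) (C1 : {set T}) : Prop :=
  [/\ C1 \subset C v, D <= #|C1| * k ^ Y n, forall j, j < n -> b j \in C v,
      forall j z, j < n -> z \in C1 -> sep (par j) z (b j) &
      forall i j, i < j -> j < n -> sep (par i) (b j) (b i)].

Definition superdense_class v n (O : {set T}) : Prop :=
  [/\ O \subset C v, D <= #|O| * k ^ Y n &
      forall y, y \in O -> #|O :\: [set z | e y z]| * k ^ pre_rho r (Y n) <= #|O|].

Lemma preselect v n : v \in J -> Y n <= sg' ->
  (exists b par C1, presel v n b par C1) \/ (exists2 i, i < n & exists O, superdense_class v i O).
Proof.
move=> vJ; elim: n => [_|n IH Yn].
  have [t _] : exists t, t \in C v.
    by apply/card_gt0P; rewrite lt0n; apply: contraTneq (Cx vJ) => ->; rewrite mul0n -ltnNge.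
  by left; exists (fun=> t), (fun=> xpred0), (C v); split=> //; apply: Cx.
have [|[b [par [C1 [sC mC bC sz sb]]]]|[i ilt hO]] := IH _; last first.
- by right; exists i => //; apply: ltnW.
- have [hO|] := boolP [forall y in C1, #|C1 :\: [set z | e y z]| * k ^ pre_rho r (Y n) <= #|C1|].
    by right; exists n => //; exists C1; split=> // y yC; apply: (forall_inP hO).
  rewrite negb_forall => /existsP[bn]; rewrite negb_imply -ltnNge => /andP[bnC hbn].
  left; set X := C1 :\: _ in hbn.
  have bnCv : bn \in C v by apply: subsetP bnC.
  have XC : X \subset C v by apply: subset_trans (subsetDl _ _) sC.
  have mX : D <= #|X| * k ^ (Y n + pre_rho r (Y n)).
    apply: leq_trans mC _; rewrite addnC expnD mulnA leq_mul2r (ltnW hbn).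
    by rewrite orbT.
  have low (B : {set T}) q : #|B| * k ^ q <= D -> sg' <= q -> #|B| * k ^ sg' <= D.
    by move=> h1 h2; apply: leq_trans h1; rewrite leq_mul2l leq_pexp2l ?orbT.
  (* One set for each way of violating [sep] against [bn]; their sizes are bounded by [teeth_big],
     [teeth_sparse], [oh_Q] and [oh_Q'] in this order. *)
  pose B (j : unit + A + A + A * A) := match j with
    | inl (inl (inl _)) => [set bn]
    | inl (inl (inr h)) => if act h then [set z in C v | e (fo h bn) z] else set0
    | inl (inr h) => if act h then [set z in C v | e (fo h z) bn] else set0
    | inr (h, h') => if [&& act h, act h' & grp h != grp h'] then [set z in C v | e (fo h z) (fo h' bn)] else set0
    end.
  have hB j : #|B j| * k ^ sg' <= D.
    case: j => [[[_|h]|h]|[h h']] /=.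
    - rewrite cards1 mul1n; apply: leq_trans (teeth_big tP).
      by rewrite leq_pexp2l // (leq_trans sg's).
    - case: ifP => [ah|_]; last by rewrite cards0.
      apply: low (leq_trans sg's sgs).
      have [fP fJ] := oh_lab oh ah vJ bnCv.
      have lv : labo h != v by apply: contraNneq fJ => ->.
      apply: leq_trans (teeth_sparse tP lv fP); rewrite leq_mul2r; apply/orP; right.
      apply: subset_leq_card; apply/subsetP => z; rewrite !inE => /andP[zC ->]; rewrite andbT.
      exact: subsetP (oh_sub oh vJ) _ zC.
    - case: ifP => [ah|_]; last by rewrite cards0.
      exact: low (oh_Q oh ah vJ vJ bnCv) sg's.
    - case: ifP => [/and3P[ah ah' g]|_]; last by rewrite cards0.
      exact: (oh_Q' oh ah ah' g vJ vJ bnCv).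
  have := tiny_remove k0 mX hB _ _; move/(_ 1); rewrite expn1 !card_sum card_unit card_prod.
  move=> /(_ Ak Yn); set X1 := X :\: _ => hX1.
  have X10 : 0 < #|X1|.
    move: hX1 mX; case: (#|X1|) => // ; rewrite muln0 leqn0 => /eqP ->.
    by rewrite mul0n leqNgt D0.
  (* The images of [z] and [bn] under one hub lie in the same tooth, so nothing makes their
     adjacency rare; it is only made independent of [z]. *)
  have [q hq] := majority (fun z => [ffun h => e (fo h z) (fo h bn)]) X10.
  rewrite card_ffun card_bool in hq.
  set C2 := [set z in X1 | _] in hq.
  have C2X : C2 \subset X1 by apply/subsetP => z; rewrite inE => /andP[].
  have sC2 z : z \in C2 -> [/\ z \in C1, z \in C v & sep q z bn].
    rewrite inE => /andP[/setDP[/setDP[zC1 nez] zB] /eqP zq].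
    have zCv := subsetP sC _ zC1.
    have zB' j : z \notin B j by apply: contra zB => zj; apply/bigcupP; exists j.
    split=> //; apply/and4P; split.
    - by have := zB' (inl (inl (inl tt))); rewrite /= inE.
    - by move: nez; rewrite inE (teeth_sym tP).
    - apply/forallP => h; apply/implyP => ah; apply/and3P; split.
      + by have := zB' (inl (inl (inr h))); rewrite /= ah inE zCv (teeth_sym tP).
      + by have := zB' (inl (inr h)); rewrite /= ah inE zCv.
      + by rewrite -zq ffunE.
    - apply/forallP => h; apply/forallP => h'; apply/implyP => /andP[/andP[ah ah'] g].
      by have := zB' (inr (h, h')); rewrite /= ah ah' g inE zCv.
  exists (fun j => if j == n then bn else b j), (fun j => if j == n then q : A -> bool else par j), C2; split.
  + by apply/subsetP => z /sC2[].
  + rewrite [Y n.+1]/= expnD expn1 [_ * k]mulnC mulnA; apply: leq_trans mX _.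
    rewrite leq_mul2r; apply/orP; right; apply: leq_trans hX1 _.
    by apply: leq_trans (leq_mul (leqnn 2) hq) _; rewrite mulnA mulnC leq_mul2l Ak2 orbT.
  + by move=> j; rewrite ltnS leq_eqVlt; case: eqP => //= _; apply: bC.
  + move=> j z; rewrite ltnS leq_eqVlt; case: eqP => [_ _|_ /= jn] /sC2[z1 z2 z3] //.
    exact: sz.
  + move=> i j ij; rewrite ltnS leq_eqVlt => /orP[/eqP jn|jn].
      by subst j; rewrite eqxx (ltn_eqF ij); apply: sz.
    by rewrite (ltn_eqF jn) (ltn_eqF (ltn_trans ij jn)); apply: sb.
- by apply: leq_trans Yn; apply: pre_exp_mono.
Qed.

Lemma sep_sym p z b : sep p z b -> sep p b z.
Proof.
have sy := teeth_sym tP.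
move=> /and4P[h1 h2 /forallP h3 /forallP h4]; apply/and4P; split.
- by rewrite eq_sym.
- by rewrite sy.
- apply/forallP => h; apply/implyP => ah; have /and3P[a1 a2 a3] := implyP (h3 h) ah.
  by rewrite sy a2 sy a1 sy a3.
- apply/forallP => h; apply/forallP => h'; apply/implyP => /andP[/andP[ah ah'] g].
  by rewrite sy; have /forallP/(_ h)/implyP := h4 h'; apply; rewrite ah ah' eq_sym.
Qed.

Definition tooth M n v (b : 'I_M -> T) (p : A -> bool) (C1 : {set T}) : Prop :=
  [/\ C1 \subset C v, D <= #|C1| * k ^ Y n, forall j, b j \in C v,
      forall j z, z \in C1 -> sep p z (b j) & forall i j, i != j -> sep p (b i) (b j)].

(** Pigeonhole over the [2 ^ #|A|] patterns leaves [M] elements with a common one. As [sep] is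
    symmetric for a fixed pattern, the order of selection is then forgotten. *)
Lemma presel_tooth M n v b par C1 : M * 2 ^ #|A| <= n -> 0 < M -> presel v n b par C1 ->
  exists (b' : 'I_M -> T) p, tooth n v b' p C1.
Proof.
move=> hM M0 [h1 h2 h3 h4 h5].
have [||phi [q [pinj hq]]] := @homogeneous_subfamily {ffun A -> bool} M n (fun j => [ffun h => par j h]).
- by rewrite muln_gt0 M0 card_ffun card_bool expn_gt0.
- by rewrite card_ffun card_bool.
have parq j h : par (phi j) h = q h by rewrite -(hq j) ffunE.
have seq z j : sep (par (phi j)) z (b (phi j)) -> sep q z (b (phi j)).
  move=> /and4P[a1 a2 /forallP a3 a4]; apply/and4P; split=> //.
  by apply/forallP => h; rewrite -(parq j).
exists (fun j => b (phi j)), q; split=> //.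
- by move=> j; apply: h3.
- by move=> j z zC; apply: seq; apply: h4.
- move=> i j ij; have : phi i != phi j :> nat by rewrite val_eqE inj_eq.
  by case: ltngtP => // lt _; [apply: sep_sym|]; apply: seq; apply: h5.
Qed.

(** If the preselection gets stuck for at least half of the labels, then for many of them it does so
    at the same step [i < n], and they all carry superdense sets for the same exponents;
    [superdense] applies to these. *)
Lemma collective_teeth (V E : finType) (e1 e2 : E -> V) M n :
  (forall i, e1 i != e2 i) -> r = #|E| -> 0 < M -> M * 2 ^ #|A| <= n -> #|V| * #|E|.+1 <= k -> 2 * n <= k ->
  Y n <= sg' -> gc_exp r (Y n).+1 r + 2 <= c -> k ^ (gc_lab r (Y n).+1).+2 <= #|J| ->
  sub2_model e1 e2 e \/
  exists (Js : {set L}) (b : L -> 'I_M -> T) (p : L -> A -> bool) (C1 : L -> {set T}),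
    [/\ Js \subset J, #|J| <= 2 * #|Js| & forall v, v \in Js -> tooth n v (b v) (p v) (C1 v)].
Proof.
move=> e12 rE M0 hM Vk nk Yn hc hJ.
have tP' (v : L) : exists bpC : (('I_M -> T) * (A -> bool) * {set T})%type,
    v \in J -> tooth n v bpC.1.1 bpC.1.2 bpC.2 \/ (exists2 i, i < n & exists O, superdense_class v i O).
  case: (boolP (v \in J)) => vJ.
    have [[b [par [C1 hp]]]|hs] := preselect vJ Yn.
      have [b' [p ht]] := presel_tooth hM M0 hp.
      by exists (b', p, C1); left.
    have [t _] : exists t, t \in C v.
      by apply/card_gt0P; rewrite lt0n; apply: contraTneq (Cx vJ) => ->; rewrite mul0n -ltnNge.
    by exists ((fun=> t), xpred0, set0); right.
  have [v' v'J] : exists v', v' \in J by apply/card_gt0P; apply: leq_trans hJ; apply: kx.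
  have [t _] : exists t, t \in C v'.
    by apply/card_gt0P; rewrite lt0n; apply: contraTneq (Cx v'J) => ->; rewrite mul0n -ltnNge.
  by exists ((fun=> t), xpred0, set0) => vJ'; case/negP: vJ.
have [bpC hbpC] := fin_all_exists tP'.
pose sdb v i := [exists O : {set T}, [&& O \subset C v, D <= #|O| * k ^ Y i &
      [forall y in O, #|O :\: [set z | e y z]| * k ^ pre_rho r (Y i) <= #|O|]]].
have sdP v i : reflect (exists O, superdense_class v i O) (sdb v i).
  apply: (iffP existsP) => -[O].
    by move=> /and3P[a1 a2 /forall_inP a3]; exists O.
  by move=> [a1 a2 a3]; exists O; rewrite a1 a2; apply/forall_inP.
pose Bad (i : 'I_n) := [set v in J | sdb v i].
pose Js := J :\: \bigcup_(i < n) Bad i.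
have [hJs|hJs] := leqP #|J| (2 * #|Js|).
  right; exists Js, (fun v => (bpC v).1.1), (fun v => (bpC v).1.2), (fun v => (bpC v).2).
  split=> //; first exact: subsetDl.
  move=> v /setDP[vJ vB]; case: (hbpC v vJ) => // -[i ilt /sdP hi]; case/negP: vB.
  by apply/bigcupP; exists (Ordinal ilt) => //; rewrite inE vJ.
left.
have hB : #|J| <= 2 * #|\bigcup_(i < n) Bad i|.
  have := cardsID (\bigcup_(i < n) Bad i) J; rewrite -/Js.
  have : #|J :&: \bigcup_(i < n) Bad i| <= #|\bigcup_(i < n) Bad i| by rewrite subset_leq_card ?subsetIr.
  by move: hJs; clear; lia.
pose a := (gc_lab r (Y n).+1).+1.
have [i hi] : exists i : 'I_n, k ^ a <= #|Bad i|.
  case: (boolP [exists i : 'I_n, k ^ a <= #|Bad i|]) => [/existsP//|].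
  rewrite negb_exists => /forallP h.
  have h1 : #|\bigcup_(i < n) Bad i| <= n * (k ^ a).-1.
    apply: leq_trans (card_bigcup _ _) _; apply: leq_sum_ord => i.
    by have := h i; rewrite -ltnNge; case: (k ^ a).
  have h2 : k * k ^ a <= 2 * n * (k ^ a).-1.
    by rewrite -expnS; apply: leq_trans hJ _; apply: leq_trans hB _; rewrite -mulnA leq_mul2l h1.
  have h3 := leq_trans h2 (leq_mul nk (leqnn _)).
  by move: h3; rewrite leq_pmul2l // leqNgt; case: (k ^ a) (kx a) => // q _; rewrite ltnSn.
(* The density of the superdense sets is tied to an upper bound [k ^ a] on the number of labels, so
   exactly the least admissible number is kept. *)
have [Jd JdB cJd] : exists2 Jd : {set L}, Jd \subset Bad i & #|Jd| = k ^ (gc_lab r (Y i).+1).+1.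
  have : k ^ (gc_lab r (Y i).+1).+1 <= #|Bad i|.
    apply: leq_trans hi; rewrite leq_pexp2l // ltnS gc_lab_mono //.
    by rewrite ltnS pre_exp_mono // ltnW.
  by move=> /subset_of_card[Jd [h1 h2]]; exists Jd.
have : forall v, exists O, v \in Jd -> superdense_class v i O.
  move=> v; case: (boolP (v \in Jd)) => [vJd|_]; last by exists set0.
  by have := subsetP JdB _ vJd; rewrite inE => /andP[_ /sdP[O hO]]; exists O.
move=> /fin_all_exists[O hO].
have JdJ v : v \in Jd -> v \in J by move=> /(subsetP JdB); rewrite inE => /andP[].
have Yi : Y i <= Y n by apply: pre_exp_mono; apply: ltnW.
apply: (@superdense V E e1 e2 T L e P D k s c (Y i) (gc_lab r (Y i).+1).+1 Jd O) => //; rewrite -?rE ?cJd //.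
- by move=> v vJd; have [h _ _] := hO v vJd; apply: subset_trans h (oh_sub oh (JdJ _ vJd)).
- by move=> v vJd; have [_ h _] := hO v vJd.
- by move=> v y vJd; have [_ _ h] := hO v vJd; apply: h.
- by apply: leq_trans hc; rewrite leq_add2r gc_exp_monox // ltnS.
- apply: leq_trans (leq_trans sg's sgs); apply: leq_trans Yn.
  have : Y i.+1 <= Y n by apply: pre_exp_mono.
  by apply: leq_trans; rewrite /= leq_addr.
Qed.
End Old.

(** Double counting. Sparsity bounds, for each [b], the number of related [u], whereas [oldhubs]
    asks for few [b] for each [u]; the two are exchanged at the price of deleting few [u]. *)
Lemma few_rich (T : finType) (X Y : {set T}) (rl : rel T) D k q z :
  #|Y| <= D -> (forall b, b \in Y -> #|[set u in X | rl b u]| * k ^ (q + z) <= D) ->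
  #|[set u in X | D < #|[set b in Y | rl b u]| * k ^ q]| * k ^ z <= D.
Proof.
move=> YD h; set B := [set u in X | _].
have h1 : #|B| * D.+1 <= (\sum_(u in X) #|[set b in Y | rl b u]|) * k ^ q.
  rewrite big_distrl /= [X in _ <= X](bigID (mem B)) /= -sum_nat_const.
  apply: leq_trans _ (leq_addr _ _).
  rewrite [X in _ <= X](eq_bigl (mem B)); last by move=> u; rewrite /= inE; case: (u \in X).
  by apply: leq_sum => u; rewrite inE => /andP[].
have h2 : \sum_(u in X) #|[set b in Y | rl b u]| = \sum_(b in Y) #|[set u in X | rl b u]|.
  under eq_bigr do rewrite -sum1_card.
  under [RHS]eq_bigr do rewrite -sum1_card.
  rewrite (exchange_big_dep (mem Y)) /=; last by move=> u b _; rewrite inE => /andP[].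
  by apply: eq_bigr => b bY; apply: eq_bigl => u; rewrite !inE bY.
have h3 : (\sum_(b in Y) #|[set u in X | rl b u]|) * k ^ (q + z) <= D * D.
  rewrite big_distrl /=; apply: leq_trans (leq_sum_const _) _; first exact: h.
  by rewrite leq_mul2r YD orbT.
have h4 : #|B| * D * k ^ z <= D * D.
  apply: leq_trans h3; rewrite -h2 expnD mulnA leq_mul2r; apply/orP; right.
  by apply: leq_trans h1; rewrite leq_mul2l leqnSn orbT.
case: (posnP D) => [D0|D0].
  have -> : B = set0; last by rewrite cards0.
  apply/setP => u; rewrite !inE; apply/negbTE; rewrite negb_and -leqNgt; apply/orP; right.
  rewrite (_ : [set b in Y | _] = set0) ?cards0 //.
  apply/setP => b; rewrite !inE; move: YD; rewrite D0 leqn0 cards_eq0 => /eqP->.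
  by rewrite inE.
by rewrite -(leq_pmul2l D0) mulnA [D * #|B|]mulnC.
Qed.

Section Add.
Variables (T L : finType) (e : rel T) (P : L -> {set T}) (D k s c : nat).
Hypothesis tP : teeth e P D k s c.
Let k2 := teeth_k tP.
Let Pd := teeth_disj tP.
Let D0 := teeth_D0 tP.
Let k0 : 0 < k. Proof. exact: leq_trans k2. Qed.
Let kx x : 0 < k ^ x. Proof. by rewrite expn_gt0 k0. Qed.

Variables (A : finType) (act : pred A) (grp : A -> nat) (fo : A -> T -> T).
Variables (sg sg' : nat).

Local Notation sep := (sep e act grp fo).

Record newgroup (J : {set L}) (C : L -> {set T}) (x' lam R M : nat) (J' : {set L}) (C' : L -> {set T}) (labn : 'I_R -> L) (S : 'I_R -> {set T})
    (fn : 'I_R -> T -> T) (bn : 'I_R -> 'I_M -> T) (pn : 'I_R -> A -> bool)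
    (beta : 'I_R -> 'I_M -> A -> bool) : Prop := NewGroup {
  ng_J : J' \subset J;
  ng_C : forall v, v \in J' -> C' v \subset C v;
  ng_lab : forall t, labn t \in J /\ labn t \notin J';
  ng_inj : injective labn;
  ng_mass : forall v, v \in J' -> D <= #|C' v| * k ^ x';
  ng_many : #|J| <= #|J'| * k ^ lam;
  ng_S : forall t, S t \subset C (labn t);
  ng_anti : forall t t', t != t' -> anti e (S t) (S t');
  ng_f : forall t v w, v \in J' -> w \in C' v -> fn t w \in S t /\ e w (fn t w);
  ng_b : forall t j, bn t j \in C (labn t);
  ng_bb : forall t i j, i != j -> sep (pn t) (bn t i) (bn t j);
  ng_wb : forall t j v w, v \in J' -> w \in C' v -> sep (beta t j) w (bn t j);
  ng_own : forall t j z, z \in S t -> sep (pn t) z (bn t j);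
  ng_Q : forall t u v v', v \in J' -> v' \in J' -> u \in C' v ->
    #|[set b in C' v' | e (fn t b) u]| * k ^ sg <= D;
  ng_Q1 : forall t h b v v', act h -> v \in J' -> v' \in J' -> b \in C' v ->
    #|[set w in C' v' | e (fn t w) (fo h b)]| * k ^ sg' <= D;
  ng_Q2 : forall t h b v v', act h -> v \in J' -> v' \in J' -> b \in C' v ->
    #|[set w in C' v' | e (fo h w) (fn t b)]| * k ^ sg' <= D
}.

Variables (labo : A -> L) (J : {set L}) (C : L -> {set T}) (r x R M n B : nat).
Hypothesis oh : oldhubs e P D k act grp fo labo sg sg' J C.
Local Notation Y := (pre_exp r x n).
Local Notation X2 := (gc_out R Y).
Hypothesis Lk : #|L| <= k ^ B.
Let cst := R * M * (1 + #|A| + #|A| + #|A| * #|A|) + R + R * #|A|.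
Hypothesis cstk : 2 * cst <= k.
Hypothesis bitk : 2 * 2 ^ (R * M * #|A|) <= k.
Hypothesis sgz : X2 + B.+1 <= sg'.
Hypothesis sgz' : sg' + (X2 + B.+1) <= sg.
Hypothesis sgz'' : sg + (X2 + B.+1) <= s.
Hypothesis hc : gc_exp R Y R + 2 <= c.

(** The sets [S t] come from [group_creation], and [fn t] picks a neighbour in [S t]. Each adjacency
    excluded by [newgroup] is avoided by deleting a tiny part of every class. The adjacencies of two
    images under one old hub are instead made uniform by two pigeonholes, first inside each class
    and then over the labels, so that [beta] depends neither on the vertex nor on its class. *)
Lemma add_group (Js : {set L}) (b : L -> 'I_M -> T) (p : L -> A -> bool) (C1 : L -> {set T}) :
  Js \subset J -> #|J| <= 2 * #|Js| -> k ^ gc_lab R Y <= #|Js| ->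
  (forall v, v \in Js -> tooth e D k act grp fo C r x n v (b v) (p v) (C1 v)) ->
  exists J' C' labn S fn bn pn beta, @newgroup J C X2.+1 (gc_lab R Y).+1 R M J' C' labn S fn bn pn beta.
Proof.
move=> JsJ cJs hJs th.
have [|||vs [S [J1 [C2 [h1 h2 [h3a h3b] h4 h5]]]]] := group_creation (C := C1) (x := Y) (R := R) (J := Js) tP hc.
- move=> v vJs; have [sC _ _ _ _] := th v vJs.
  by apply: subset_trans sC (oh_sub oh (subsetP JsJ _ vJs)).
- by move=> v vJs; have [_ mC _ _ _] := th v vJs.
- by [].
pose labn (t : 'I_R) := vs t.
have labJs t : labn t \in Js by have [] := h1 t (ltn_ord t).
have labJ t : labn t \in J by apply: subsetP JsJ _ _.
have labJ1 t : labn t \notin J1 by apply: h3b.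
have J1J v : v \in J1 -> v \in J by move=> /(subsetP h3a)/(subsetP JsJ).
have SC1 (t : 'I_R) : S t \subset C1 (labn t) by have [] := h1 (t : 'I_R) (ltn_ord t).
have C1C v : v \in Js -> C1 v \subset C v by move=> vJs; have [] := th v vJs.
have C2C v : v \in J1 -> C2 v \subset C v.
  by move=> vJ1; have [sC _ _] := h5 v vJ1; apply: subset_trans sC (C1C _ (subsetP h3a _ vJ1)).
have C2P v : v \in J1 -> C2 v \subset P v.
  by move=> vJ1; apply: subset_trans (C2C v vJ1) (oh_sub oh (J1J v vJ1)).
pose fn (t : 'I_R) w := if [pick z in S t | e z w] is Some z then z else w.
have fnP t v w : v \in J1 -> w \in C2 v -> fn t w \in S t /\ e w (fn t w).
  move=> vJ1 wC; rewrite /fn; case: pickP => [z /andP[zS ezw]|hn].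
    by split=> //; rewrite (teeth_sym tP).
  have [_ _ /(_ t (ltn_ord t)) sn] := h5 v vJ1.
  by have /nbP[z zS ezw] := subsetP sn _ wC; have := hn z; rewrite zS ezw.
have fnC t v w : v \in J1 -> w \in C2 v -> fn t w \in C (labn t).
  move=> vJ1 wC; have [fS _] := fnP t v w vJ1 wC.
  exact: subsetP (C1C _ (labJs t)) _ (subsetP (SC1 t) _ fS).
pose bn (t : 'I_R) := b (labn t).
have bC t j : bn t j \in C (labn t) by have [_ _ + _ _] := th _ (labJs t); apply.
(* Labels occur in this index because richness is tested against every remaining class; the bound
   [Lk] and the exponent [B.+1] serve to pay for that many deletions. *)
pose idx : finType := ('I_R * 'I_M * (unit + A + A + A * A) + L * 'I_R + L * 'I_R * A)%type.
pose tiny v (q : idx) : {set T} := match q with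
  | inl (inl (t, j, inl (inl (inl _)))) => [set w in C2 v | e w (bn t j)]
  | inl (inl (t, j, inl (inl (inr h)))) => if act h then [set w in C2 v | e w (fo h (bn t j))] else set0
  | inl (inl (t, j, inl (inr h))) => if act h then [set w in C2 v | e (fo h w) (bn t j)] else set0
  | inl (inl (t, j, inr (h, h'))) => if [&& act h, act h' & grp h != grp h'] then [set w in C2 v | e (fo h w) (fo h' (bn t j))] else set0
  | inl (inr (v', t)) => if v' \in J1 then [set u in C2 v | D < #|[set w in C2 v' | e (fn t w) u]| * k ^ sg] else set0
  | inr (v', t, h) => if (v' \in J1) && act h then [set u in C2 v | D < #|[set w in C2 v' | e (fn t w) (fo h u)]| * k ^ sg'] else set0
  end.
(* A use of [few_rich] costs a factor [k ^ z]: sparsity between teeth at exponent [s] gives the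
   bound [ng_Q] at exponent [sg], and [oh_Q] for the old hubs gives [ng_Q1] at exponent [sg']. Hence
   the chain of three exponents. *)
pose z := X2 + B.+1; have zg : z <= sg' := sgz; have zg' : sg' + z <= sg := sgz'; have zg'' : sg + z <= s := sgz''.
have low q (E : {set T}) : z <= q -> #|E| * k ^ q <= D -> #|E| * k ^ z <= D.
  by move=> zq; apply: leq_trans; rewrite leq_mul2l leq_pexp2l ?orbT.
have zs : z <= s by apply: leq_trans zg''; apply: leq_addl.
have zsg : z <= sg by apply: leq_trans zg'; apply: leq_addl.
have spar v y lb : v \in J1 -> lb \notin J -> y \in P lb -> #|[set w in C2 v | e y w]| * k ^ s <= D.
  move=> vJ1 lJ yP; have lv : lb != v by apply: contraNneq lJ => ->; apply: J1J.
  apply: leq_trans (teeth_sparse tP lv yP); rewrite leq_mul2r; apply/orP; right.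
  apply: subset_leq_card; apply/subsetP => w; rewrite !inE => /andP[wC ->]; rewrite andbT.
  exact: subsetP (C2P v vJ1) _ wC.
have spar' v y lb : v \in J1 -> lb \notin J1 -> y \in P lb -> #|[set w in C2 v | e y w]| * k ^ s <= D.
  move=> vJ1 lJ yP; have lv : lb != v by apply: contraNneq lJ => ->.
  apply: leq_trans (teeth_sparse tP lv yP); rewrite leq_mul2r; apply/orP; right.
  apply: subset_leq_card; apply/subsetP => w; rewrite !inE => /andP[wC ->]; rewrite andbT.
  exact: subsetP (C2P v vJ1) _ wC.
have restr v (pr : pred T) q : v \in J1 -> #|[set w in C v | pr w]| * k ^ q <= D -> #|[set w in C2 v | pr w]| * k ^ q <= D.
  move=> vJ1; apply: leq_trans; rewrite leq_mul2r; apply/orP; right; apply: subset_leq_card.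
  by apply/subsetP => w; rewrite !inE => /andP[wC ->]; rewrite (subsetP (C2C v vJ1) _ wC).
have tinyP v q : v \in J1 -> #|tiny v q| * k ^ z <= D.
  move=> vJ1; case: q => [[[[t j] [[[_|h]|h]|[h h']]]|[v' t]]|[[v' t] h]] /=.
  - apply: (low s _ zs); have bP := subsetP (oh_sub oh (labJ t)) _ (bC t j).
    apply: leq_trans (spar' v _ _ vJ1 (labJ1 t) bP); rewrite leq_mul2r; apply/orP; right.
    by apply: subset_leq_card; apply/subsetP => w; rewrite !inE (teeth_sym tP).
  - case: ifP => [ah|_]; last by rewrite cards0.
    apply: (low s _ zs); have [fP fJ] := oh_lab oh ah (labJ t) (bC t j).
    apply: leq_trans (spar v _ _ vJ1 fJ fP); rewrite leq_mul2r; apply/orP; right.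
    by apply: subset_leq_card; apply/subsetP => w; rewrite !inE (teeth_sym tP).
  - case: ifP => [ah|_]; last by rewrite cards0.
    by apply: (low sg _ zsg); apply: restr vJ1 (oh_Q oh ah (labJ t) (J1J v vJ1) (bC t j)).
  - case: ifP => [/and3P[ah ah' g]|_]; last by rewrite cards0.
    by apply: (low sg' _ zg); apply: restr vJ1 (oh_Q' oh ah ah' g (labJ t) (J1J v vJ1) (bC t j)).
  - case: ifP => [v'J1|_]; last by rewrite cards0.
    apply: (@few_rich _ _ _ (fun w u => e (fn t w) u)).
      by apply: leq_trans (teeth_size tP v'); apply/subset_leq_card/C2P.
    move=> w wC; have fC := fnC t v' w v'J1 wC.
    have fP := subsetP (oh_sub oh (labJ t)) _ fC.
    apply: leq_trans (spar' v _ _ vJ1 (labJ1 t) fP).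
    by rewrite leq_mul2l leq_pexp2l ?orbT.
  - case: ifP => [/andP[v'J1 ah]|_]; last by rewrite cards0.
    apply: (@few_rich _ _ _ (fun w u => e (fn t w) (fo h u))).
      by apply: leq_trans (teeth_size tP v'); apply/subset_leq_card/C2P.
    move=> w wC; have fC := fnC t v' w v'J1 wC.
    apply: leq_trans (restr v (fun u => e (fo h u) (fn t w)) _ vJ1 (oh_Q oh ah (labJ t) (J1J v vJ1) fC)).
    apply: leq_mul; last by rewrite leq_pexp2l.
    by apply: subset_leq_card; apply/subsetP => u; rewrite !inE (teeth_sym tP).
have cidx : 2 * #|idx| <= k ^ B.+1.
  rewrite /idx !card_sum !card_prod !card_sum card_unit card_prod !card_ord expnSr.
  apply: leq_trans (leq_mul Lk cstk); rewrite /cst.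
  have L1 : 0 < #|L| by apply/card_gt0P; exists (vs 0).
  rewrite mulnCA leq_mul2l /= !(mulnDr #|L|) !(mulnA #|L|) leq_add2r leq_add2r.
  by rewrite -!mulnA leq_pmull.
pose C3 v := C2 v :\: \bigcup_q tiny v q.
have hC3 v : v \in J1 -> #|C2 v| <= 2 * #|C3 v|.
  move=> vJ1; have [_ mC _] := h5 v vJ1.
  exact: tiny_remove k0 mC (fun q => tinyP v q vJ1) cidx (leqnn _).
have C30 v : v \in J1 -> 0 < #|C3 v|.
  move=> vJ1; have [_ mC _] := h5 v vJ1; have := hC3 v vJ1; move: mC.
  by case: (#|C3 v|) => //; rewrite muln0 leqn0 => /[swap] /eqP->; rewrite mul0n leqNgt D0.
pose K : finType := {ffun 'I_R * 'I_M * A -> bool}.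
pose vec w : K := [ffun q : 'I_R * 'I_M * A => e (fo q.2 w) (fo q.2 (bn q.1.1 q.1.2))].
have cK : #|K| = 2 ^ (R * M * #|A|).
  by rewrite /K card_ffun card_bool !card_prod !card_ord.
have : forall v, exists q, v \in J1 -> #|C3 v| <= #|K| * #|[set w in C3 v | vec w == q]|.
  move=> v; case: (boolP (v \in J1)) => vJ1; last by exists [ffun=> true].
  by have [q hq] := majority vec (C30 v vJ1); exists q.
move=> /fin_all_exists[kap hkap].
have J10 : 0 < #|J1|.
  by rewrite lt0n; apply: contraTneq h4 => ->; rewrite mul0n -ltnNge; apply: leq_trans hJs.
have [q hq] := majority kap J10.
set J2 := [set v in J1 | _] in hq.
pose C4 v := [set w in C3 v | vec w == kap v].
have J2J1 v : v \in J2 -> v \in J1 by rewrite inE => /andP[].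
have C4C3 v w : w \in C4 v -> w \in C3 v by rewrite inE => /andP[].
have C4C2 v w : w \in C4 v -> w \in C2 v by move=> /C4C3 /setDP[].
have C4t v w i : w \in C4 v -> w \notin tiny v i.
  by move=> /C4C3 /setDP[_]; apply: contra => hw; apply/bigcupP; exists i.
have restr4 v (pr : pred T) y : #|[set w in C2 v | pr w]| * k ^ y <= D -> #|[set w in C4 v | pr w]| * k ^ y <= D.
  apply: leq_trans; rewrite leq_mul2r; apply/orP; right; apply: subset_leq_card.
  by apply/subsetP => w; rewrite !inE -!andbA => /and4P[_ -> _ ->].
exists J2, C4, labn, (fun t => S t), fn, bn, (fun t => p (labn t)), (fun t j h => q (t, j, h)); split.
- by apply/subsetP => v /J2J1 /J1J.
- by move=> v /J2J1 vJ1; apply/subsetP => w /C4C2 /(subsetP (C2C v vJ1)).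
- by move=> t; split=> //; apply/negP => /J2J1; apply/negP.
- move=> t t' tt; apply/eqP; apply: contraT => ne.
  by have [/eqP] := h2 t t' (ltn_ord t) (ltn_ord t') ne.
- move=> v /J2J1 vJ1; have [_ mC _] := h5 v vJ1.
  apply: leq_trans mC _; rewrite expnS mulnA leq_mul2r; apply/orP; right.
  apply: leq_trans (hC3 v vJ1) _; apply: leq_trans (leq_mul (leqnn 2) (hkap v vJ1)) _.
  by rewrite mulnA mulnC leq_mul2l cK bitk orbT.
- apply: leq_trans cJs _; apply: leq_trans (leq_mul (leqnn 2) h4) _.
  rewrite expnS mulnA mulnA leq_mul2r; apply/orP; right.
  apply: leq_trans (leq_mul (leqnn 2) hq) _.
  by rewrite mulnA mulnC leq_mul2l cK bitk orbT.
- by move=> t; apply: subset_trans (SC1 t) (C1C _ (labJs t)).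
- by move=> t t' ne; have [] := h2 t t' (ltn_ord t) (ltn_ord t') ne.
- by move=> t v w /J2J1 vJ1 /C4C2 wC; apply: fnP wC.
- exact: bC.
- by move=> t i j ij; have [_ _ _ _ h] := th _ (labJs t); apply: h.
- move=> t j v w vJ2 wC; have vJ1 := J2J1 v vJ2; have w2 := C4C2 v w wC.
  have bP := subsetP (oh_sub oh (labJ t)) _ (bC t j).
  have wt i := C4t v w i wC.
  apply/and4P; split.
  + apply: contraNneq (labJ1 t) => wb; rewrite wb in w2.
    by rewrite (Pd bP (subsetP (C2P v vJ1) _ w2)).
  + by have := wt (inl (inl (t, j, inl (inl (inl tt))))); rewrite /= inE w2.
  + apply/forallP => h; apply/implyP => ah; apply/and3P; split.
    * by have := wt (inl (inl (t, j, inl (inl (inr h))))); rewrite /= ah inE w2.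
    * by have := wt (inl (inl (t, j, inl (inr h)))); rewrite /= ah inE w2.
    * move: vJ2 wC; rewrite !inE => /andP[_ /eqP<-] /andP[_ /eqP<-].
      by rewrite ffunE.
  + apply/forallP => h; apply/forallP => h'; apply/implyP => /andP[/andP[ah ah'] g].
    by have := wt (inl (inl (t, j, inr (h, h')))); rewrite /= ah ah' g inE w2.
- move=> t j y yS; have [_ _ _ h _] := th _ (labJs t); apply: h.
  exact: subsetP (SC1 t) _ yS.
- move=> t u v v' /J2J1 vJ1 /J2J1 v'J1 uC; have := C4t v u (inl (inr (v', t))) uC.
  rewrite /= v'J1 inE (C4C2 v u uC) -leqNgt; exact: restr4.
- move=> t h w v v' ah /J2J1 vJ1 /J2J1 v'J1 uC; have := C4t v w (inr (v', t, h)) uC.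
  rewrite /= v'J1 ah inE (C4C2 v w uC) -leqNgt; exact: (restr4 v' (fun u => e (fn t u) (fo h w))).
- move=> t h w v v' ah /J2J1 vJ1 /J2J1 v'J1 wC; have fC := fnC t v w vJ1 (C4C2 v w wC).
  have := restr v' (fun u => e (fo h u) (fn t w)) _ v'J1 (oh_Q oh ah (labJ t) (J1J v' v'J1) fC).
  move/(restr4 v' (fun u => e (fo h u) (fn t w))); apply: leq_trans.
  by rewrite leq_mul2l leq_pexp2l ?orbT // (leq_trans _ zg') // leq_addr.
Qed.
End Add.

(** * Iterating the construction *)

Section HubSystem.
Variables (T : finType) (e : rel T) (G R M : nat).
Local Notation A := ('I_G * 'I_R)%type.

(* Hub [(g, t)] is the [t]-th hub of the [g]-th group, [ap] its apex and [b (g, t) j] the [j]-th element chosen in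
   its tooth; [f h (b l j)] is meaningful only when the group of [h] is earlier than that of [l].  The hypotheses
   [h.1 == l.1 -> h == l] exclude the pairs about which the construction says nothing. *)
Record hubsys (ap : A -> T) (b : A -> 'I_M -> T) (f : A -> T -> T) (p : A -> A -> bool)
    (beta : A -> 'I_M -> A -> bool) : Prop := HubSys {
  hs_ap : forall l l', ~~ e (ap l) (ap l');
  hs_apb : forall l l' j, e (ap l) (b l' j) = (l == l');
  hs_apf : forall l (h l' : A) j, h.1 < l'.1 -> e (ap l) (f h (b l' j)) = (l == h);
  hs_own : forall (h l : A) j, h.1 < l.1 -> e (b l j) (f h (b l j));
  hs_b : forall l j j', j != j' -> b l j != b l j';
  hs_bb : forall l j j', ~~ e (b l j) (b l j');
  hs_bb' : forall (l l' : A) j j', l.1 != l'.1 -> ~~ e (b l j) (b l' j');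
  hs_bf : forall (l h : A) j j', j != j' -> h.1 < l.1 -> ~~ e (b l j) (f h (b l j'));
  hs_bf' : forall (l l' h : A) j j', l.1 != l'.1 -> h.1 < l'.1 -> (h.1 == l.1 -> h == l) ->
    ~~ e (b l j) (f h (b l' j'));
  hs_ff : forall (h h' l l' : A) j j', h != h' -> h.1 = h'.1 -> h.1 < l.1 -> h'.1 < l'.1 ->
    ~~ e (f h (b l j)) (f h' (b l' j'));
  hs_ff1 : forall (h h' l : A) j j', j != j' -> h.1 != h'.1 -> h.1 < l.1 -> h'.1 < l.1 ->
    ~~ e (f h (b l j)) (f h' (b l j'));
  hs_ff2 : forall (h h' l l' : A) j j', h.1 != h'.1 -> h.1 < l.1 -> h'.1 < l'.1 -> l.1 < l'.1 ->
    (h'.1 == l.1 -> h' == l) -> ~~ e (f h (b l j)) (f h' (b l' j'));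
  hs_beta : forall (h l l' : A) j j', h.1 < l.1 -> l.1 < l'.1 ->
    e (f h (b l j)) (f h (b l' j')) = beta l j h;
  hs_p : forall (h l : A) j j', j != j' -> h.1 < l.1 -> e (f h (b l j)) (f h (b l j')) = p l h
}.
End HubSystem.

Lemma sep_eq (T A : finType) (e : rel T) (act : pred A) grp (fo fo' : A -> T -> T) p z b :
  (forall h, act h -> fo h = fo' h) -> sep e act grp fo p z b -> sep e act grp fo' p z b.
Proof.
move=> hf /and4P[h1 h2 /forallP h3 /forallP h4]; apply/and4P; split=> //.
- by apply/forallP => h; apply/implyP => ah; rewrite -hf //; apply: (implyP (h3 h)).
- apply/forallP => h; apply/forallP => h'; apply/implyP => hh; have /andP[/andP[ah ah'] _] := hh.
  by rewrite -!hf //; have /forallP/(_ h')/implyP := h4 h; apply.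
Qed.

Lemma newgroup_eq (T L A : finType) (e : rel T) D k (act : pred A) grp (fo fo' : A -> T -> T) sg sg'
  (J : {set L}) C x lam R M J' C' labn S fn bn pn beta :
  (forall h, act h -> fo h = fo' h) ->
  @newgroup T L e D k A act grp fo sg sg' J C x lam R M J' C' labn S fn bn pn beta ->
  @newgroup T L e D k A act grp fo' sg sg' J C x lam R M J' C' labn S fn bn pn beta.
Proof.
move=> hf [n1 n2 n3 n4 n5 n6 n7 n8 n9 n10 n11 n12 n13 n14 n15 n16]; split=> //.
- by move=> t i j ij; apply: sep_eq (n11 t i j ij).
- by move=> t j v w h1 h2; apply: sep_eq (n12 t j v w h1 h2).
- by move=> t j z h1; apply: sep_eq (n13 t j z h1).
- by move=> t h u v v' ah; rewrite -hf //; apply: n15.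
- by move=> t h u v v' ah; rewrite -hf //; apply: n16.
Qed.

Lemma sepP (T A : finType) (e : rel T) (act : pred A) grp (fo : A -> T -> T) p z b :
  symmetric e -> sep e act grp fo p z b ->
  [/\ z != b, ~~ e z b /\ ~~ e b z,
    forall h, act h -> [/\ ~~ e z (fo h b), ~~ e b (fo h z), ~~ e (fo h z) b & e (fo h z) (fo h b) = p h] &
    forall h h', act h -> act h' -> grp h != grp h' -> ~~ e (fo h z) (fo h' b)].
Proof.
move=> sy /and4P[h1 h2 /forallP h3 /forallP h4]; split=> //.
- by rewrite [e b z]sy.
- by move=> h ah; have /and3P[a1 a2 /eqP a3] := implyP (h3 h) ah; rewrite [e b _]sy.
- by move=> h h' ah ah' g; have /forallP/(_ h')/implyP := h4 h; apply; rewrite ah ah'.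
Qed.

(** A round takes the density exponent [x] through the preselection of [n] elements, then through
    the covering, and adds 1 for the deletions and pigeonholes. The iteration [proc_exp] starts at
    3, the density of the teeth within [D] built in [exists_teeth]. *)
Definition proc_step r R n x := (gc_out R (pre_exp r x n)).+1.
Definition proc_exp r R n i := iter i (proc_step r R n) 3.
Definition proc_pre r R n i := pre_exp r (proc_exp r R n i) n.
Definition proc_lam r R n i := (gc_lab R (proc_pre r R n i)).+1.
Definition proc_Lam r R n i := \sum_(j < i) proc_lam r R n j.

Section Process.
Variables (T L : finType) (e : rel T) (P : L -> {set T}) (D k s c : nat).
Hypothesis tP : teeth e P D k s c.
Variables (G R M : nat) (sg sg' : nat).
Local Notation A := ('I_G * 'I_R)%type.
Variables (xx lam : nat -> nat).

Definition hact (i : nat) : pred A := fun h => h.1 < i.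
Definition hgrp (h : A) : nat := h.1.

Record stage i (Jh : nat -> {set L}) (Ch : nat -> L -> {set T}) (f : A -> T -> T) (lb : A -> L)
    (S : A -> {set T}) (b : A -> 'I_M -> T) (p : A -> A -> bool) (beta : A -> 'I_M -> A -> bool) : Prop := Stage {
  st_new : forall g : 'I_G, g < i -> @newgroup T L e D k A (hact g) hgrp f sg sg' (Jh g) (Ch g) (xx g.+1) (lam g) R M
     (Jh g.+1) (Ch g.+1) (fun t => lb (g, t)) (fun t => S (g, t)) (fun t => f (g, t)) (fun t => b (g, t))
     (fun t => p (g, t)) (fun t => beta (g, t));
  st_sub : forall v, v \in Jh 0 -> Ch 0 v \subset P v;
  st_mass : forall v, v \in Jh 0 -> D <= #|Ch 0 v| * k ^ xx 0
}.

Section Stage.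
Variables (i : nat) (Jh : nat -> {set L}) (Ch : nat -> L -> {set T}) (f : A -> T -> T) (lb : A -> L)
    (S : A -> {set T}) (b : A -> 'I_M -> T) (p : A -> A -> bool) (beta : A -> 'I_M -> A -> bool).
Hypothesis st : stage i Jh Ch f lb S b p beta.
Hypothesis iG : i <= G.

Lemma st_J a d : a <= d -> d <= i -> Jh d \subset Jh a.
Proof.
elim: d => [|d IH]; first by rewrite leqn0 => /eqP->.
rewrite leq_eqVlt => /orP[/eqP->//|]; rewrite ltnS => ad di.
apply: subset_trans (IH ad (ltnW di)).
exact: ng_J (st_new st (g := Ordinal (leq_trans di iG)) di).
Qed.

Lemma st_C a d v : a <= d -> d <= i -> v \in Jh d -> Ch d v \subset Ch a v.
Proof.
elim: d => [|d IH]; first by rewrite leqn0 => /eqP->.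
rewrite leq_eqVlt => /orP[/eqP->//|]; rewrite ltnS => ad di vJ.
apply: subset_trans (IH ad (ltnW di) (subsetP (st_J (leqnSn d) di) _ vJ)).
exact: ng_C (st_new st (g := Ordinal (leq_trans di iG)) di) _ vJ.
Qed.

Lemma st_P d v : d <= i -> v \in Jh d -> Ch d v \subset P v.
Proof.
move=> di vJ; apply: subset_trans (st_C (leq0n d) di vJ) (st_sub st _).
exact: subsetP (st_J (leq0n d) di) _ vJ.
Qed.

Lemma st_massd d v : d <= i -> v \in Jh d -> D <= #|Ch d v| * k ^ xx d.
Proof.
case: d => [|d] di; first exact: (st_mass st).
exact: (ng_mass (st_new st (g := Ordinal (leq_trans di iG)) di)).
Qed.

Lemma st_many d : d <= i -> #|Jh 0| <= #|Jh d| * k ^ (\sum_(j < d) lam j).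
Proof.
elim: d => [|d IH] di; first by rewrite big_ord0 muln1.
apply: leq_trans (IH (ltnW di)) _; rewrite big_ord_recr /= addnC expnD mulnA leq_mul2r.
apply/orP; right.
exact: ng_many (st_new st (g := Ordinal (leq_trans di iG)) di).
Qed.

Lemma stage_oldhubs : oldhubs e P D k (hact i) hgrp f lb sg sg' (Jh i) (Ch i).
Proof.
have up (h : A) : h.1 < i -> h.1.+1 <= i by [].
have N (h : A) (hi : h.1 < i) := st_new st hi.
have sub (h : A) v w : h.1 < i -> v \in Jh i -> w \in Ch i v -> v \in Jh h.1.+1 /\ w \in Ch h.1.+1 v.
  move=> hi vJ wC; split; first exact: subsetP (st_J hi (leqnn i)) _ vJ.
  exact: subsetP (st_C hi (leqnn i) vJ) _ wC.
have subQ (h : A) v (pr : pred T) q : h.1 < i -> v \in Jh i -> #|[set w in Ch h.1.+1 v | pr w]| * k ^ q <= D ->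
   #|[set w in Ch i v | pr w]| * k ^ q <= D.
  move=> hi vJ; apply: leq_trans; rewrite leq_mul2r; apply/orP; right; apply: subset_leq_card.
  by apply/subsetP => w; rewrite !inE => /andP[/(sub h v w hi vJ)[_ ->] ->].
split.
- by move=> v; apply: st_P.
- move=> h w v hi vJ wC; have [vJ' wC'] := sub h v w hi vJ wC.
  have [lJ lnJ] := ng_lab (N h hi) h.2; rewrite -surjective_pairing in lJ lnJ.
  have [fS _] := ng_f (N h hi) h.2 vJ' wC'.
  have fC := subsetP (ng_S (N h hi) h.2) _ fS; rewrite -surjective_pairing in fC.
  split; first exact: subsetP (st_P (ltnW hi) lJ) _ fC.
  by apply: contra lnJ; apply: subsetP (st_J hi (leqnn i)) _.
- move=> h u v v' hi vJ v'J uC; have [vJ1 uC1] := sub h v u hi vJ uC.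
  have v'J1 := subsetP (st_J hi (leqnn i)) _ v'J.
  have := ng_Q (N h hi) h.2 vJ1 v'J1 uC1; rewrite -surjective_pairing.
  exact: subQ.
- move=> h h' u v v' hi h'i g vJ v'J uC; case: (ltngtP h.1 h'.1) => [lt|lt|eq]; last by rewrite /hgrp eq eqxx in g.
    have [vJ1 uC1] := sub h' v u h'i vJ uC; have v'J1 := subsetP (st_J h'i (leqnn i)) _ v'J.
    have := ng_Q2 (N h' h'i) h'.2 lt vJ1 v'J1 uC1; rewrite -surjective_pairing.
    exact: (subQ h' v' (fun w => e (f h w) (f h' u))).
  have [vJ1 uC1] := sub h v u hi vJ uC; have v'J1 := subsetP (st_J hi (leqnn i)) _ v'J.
  have := ng_Q1 (N h hi) h.2 lt vJ1 v'J1 uC1; rewrite -surjective_pairing.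
  exact: (subQ h v' (fun w => e (f h w) (f h' u))).
Qed.

Hypothesis iE : i = G.
Variable ap : L -> T.
Hypothesis ap_ap : forall u v, ~~ e (ap u) (ap v).
Hypothesis ap_P : forall u v z, z \in P v -> e (ap u) z = (u == v).

(** Labels and classes only decrease, so the chosen elements and the images under a hub all lie in
    the classes of every earlier stage ([inW], [SW]). The guarantee [ng_wb] of an earlier group,
    which concerns all vertices of these classes, therefore applies to both kinds. Within a single
    tooth, [ng_bb] and [ng_own] take its place. *)
Lemma stage_hubsys : hubsys e (fun l => ap (lb l)) b f p beta.
Proof.
have sy := teeth_sym tP.
have N (h : A) : newgroup _ _ _ _ _ _ _ _ _ _ _ _ _ _ _ _ _ _ _ _ := st_new st (leq_trans (ltn_ord h.1) (eq_leq (esym iE))).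
have hG (h : A) : h.1 < i by rewrite iE.
have inW (l : A) j d : d <= l.1 -> lb l \in Jh d /\ b l j \in Ch d (lb l).
  move=> dl; have [lJ _] := ng_lab (N l) l.2; have bC := ng_b (N l) l.2 j.
  rewrite -!surjective_pairing in lJ bC; have li := ltnW (hG l).
  split; first exact: subsetP (st_J dl li) _ lJ.
  exact: subsetP (st_C dl li lJ) _ bC.
have SW (h : A) z d : z \in S h -> d <= h.1 -> lb h \in Jh d /\ z \in Ch d (lb h).
  move=> zS dl; have [lJ _] := ng_lab (N h) h.2; have sC := ng_S (N h) h.2.
  rewrite -!surjective_pairing in lJ sC; have li := ltnW (hG h).
  split; first exact: subsetP (st_J dl li) _ lJ.
  exact: subsetP (st_C dl li lJ) _ (subsetP sC _ zS).
have fS (h l : A) j : h.1 < l.1 -> f h (b l j) \in S h /\ e (b l j) (f h (b l j)).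
  move=> hl; have [lJ bC] := inW l j _ hl.
  by have := ng_f (N h) h.2 lJ bC; rewrite -surjective_pairing.
have bP (l : A) j : b l j \in P (lb l).
  have [lJ bC] := inW l j _ (leqnn _); exact: subsetP (st_P (ltnW (hG l)) lJ) _ bC.
have SP (h : A) z : z \in S h -> z \in P (lb h).
  move=> zS; have [lJ bC] := SW h z _ zS (leqnn _); exact: subsetP (st_P (ltnW (hG h)) lJ) _ bC.
have lbne (l l' : A) : l.1 < l'.1 -> lb l != lb l'.
  move=> ll; have [lJ _] := ng_lab (N l') l'.2; have [_ lnJ] := ng_lab (N l) l.2.
  rewrite -!surjective_pairing in lJ lnJ; apply: contraNneq lnJ => ->.
  exact: subsetP (st_J ll (ltnW (hG l'))) _ lJ.
have lbinj l l' : (lb l == lb l') = (l == l').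
  apply/eqP/eqP => [ll|->//]; case: (ltngtP l.1 l'.1) => [lt|lt|/val_inj e1].
  - by have := lbne _ _ lt; rewrite ll eqxx.
  - by have := lbne _ _ lt; rewrite ll eqxx.
  - move: (ng_inj (N l)) ll e1; case: l => l1 l2; case: l' => l1' l2' /= inj ll e1.
    by rewrite -e1 in ll *; rewrite (inj _ _ ll).
have own (l : A) j j' : j != j' -> sep e (hact l.1) hgrp f (p l) (b l j) (b l j').
  by move=> jj; have := ng_bb (N l) l.2 jj; rewrite -surjective_pairing.
have ownS (l : A) j z : z \in S l -> sep e (hact l.1) hgrp f (p l) z (b l j).
  by move=> zS; have := ng_own (N l) (t := l.2) (z := z) j; rewrite -surjective_pairing; apply.
have wb (l : A) j v w : v \in Jh l.1.+1 -> w \in Ch l.1.+1 v -> sep e (hact l.1) hgrp f (beta l j) w (b l j).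
  by move=> vJ wC; have := ng_wb (N l) l.2 j vJ wC; rewrite -surjective_pairing.
have wbS (l h : A) j z : z \in S h -> l.1 < h.1 -> sep e (hact l.1) hgrp f (beta l j) z (b l j).
  by move=> zS lh; have [vJ zC] := SW h z _ zS lh; apply: wb zC.
have wbb (l l' : A) j j' : l.1 < l'.1 -> sep e (hact l.1) hgrp f (beta l j) (b l' j') (b l j).
  by move=> ll; have [vJ zC] := inW l' j' _ ll; apply: wb zC.
split.
- by move=> l l'.
- by move=> l l' j; rewrite (ap_P _ (bP l' j)) lbinj.
- by move=> l h l' j hl; rewrite (ap_P _ (SP h _ _)) ?lbinj //; have [] := fS h l' j hl.
- by move=> h l j hl; have [] := fS h l j hl.
- by move=> l j j' jj; have [] := sepP sy (own l j j' jj).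
- move=> l j j'; case: (eqVneq j j') => [->|jj]; first by rewrite (teeth_irr tP).
  by have [_ []] := sepP sy (own l j j' jj).
- move=> l l' j j'; rewrite -val_eqE neq_ltn => /orP[] lt.
    by have [_ []] := sepP sy (wbb l l' j j' lt).
  by have [_ []] := sepP sy (wbb l' l j' j lt).
- by move=> l h j j' jj hl; have [_ _ /(_ h hl)[]] := sepP sy (own l j j' jj).
- move=> l l' h j j' ll hl' hll; case: (ltngtP l.1 l'.1) => [lt|lt|eq]; last by rewrite (val_inj eq) eqxx in ll.
    case: (ltngtP h.1 l.1) => [hl|lh|hl].
    + by have [_ _ /(_ h hl)[]] := sepP sy (wbb l l' j j' lt).
    + have [zS _] := fS h l' j' hl'; by have [_ []] := sepP sy (wbS l h j _ zS lh).
    + have hl2 : h == l by apply: hll; apply/eqP/val_inj.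
      rewrite (eqP hl2) in hl' *; have [zS _] := fS l l' j' hl'.
      by have [_ []] := sepP sy (ownS l j _ zS).
  have [_ _ /(_ h hl')[]] := sepP sy (wbb l' l j' j lt); by [].
- move=> h h' l l' j j' hh h1 hl hl'; have [zS _] := fS h l j hl; have [zS' _] := fS h' l' j' hl'.
  move: (ng_anti (N h)) hh h1 zS zS'; case: (h) => a1 a2; case: (h') => a1' a2' /= an ne e1.
  rewrite -e1 in ne *; move=> zS zS'; apply: an zS zS'.
  by apply: contraNneq ne => ->.
- move=> h h' l j j' jj hh hl h'l.
  by have [_ _ _ /(_ h h' hl h'l hh)] := sepP sy (own l j j' jj).
- move=> h h' l l' j j' hh hl h'l' ll h'll; case: (ltngtP h'.1 l.1) => [h'l|lh'|h'l].
  + have [_ _ _ /(_ h' h h'l hl)] := sepP sy (wbb l l' j j' ll).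
    by rewrite sy; apply; rewrite /hgrp eq_sym.
  + have [zS _] := fS h' l' j' h'l'.
    by have [_ _ /(_ h hl)[+ _ _ _] _] := sepP sy (wbS l h' j _ zS lh'); rewrite sy.
  + have hl2 : h' == l by apply: h'll; apply/eqP/val_inj.
    rewrite (eqP hl2) in h'l' *; have [zS _] := fS l l' j' h'l'.
    by have [_ _ /(_ h hl)[+ _ _ _] _] := sepP sy (ownS l j _ zS); rewrite sy.
- move=> h l l' j j' hl ll; have [_ _ /(_ h hl)[_ _ _ <-] _] := sepP sy (wbb l l' j j' ll).
  by rewrite sy.
- by move=> h l j j' jj hl; have [_ _ /(_ h hl)[_ _ _ <-] _] := sepP sy (own l j j' jj).
Qed.
End Stage.
End Process.

Lemma pre_exp_monox r n : {homo pre_exp r ^~ n : x x' / x <= x'}.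
Proof.
move=> x x' xx'; elim: n => //= n IH; rewrite leq_add2r leq_add // /pre_rho leq_add2r leq_mul2l ltnS.
by rewrite gc_lab_mono ?orbT.
Qed.

Lemma gc_out_mono R : {homo gc_out R : x x' / x <= x'}.
Proof. by move=> x x' xx'; rewrite /gc_out ltnS gc_exp_monox. Qed.

Lemma pre_exp_le r x n : x <= pre_exp r x n.
Proof. exact: (pre_exp_mono r x (leq0n n)). Qed.

Lemma gc_out_le R x : x <= gc_out R x.
Proof.
rewrite /gc_out; apply: leq_trans (leqnSn _).
by apply: leq_trans (gc_exp_mono R x (leq0n R)).
Qed.

Lemma proc_exp_mono r R n : {homo proc_exp r R n : i j / i <= j}.
Proof.
apply: homo_leq leq_trans _ => // i; rewrite /proc_exp iterS /proc_step.
by apply: leq_trans (leqnSn _); apply: leq_trans (gc_out_le _ _); apply: pre_exp_le.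
Qed.

Lemma proc_pre_mono r R n : {homo proc_pre r R n : i j / i <= j}.
Proof. by move=> i j ij; apply/pre_exp_monox/proc_exp_mono. Qed.

Section Process.
Variables (T L : finType) (e : rel T) (P : L -> {set T}) (D k s c : nat).
Hypothesis tP : teeth e P D k s c.
Let k2 := teeth_k tP.
Let D0 := teeth_D0 tP.
Let k0 : 0 < k. Proof. exact: leq_trans k2. Qed.
Let kx x : 0 < k ^ x. Proof. by rewrite expn_gt0 k0. Qed.
Variables (V E : finType) (e1 e2 : E -> V) (G R M B : nat).
Hypothesis e12 : forall i, e1 i != e2 i.
Let a := (G * R)%N.
Let n := M * 2 ^ a.
Let r := #|E|.
Local Notation Y := (proc_pre r R n).
Hypothesis M0 : 0 < M.
Hypothesis cL : #|L| = k ^ B.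
Hypothesis PL : forall v, D <= #|P v| * k ^ 3.
Hypothesis c1 : gc_exp R (Y G) R + 2 <= c.
Hypothesis c2 : gc_exp r (Y G).+1 r + 2 <= c.
Hypothesis hB : proc_Lam r R n G + gc_lab r (Y G).+1 + gc_lab R (Y G) + 3 <= B.
Let z := gc_out R (Y G) + B.+1.
Hypothesis hs : 3 * z <= s.
Hypothesis k_1 : 2 * (1 + a + a + a * a) <= k.
Hypothesis k_2 : 2 * 2 ^ a <= k.
Hypothesis k_3 : 2 * (R * M * (1 + a + a + a * a) + R + R * a) <= k.
Hypothesis k_4 : 2 * 2 ^ (R * M * a) <= k.
Hypothesis k_5 : #|V| * #|E|.+1 <= k.
Hypothesis k_6 : 2 * n <= k.

Local Notation stg i := (@stage T L e P D k G R M (2 * z) z (proc_exp r R n) (proc_lam r R n) i).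

(** Since [z] is computed from the last round and the exponents increase, the values [z], [2 * z]
    and [3 * z] for [sg'], [sg] and the lower bound on [s] serve all [G] rounds at once. The
    hypothesis [hB] reserves enough labels for every round. *)
Lemma process_stage i : i <= G -> sub2_model e1 e2 e \/
  exists (Jh : nat -> {set L}) (Ch : nat -> L -> {set T}) f lb S b p beta, #|Jh 0| = k ^ B /\ stg i Jh Ch f lb S b p beta.
Proof.
have cA : #|{: 'I_G * 'I_R}| = a by rewrite card_prod !card_ord.
elim: i => [_|i IH iG].
  right.
  have [v _] : exists v : L, v \in setT by apply/card_gt0P; rewrite cardsT cL.
  have [t _] : exists t, t \in P v.
    by apply/card_gt0P; rewrite lt0n; apply: contraTneq (PL v) => ->; rewrite mul0n -ltnNge.
  exists (fun=> setT), (fun=> P), (fun _ w => w), (fun=> v), (fun=> set0), (fun _ _ => t), (fun _ _ => true), (fun _ _ _ => true).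
  by split; [rewrite cardsT | split].
have [|[Jh [Ch [f [lb [S [b [p [beta [cJ st]]]]]]]]]] := IH (ltnW iG); first by left.
have oh := stage_oldhubs st (ltnW iG).
have Cx v : v \in Jh i -> D <= #|Ch i v| * k ^ proc_exp r R n i.
  exact: st_massd st (ltnW iG) i v (leqnn i).
have YG : Y i <= Y G by apply/proc_pre_mono/ltnW.
have YE : pre_exp r (proc_exp r R n i) n = Y i by [].
have outz : gc_out R (Y i) + B.+1 <= z by rewrite leq_add2r gc_out_mono.
have zs : 2 * z <= s by apply: leq_trans hs; rewrite leq_mul2r orbT.
have zz : z <= 2 * z by rewrite leq_pmull.
have Yz : Y i <= z by apply: leq_trans outz; apply: leq_trans (leq_addr _ _); apply: gc_out_le.
have hJ q : q + proc_Lam r R n G <= B -> k ^ q <= #|Jh i|.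
  move=> hq; have := st_many st (ltnW iG) (leqnn i); rewrite cJ => hm.
  rewrite -(leq_pmul2r (kx (\sum_(j < i) proc_lam r R n j))); apply: leq_trans hm.
  rewrite -expnD leq_pexp2l //; apply: leq_trans hq; rewrite leq_add2l.
  by rewrite /proc_Lam (big_ord_widen G) ?(ltnW iG) //= [X in _ <= X](bigID (fun j : 'I_G => j < i)) /= leq_addr.
have nA : M * 2 ^ #|{: 'I_G * 'I_R}| <= n by rewrite cA.
have A_1 : 2 * (1 + #|{: 'I_G * 'I_R}| + #|{: 'I_G * 'I_R}| + #|{: 'I_G * 'I_R}| * #|{: 'I_G * 'I_R}|) <= k by rewrite cA.
have A_2 : 2 * 2 ^ #|{: 'I_G * 'I_R}| <= k by rewrite cA.
have A_3 : 2 * (R * M * (1 + #|{: 'I_G * 'I_R}| + #|{: 'I_G * 'I_R}| + #|{: 'I_G * 'I_R}| * #|{: 'I_G * 'I_R}|) + R + R * #|{: 'I_G * 'I_R}|) <= k by rewrite cA.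
have A_4 : 2 * 2 ^ (R * M * #|{: 'I_G * 'I_R}|) <= k by rewrite cA.
have hJ1 : k ^ (gc_lab r (Y i).+1).+2 <= #|Jh i|.
  apply: hJ; apply: leq_trans hB.
  have := @gc_lab_mono r (Y i).+1 (Y G).+1; rewrite ltnS => /(_ YG).
  move: (gc_lab r (Y i).+1) (gc_lab r _) (gc_lab R _) (proc_Lam _ _ _ _) => p1 p2 p3 p4; clear; lia.
have hc2 : gc_exp r (Y i).+1 r + 2 <= c by apply: leq_trans c2; rewrite leq_add2r gc_exp_monox // ltnS.
have hc1 : gc_exp R (Y i) R + 2 <= c by apply: leq_trans c1; rewrite leq_add2r gc_exp_monox.
have [|[Js [bb [pp [C1 [JsJ cJs th]]]]]] := collective_teeth tP oh zs zz Cx A_1 A_2 e12 (erefl r) M0 nA k_5 k_6 Yz hc2 hJ1.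
  by left.
right.
have hJs : k ^ gc_lab R (Y i) <= #|Js|.
  have h1 : k ^ (gc_lab R (Y i)).+1 <= #|Jh i|.
    apply: hJ; apply: leq_trans hB.
    have := @gc_lab_mono R (Y i) (Y G) YG.
    move: (gc_lab R (Y i)) (gc_lab r _) (gc_lab R _) (proc_Lam _ _ _ _) => p1 p2 p3 p4; clear; lia.
  have h2 := leq_trans h1 cJs; rewrite expnS in h2.
  have h3 : 2 * k ^ gc_lab R (Y i) <= 2 * #|Js| by apply: leq_trans h2; rewrite leq_mul2r k2 orbT.
  by rewrite leq_pmul2l in h3.
have z2 : z + (gc_out R (Y i) + B.+1) <= 2 * z by rewrite mul2n -addnn leq_add2l.
have z3 : 2 * z + (gc_out R (Y i) + B.+1) <= s by apply: leq_trans hs; rewrite (mulSn 2) addnC leq_add2r.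
have cL' : #|L| <= k ^ B by rewrite cL.
have [J' [C' [labn [S' [fn [bn [pn [bt ng]]]]]]]] :=
  add_group tP oh cL' A_3 A_4 outz z2 z3 hc1 JsJ cJs hJs th.
pose gi : 'I_G := Ordinal iG.
exists (fun d => if d == i.+1 then J' else Jh d), (fun d => if d == i.+1 then C' else Ch d),
  (fun h => if h.1 == gi then fn h.2 else f h), (fun h => if h.1 == gi then labn h.2 else lb h),
  (fun h => if h.1 == gi then S' h.2 else S h), (fun h => if h.1 == gi then bn h.2 else b h),
  (fun h => if h.1 == gi then pn h.2 else p h), (fun h => if h.1 == gi then bt h.2 else beta h).
split=> //; case: st => st1 st2 st3; split=> // g.
rewrite ltnS leq_eqVlt => /orP[/eqP gE|gi'].
  have -> : g = gi by apply/val_inj.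
  rewrite /= !eqxx (ltn_eqF (ltnSn i)).
  apply: newgroup_eq ng => h; rewrite /hact => hi.
  by rewrite -val_eqE /= (ltn_eqF hi).
have ggi : (g == gi) = false by rewrite -val_eqE /= (ltn_eqF gi').
rewrite /= !ggi (ltn_eqF (ltn_trans gi' (ltnSn i))) eqSS (ltn_eqF gi').
apply: newgroup_eq (st1 g gi') => h; rewrite /hact => hi.
by rewrite -val_eqE /= (ltn_eqF (ltn_trans hi gi')).
Qed.

Lemma process (ap : L -> T) :
  (forall u v, ~~ e (ap u) (ap v)) -> (forall u v t, t \in P v -> e (ap u) t = (u == v)) ->
  sub2_model e1 e2 e \/ exists (a' : 'I_G * 'I_R -> T) (b : 'I_G * 'I_R -> 'I_M -> T) f p beta, hubsys e a' b f p beta.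
Proof.
move=> h1 h2; have [|[Jh [Ch [f [lb [S [b [p [beta [_ st]]]]]]]]]] := process_stage (leqnn G); first by left.
right; exists (fun l => ap (lb l)), b, f, p, beta.
exact: (stage_hubsys tP st (leqnn G) (erefl G) h1 h2).
Qed.
End Process.

(** * Extracting the subdivision *)

Section Selection.
Variables (T : finType) (e : rel T) (G R M : nat).
Local Notation A := ('I_G * 'I_R)%type.
Variables (ap : A -> T) (b : A -> 'I_M -> T) (f : A -> T -> T) (p : A -> A -> bool)
    (beta : A -> 'I_M -> A -> bool).
Hypothesis H : hubsys e ap b f p beta.
Hypothesis sy : symmetric e.
Hypothesis eirr : irreflexive e.
Variables (V E : finType) (e1 e2 : E -> V).
Hypothesis e12 : forall i, e1 i != e2 i.
Hypothesis M0 : 0 < M.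
Hypothesis VM : #|V| <= M.
Hypothesis EM : #|E| <= M.

Let vM (u : V) : 'I_M := widen_ord VM (enum_rank u).
Let eM (i : E) : 'I_M := widen_ord EM (enum_rank i).

Lemma vM_inj : injective vM.
Proof. by move=> u v /(congr1 val)/= /val_inj/enum_rank_inj. Qed.

Lemma eM_inj : injective eM.
Proof. by move=> u v /(congr1 val)/= /val_inj/enum_rank_inj. Qed.

(* An edge with ends [u], [v], the group of [l u] being the earlier one, becomes the path
   [ap (l u)], [f (l u) x], [x], [ap (l v)] with [x] an element of the tooth of [l v]. *)
Lemma apex_model (l : V -> A) :
  (forall u v, (l u).1 = (l v).1 -> u = v) ->
  (forall u v, (l u).1 < (l v).1 -> ~~ p (l v) (l u) /\ forall j, ~~ beta (l v) j (l u)) ->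
  sub2_model e1 e2 e.
Proof.
move=> linj lpb.
have linj' : injective l by move=> u v uv; apply: linj; rewrite uv.
have l1 u v : (l u).1 == (l v).1 -> l u == l v by move=> /eqP/linj->.
have apinj : injective (fun u => ap (l u)).
  move=> u v uv; have := hs_apb H (l u) (l v) (Ordinal M0).
  by rewrite uv (hs_apb H) eqxx => /esym/eqP/linj'.
have e12l i : (l (e1 i)).1 != (l (e2 i)).1.
  by apply: contra (e12 i) => /eqP/linj->.
pose low i := (l (e1 i)).1 < (l (e2 i)).1.
pose lo i := if low i then e1 i else e2 i.
pose hi i := if low i then e2 i else e1 i.
have lohi i : (l (lo i)).1 < (l (hi i)).1.
  by rewrite /lo /hi; case: ifP => //; rewrite /low; case: ltngtP (e12l i) => // /val_inj ->; rewrite eqxx.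
pose Pv i := f (l (lo i)) (b (l (hi i)) (eM i)).
pose Qv i := b (l (hi i)) (eM i).
have PQ i : e (Qv i) (Pv i) by apply: (hs_own H); apply: lohi.
have QQ i i' : i != i' -> ~~ e (Qv i) (Qv i').
  move=> ii'; rewrite /Qv; case: (eqVneq (l (hi i)).1 (l (hi i')).1) => [/linj->|ne]; first exact: (hs_bb H).
  exact: (hs_bb' H).
have QP i i' : i != i' -> ~~ e (Qv i) (Pv i').
  move=> ii'; have jj : eM i != eM i' by rewrite (inj_eq eM_inj).
  rewrite /Qv /Pv; case: (eqVneq (l (hi i)).1 (l (hi i')).1) => [/linj->|ne].
    by apply: (hs_bf H) => //; apply: lohi.
  by apply: (hs_bf' H) => //; apply: l1.
have PP i i' : i != i' -> ~~ e (Pv i) (Pv i').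
  wlog le : i i' / (l (hi i)).1 <= (l (hi i')).1.
    move=> h ii'; case: (leqP (l (hi i)).1 (l (hi i')).1) => [le|/ltnW le]; first exact: h.
    by rewrite sy; apply: h; rewrite // eq_sym.
  move=> ii'; have jj : eM i != eM i' by rewrite (inj_eq eM_inj).
  rewrite /Pv; case: (eqVneq (l (lo i)).1 (l (lo i')).1) => [/linj ll|ll].
    case: (eqVneq (l (hi i)).1 (l (hi i')).1) => [/linj hh|hh].
      have lt := lohi i'; rewrite ll hh (hs_p H jj) //.
      by have [] := lpb _ _ lt.
    have lt : (l (hi i)).1 < (l (hi i')).1 by rewrite ltn_neqAle hh.
    have lt2 := lohi i; rewrite -ll (hs_beta H) //.
    by have [_] := lpb _ _ lt2; apply.
  case: (eqVneq (l (hi i)).1 (l (hi i')).1) => [/linj hh|hh].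
    have lt := lohi i; have lt' := lohi i'; rewrite hh in lt *.
    exact: (hs_ff1 H).
  have lt : (l (hi i)).1 < (l (hi i')).1 by rewrite ltn_neqAle hh.
  by apply: (hs_ff2 H) => //; apply: l1.
have aQ u i : e (ap (l u)) (Qv i) = (u == hi i) by rewrite (hs_apb H) (inj_eq linj').
have aP u i : e (ap (l u)) (Pv i) = (u == lo i) by rewrite (hs_apf H) ?lohi // (inj_eq linj').
exists (fun u => ap (l u)), (fun i => if low i then Pv i else Qv i), (fun i => if low i then Qv i else Pv i).
split=> //.
- split; first by move=> u w; apply: (hs_ap H).
  by move=> u i; rewrite /lo /hi in aP aQ; case: ifP => li; rewrite aP aQ li.
- move=> i i'; case: (eqVneq i i') => [->|ii']; first by rewrite !eirr.
  have i'i : i' != i by rewrite eq_sym.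
  by case: ifP => _; case: ifP => _; split; rewrite ?QQ ?PP ?QP // sy QP.
- move=> i i'; case: (eqVneq i i') => [->|ii']; first by case: ifP => _; rewrite ?PQ // sy PQ.
  have i'i : i' != i by rewrite eq_sym.
  by apply/negbTE; case: ifP => _; case: ifP => _; rewrite ?QQ ?PP ?QP // sy QP.
Qed.

Definition pset (g : 'I_G) (l : A) : {set 'I_R} := [set t | p l (g, t)].
Definition bset (g : 'I_G) (l : A) (j : 'I_M) : {set 'I_R} := [set t | beta l j (g, t)].

Lemma hub_of_edge (Q : {set 'I_R}) : #|E| <= #|Q| -> exists2 t : E -> 'I_R, injective t & forall i, t i \in Q.
Proof.
move=> h; exists (fun i => enum_val (widen_ord h (enum_rank i))).
  by move=> i j /enum_val_inj/(congr1 val)/= /val_inj/enum_rank_inj.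
by move=> i; apply: enum_valP.
Qed.

(** The branch vertices are elements of the single tooth of [l]. Each edge takes its own hub of
    group [g], because images under different hubs of one group are anticomplete. *)
Lemma star_own (g : 'I_G) (l : A) : g < l.1 -> #|E| <= #|pset g l| -> sub2_model e1 e2 e.
Proof.
move=> gl /hub_of_edge[t tinj tQ].
pose y (i : E) (u : V) := f (g, t i) (b l (vM u)).
apply: (@star_model V E e1 e2 T e (fun u => b l (vM u)) y) => //.
- move=> u v uv; apply/eqP; apply: contraT => ne.
  have ne' : vM u != vM v by rewrite (inj_eq vM_inj).
  by have := hs_b H l ne'; rewrite uv eqxx.
- by move=> u w; apply: (hs_bb H).
- move=> u i w; case: (eqVneq u w) => [->|uw]; first exact: (hs_own H).
  by apply/negbTE; apply: (hs_bf H) => //; rewrite (inj_eq vM_inj).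
- move=> i i' u w ii'; apply: (hs_ff H) => //.
  by apply: contra ii' => /eqP[/tinj->].
- move=> i; rewrite (hs_p H) ?(inj_eq vM_inj) //.
  by have := tQ i; rewrite inE.
Qed.

(** The branch vertices come from teeth of different groups. The pattern [beta] of a pair is that of
    the earlier element; pigeonhole over the [2 ^ R] sets of hubs gives [#|V|] elements with the
    same [bset], so a hub in it joins the images of any two of them. *)
Lemma star_later (g : 'I_G) (X : {set 'I_G}) (l : 'I_G -> A) (j : 'I_G -> 'I_M) :
  (forall g', g' \in X -> [/\ g < g', (l g').1 = g' & #|E| <= #|bset g (l g') (j g')|]) ->
  #|V| * 2 ^ R <= #|X| -> sub2_model e1 e2 e.
Proof.
move=> hX cX.
case: (posnP #|V|) => [V0|V0].
  have E0 : E -> False by move=> i; have := fintype0 (e1 i) V0.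
  have V0' : V -> False by move=> v; have := fintype0 v V0.
  by exists (fun v => match V0' v with end), (fun i => match E0 i with end), (fun i => match E0 i with end);
    split=> [v|||]; [case: (V0' v) | split=> v; case: (V0' v) | move=> i; case: (E0 i) | move=> i; case: (E0 i)].
have [|Q hQ] := majority (fun g' => bset g (l g') (j g')) (X := X).
  by apply: leq_trans cX; rewrite muln_gt0 V0 expn_gt0.
set Y := [set x in X | _] in hQ.
have cY : #|V| <= #|Y|.
  rewrite -(@leq_pmul2r (2 ^ R)) ?expn_gt0 //; apply: leq_trans cX _; rewrite mulnC.
  by move: hQ; rewrite -cardsT -powersetT card_powerset cardsT card_ord mulnC.
pose gv (u : V) : 'I_G := enum_val (widen_ord cY (enum_rank u)).
have gvinj : injective gv by move=> u v /enum_val_inj/(congr1 val)/= /val_inj/enum_rank_inj.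
have gvY u : gv u \in X /\ bset g (l (gv u)) (j (gv u)) = Q.
  by have := enum_valP (widen_ord cY (enum_rank u)); rewrite inE => /andP[? /eqP].
have cQ : #|E| <= #|Q|.
  have [u _] : exists u : V, u \in V by apply/card_gt0P.
  by have [uX <-] := gvY u; have [_ _] := hX _ uX.
have [t tinj tQ] := hub_of_edge cQ.
have l1 u : (l (gv u)).1 = gv u by have [uX _] := gvY u; have [_ ->] := hX _ uX.
have lg u : g < (l (gv u)).1 by have [uX _] := gvY u; have [? ->] := hX _ uX.
pose x (u : V) := b (l (gv u)) (j (gv u)).
have lne u v : u != v -> (l (gv u)).1 != (l (gv v)).1 by rewrite !l1 (inj_eq gvinj).
apply: (@star_model V E e1 e2 T e x (fun i u => f (g, t i) (x u))) => //.
- move=> u v uv; apply/eqP; apply: contraT => ne.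
  have := hs_apb H (l (gv u)) (l (gv v)) (j (gv v)); rewrite -/(x v) -uv (hs_apb H) eqxx => /esym/eqP ll.
  by have := lne _ _ ne; rewrite ll eqxx.
- move=> u w; case: (eqVneq u w) => [->|uw]; first by rewrite eirr.
  by apply: (hs_bb' H); apply: lne.
- move=> u i w; case: (eqVneq u w) => [->|uw]; first exact: (hs_own H).
  apply/negbTE; apply: (hs_bf' H) => //; first exact: lne.
  by move=> /eqP h; have := lg u; rewrite -h ltnn.
- move=> i i' u w ii'; apply: (hs_ff H) => //.
  by apply: contra ii' => /eqP[/tinj->].
- move=> i; have ne := lne _ _ (e12 i).
  have tb u : beta (l (gv u)) (j (gv u)) (g, t i) by have [_ gQ] := gvY u; have := tQ i; rewrite -gQ inE.
  by case: (ltngtP (l (gv (e1 i))).1 (l (gv (e2 i))).1) => [lt|lt|/val_inj eq];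
    [rewrite (hs_beta H) | rewrite sy (hs_beta H) | rewrite eq eqxx in ne].
Qed.

Definition rich (g g' : 'I_G) : bool :=
  (g < g') && [exists l : A, (l.1 == g') && [exists j, #|E| <= #|bset g l j|]].

(** Picking the earliest remaining group and discarding those that are [rich] with it uses up at
    most [q] groups each time. *)
Lemma sparse_chain (q n : nat) (X : {set 'I_G}) : 0 < q -> (forall g, #|[set g' | rich g g']| < q) -> n * q <= #|X| ->
  0 < G -> exists gs : nat -> 'I_G, (forall i, i < n -> gs i \in X) /\
    forall i i', i < i' -> i' < n -> gs i < gs i' /\ ~~ rich (gs i) (gs i').
Proof.
move=> q0 hq + G0; elim: n X => [|n IH] X hX; first by exists (fun=> Ordinal G0).
have [g0 g0X] : exists g, g \in X by apply/card_gt0P; apply: leq_trans hX; rewrite muln_gt0.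
have [g gX gmin] : exists2 g, g \in X & forall g', g' \in X -> g <= g'.
  by case: (@arg_minnP _ g0 (mem X) (fun g => g : nat) g0X) => g gX gm; exists g.
have [|gs [h1 h2]] := IH ((X :\ g) :\: [set g' | rich g g']).
  have := cardsID [set g' | rich g g'] (X :\ g); have := cardsD1 g X; rewrite gX add1n.
  have : #|(X :\ g) :&: [set g' | rich g g']| <= #|[set g' | rich g g']| by rewrite subset_leq_card ?subsetIr.
  have := hq g; rewrite mulSn in hX.
  move: hX; move: (n * q) #|X :\ g :\: _| #|X :\ g| #|[set g' | rich g g']| #|_ :&: _| => n1 n2 n3 n4 n5; clear; lia.
exists (fun i => if i is i'.+1 then gs i' else g); split.
  by case=> [|i] //; rewrite ltnS => /h1 /setDP[/setD1P[]].
case=> [|i] [|i'] //; rewrite !ltnS => ii' i'n; last exact: h2.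
have /setDP[/setD1P[ne gX'] nr] := h1 _ i'n; rewrite inE in nr; split=> //.
by rewrite ltn_neqAle gmin // eq_sym -val_eqE in ne *; rewrite ne.
Qed.

(** The hubs are chosen from the last group to the first, since the bounds count the unwanted
    earlier hubs for a given later one, not conversely. A later hub excludes at most [M.+1 * #|E|]
    candidates: one share for [p], and one for [beta] at each of its [M] elements. *)
Lemma choose_hubs (gs : nat -> 'I_G) n : #|E| > 0 -> n * (M.+1 * #|E|) < R ->
  (forall i i', i < i' -> i' < n -> gs i < gs i' /\ ~~ rich (gs i) (gs i')) ->
  (forall (g : 'I_G) (l : A), g < l.1 -> #|pset g l| < #|E|) ->
  exists s : nat -> 'I_R, forall i i', i < i' -> i' < n ->
    ~~ p (gs i', s i') (gs i, s i) /\ forall j, ~~ beta (gs i', s i') j (gs i, s i).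
Proof.
move=> E0 nR hg hp.
have R0 : 0 < R by apply: leq_trans nR.
suff: forall d, d <= n -> exists s : nat -> 'I_R, forall i i', i < i' -> i' < n -> n - d <= i ->
    ~~ p (gs i', s i') (gs i, s i) /\ forall j, ~~ beta (gs i', s i') j (gs i, s i).
  by move=> /(_ n (leqnn n))[s hs]; exists s => i i' ii' i'n; apply: hs; rewrite ?subnn.
elim=> [_|d IH dn].
  exists (fun=> Ordinal R0) => i i' ii' i'n; rewrite subn0 => ni.
  by have := leq_trans (ltn_trans ii' i'n) ni; rewrite ltnn.
have [s hs] := IH (ltnW dn).
set i0 := n - d.+1.
have i0n : i0.+1 = n - d by rewrite /i0 subnSK.
pose bad (q : 'I_n) : {set 'I_R} := if i0 < q then pset (gs i0) (gs q, s q) :|: \bigcup_j bset (gs i0) (gs q, s q) j else set0.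
have cbad q : #|bad q| <= M.+1 * #|E|.
  rewrite /bad; case: ifP => [iq|_]; last by rewrite cards0.
  have [lt nr] := hg _ _ iq (ltn_ord q).
  apply: leq_trans (leq_card_setU _ _) _; rewrite mulSn leq_add ?(ltnW (hp _ _ _)) //.
  apply: leq_trans (card_bigcup _ _) _; apply: leq_sum_ord => j.
  move: nr; rewrite /rich lt /= negb_exists => /forallP/(_ (gs q, s q)); rewrite /= eqxx /=.
  by rewrite negb_exists => /forallP/(_ j); rewrite -ltnNge => /ltnW.
have [t tb] : exists t : 'I_R, t \notin \bigcup_q bad q.
  have : ~~ ([set: 'I_R] \subset \bigcup_q bad q).
    apply/negP => /subset_leq_card; rewrite cardsT card_ord => h.
    have := leq_trans h (card_bigcup _ _).
    have := leq_sum_ord cbad => h2 h3; have := leq_ltn_trans (leq_trans h3 h2) nR.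
    by rewrite ltnn.
  by case/subsetPn => t _ tb; exists t.
exists (fun i => if i == i0 then t else s i) => i i' ii' i'n.
rewrite leq_eqVlt => /orP[/eqP ei|lt].
  rewrite -ei eqxx (gtn_eqF (leq_ltn_trans (eq_leq ei) ii')).
  have : t \notin bad (Ordinal i'n) by apply: contra tb => tb; apply/bigcupP; exists (Ordinal i'n).
  rewrite /bad /= ei ii' inE negb_or => /andP[]; rewrite inE => -> h; split=> // j.
  by apply: contra h => h; apply/bigcupP; exists j => //; rewrite inE.
rewrite (gtn_eqF lt) (gtn_eqF (ltn_trans lt ii')); apply: hs => //.
by rewrite -i0n.
Qed.

Lemma selection : #|V| * (#|V| * 2 ^ R).+1 <= G -> 0 < G -> #|V| * (M.+1 * #|E|) < R -> sub2_model e1 e2 e.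
Proof.
move=> hG G0 hR.
case: (boolP [exists g : 'I_G, [exists l : A, (g < l.1) && (#|E| <= #|pset g l|)]]) => [/existsP[g /existsP[l /andP[]]]|hp].
  exact: star_own.
case: (boolP [exists g : 'I_G, #|V| * 2 ^ R <= #|[set g' | rich g g']|]) => [/existsP[g hg]|hr].
  have lj (g' : 'I_G) : exists lj : A * 'I_M, g' \in [set g' | rich g g'] ->
      [/\ g < g', lj.1.1 = g' & #|E| <= #|bset g lj.1 lj.2|].
    have R0 : 0 < R by apply: leq_trans hR.
    case: (boolP (rich g g')) => [|h]; last by exists ((g, Ordinal R0), Ordinal M0); rewrite inE (negbTE h).
    by move=> /andP[gg /existsP[l /andP[/eqP lg /existsP[j hj]]]]; exists (l, j).
  have [lj' hlj] := fin_all_exists lj.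
  exact: (@star_later g _ (fun g' => (lj' g').1) (fun g' => (lj' g').2) hlj hg).
have hp' (g : 'I_G) (l : A) : g < l.1 -> #|pset g l| < #|E|.
  move=> gl; move: hp; rewrite negb_exists => /forallP/(_ g); rewrite negb_exists => /forallP/(_ l).
  by rewrite gl /= -ltnNge.
(* The successor keeps the bound positive, as [sparse_chain] demands, even when [V] is empty. *)
have hr' g : #|[set g' | rich g g']| < (#|V| * 2 ^ R).+1.
  move: hr; rewrite negb_exists => /forallP/(_ g); rewrite -ltnNge => /ltnW; by rewrite ltnS.
case: (posnP #|E|) => [E0|E0].
  have E0' : E -> False by move=> i; have := fintype0 i E0.
  have VG : #|V| <= G by apply: leq_trans hG; rewrite leq_pmulr.
  have R0 : 0 < R by apply: leq_trans hR.
  pose l (u : V) : A := (widen_ord VG (enum_rank u), Ordinal R0).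
  exists (fun u => ap (l u)), (fun i => match E0' i with end), (fun i => match E0' i with end).
  split=> [u v uv||i|i]; [ | split=> [u w|u i]; [exact: (hs_ap H)|] | |]; try by case: (E0' i).
  have := hs_apb H (l u) (l v) (Ordinal M0); rewrite uv (hs_apb H) eqxx => /esym/eqP[].
  by move/val_inj/enum_rank_inj.
have [|gs [_ hgs]] := @sparse_chain (#|V| * 2 ^ R).+1 #|V| setT (ltn0Sn _) hr' _ G0; first by rewrite cardsT card_ord.
have [s hs] := choose_hubs E0 hR hgs hp'.
pose l (u : V) := (gs (enum_rank u), s (enum_rank u)).
have rV (u : V) : enum_rank u < #|V| by apply: ltn_ord.
have mono (u v : V) : enum_rank u < enum_rank v -> (l u).1 < (l v).1 by move=> lt; have [] := hgs _ _ lt (rV v).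
have key (u v : V) : (l u).1 < (l v).1 -> enum_rank u < enum_rank v.
  move=> lt; case: (ltngtP (enum_rank u) (enum_rank v)) => // [/mono h1|/val_inj/enum_rank_inj uv].
    by case: ltngtP h1 lt.
  by rewrite uv ltnn in lt.
apply: (apex_model (l := l)).
  move=> u v uv; case: (ltngtP (enum_rank u) (enum_rank v)) => [/mono|/mono|/val_inj/enum_rank_inj//].
    by rewrite uv ltnn.
  by rewrite uv ltnn.
by move=> u v /key lt; apply: hs lt (rV v).
Qed.
End Selection.

(** * Teeth in a sparse set *)

Lemma markov (T : finType) (X : {set T}) (F : T -> nat) q S :
  #|[set y in X | S < F y * q]| * S <= (\sum_(y in X) F y) * q.
Proof.
rewrite big_distrl /= [X in _ <= X](bigID (fun y => S < F y * q)) /= -sum_nat_const.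
apply: leq_trans _ (leq_addr _ _).
rewrite [X in _ <= X](eq_bigl (mem [set y in X | S < F y * q])); last by move=> u; rewrite /= inE.
by apply: leq_sum => u; rewrite inE => /andP[_ /ltnW].
Qed.

Lemma greedy_seq (T : finType) (X : {set T}) (bad : rel T) w n : 0 < #|X| ->
  (forall a, a \in X -> #|[set y in X | bad a y]| <= w) -> n * w < #|X| ->
  exists a : nat -> T, (forall i, i < n -> a i \in X) /\ forall i j, i < j -> j < n -> ~~ bad (a i) (a j).
Proof.
move=> X0 hw hn; case/card_gt0P: X0 => x0 x0X.
suff: forall d, d <= n -> exists a : nat -> T, (forall i, i < d -> a i \in X) /\ forall i j, i < j -> j < d -> ~~ bad (a i) (a j).
  by apply.
elim=> [_|d IH dn]; first by exists (fun=> x0).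
have [a [h1 h2]] := IH (ltnW dn).
have : ~~ (X \subset \bigcup_(i < d) [set y in X | bad (a i) y]).
  apply/negP => /subset_leq_card h; have := leq_trans h (card_bigcup _ _); apply/negP; rewrite -ltnNge.
  apply: leq_ltn_trans hn; apply: (@leq_trans (d * w)); last by rewrite leq_mul2r ltnW ?orbT.
  by apply: leq_sum_ord => i; apply: hw; apply: h1.
case/subsetPn => y yX yb; exists (fun i => if i == d then y else a i); split.
  by move=> i; rewrite ltnS leq_eqVlt; case: eqP => //= _; apply: h1.
move=> i j ij; rewrite ltnS leq_eqVlt => /orP[/eqP jd|jd].
  subst j; rewrite eqxx (ltn_eqF ij); apply: contra yb => yb; apply/bigcupP; exists (Ordinal ij) => //.
  by rewrite inE yX.
by rewrite (ltn_eqF jd) (ltn_eqF (ltn_trans ij jd)); apply: h2.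
Qed.

Section Teeth.
Variables (T : finType) (e : rel T).
Hypothesis sy : symmetric e.
Hypothesis irr : irreflexive e.
Variables (Y : {set T}) (D k B s c : nat).
Local Notation N y := [set z in Y | e y z].
Hypothesis degD : forall y, y \in Y -> #|N y| <= D.
Hypothesis half : #|Y| < 2 * #|[set y in Y | D <= 4 * #|N y|]|.
Hypothesis D0 : 0 < D.
Hypothesis k4 : 4 <= k.
Hypothesis B0 : 0 < B.
(** [B] pays for the [k ^ B] apexes, [s] for the sparsity asked of the teeth, and 3 is the margin
    that keeps [D / k ^ 3] vertices in each tooth. *)
Let u := B + s + 3.
Hypothesis kQ : k ^ (B + u + 2) * D <= #|Y|.
Hypothesis sc : s <= c.
Hypothesis crit : forall X : nat -> {set T}, (forall i, i < k -> X i \subset Y) ->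
    (forall i j, i < j -> j < k -> apart e (X i) (X j)) -> exists2 i, i < k & #|X i| * k ^ c < D.

Let k0 : 0 < k. Proof. exact: leq_trans k4. Qed.
Let kx x : 0 < k ^ x. Proof. by rewrite expn_gt0 k0. Qed.

Definition edge_count (X Z : {set T}) := \sum_(x in X) #|[set z in Z | e x z]|.

Lemma edge_countC X Z : edge_count X Z = edge_count Z X.
Proof.
rewrite /edge_count; under eq_bigr do rewrite -sum1_card.
under [RHS]eq_bigr do rewrite -sum1_card.
rewrite (exchange_big_dep (mem Z)) /=; last by move=> x z _; rewrite inE => /andP[].
by apply: eq_bigr => z zZ; apply: eq_bigl => x; rewrite !inE zZ sy.
Qed.

Lemma sum_le_deg (X : {set T}) (F : T -> nat) w : (forall x, x \in X -> F x <= w) -> #|X| <= D -> \sum_(x in X) F x <= D * w.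
Proof. by move=> h XD; apply: leq_trans (leq_sum_const h) _; rewrite leq_mul2r XD orbT. Qed.

Let bad (a y : T) := [|| a == y, e a y, D < #|N a :&: N y| * k ^ u | D * D < edge_count (N a) (N y) * k ^ u].

Let sum_common a : a \in Y -> \sum_(y in Y) #|N a :&: N y| <= D * D.
Proof.
move=> aY.
have -> : \sum_(y in Y) #|N a :&: N y| = edge_count Y (N a).
  by apply: eq_bigr => y _; apply: eq_card => z; rewrite !inE; case: (z \in Y); rewrite /= ?andbF.
rewrite edge_countC; apply: sum_le_deg; last exact: degD.
by move=> x; rewrite inE => /andP[xY _]; apply: degD.
Qed.

Let sum_ee a : a \in Y -> \sum_(y in Y) edge_count (N a) (N y) <= D * D * D.
Proof.
move=> aY; rewrite /edge_count exchange_big /= -mulnA.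
apply: sum_le_deg; last exact: degD.
move=> x; rewrite inE => /andP[xY _]; apply: leq_trans (sum_common xY).
apply: leq_sum => y _; apply: subset_leq_card; apply/subsetP => z; rewrite !inE.
by move=> /andP[/andP[-> ->] ->].
Qed.

(** From [a] start at most [D * D] walks of length two and [D * D * D] of length three. By Markov's
    inequality at most [D * k ^ u] vertices end more than [D / k ^ u] of the former, and at most as
    many end more than [D * D / k ^ u] of the latter. *)
Lemma few_bad a : a \in Y -> #|[set y in Y | bad a y]| <= D * (2 * k ^ u + 2).
Proof.
move=> aY.
have sub : [set y in Y | bad a y] \subset ([set a] :|: N a) :|: ([set y in Y | D < #|N a :&: N y| * k ^ u] :|: [set y in Y | D * D < edge_count (N a) (N y) * k ^ u]).
  apply/subsetP => y; rewrite !inE => /andP[-> /or4P[/eqP->|->|->|->]]; rewrite ?eqxx ?orbT //=.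
apply: leq_trans (subset_leq_card sub) _; apply: leq_trans (leq_card_setU _ _) _.
rewrite addnC mulnDr leq_add //.
  rewrite mulnCA mul2n -addnn; apply: leq_trans (leq_card_setU _ _) _; apply: leq_add.
    rewrite -(leq_pmul2r D0); apply: leq_trans (markov _ _ _ _) _.
    by rewrite mulnAC leq_mul2r sum_common ?orbT.
  have DD : 0 < D * D by rewrite muln_gt0 D0.
  rewrite -(leq_pmul2r DD); apply: leq_trans (markov _ _ _ _) _.
  by rewrite mulnAC mulnA leq_mul2r sum_ee ?orbT.
apply: leq_trans (leq_card_setU _ _) _; rewrite cards1 muln2 -addnn leq_add //; exact: degD.
Qed.

(** The apexes are chosen greedily among the vertices of degree at least [D / 4] so that no pair is
    [bad]. A tooth is the neighbourhood of its apex, without the vertices seen by another apex or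
    having too many neighbours in another neighbourhood. *)
Lemma exists_teeth : exists (ap : 'I_(k ^ B) -> T) (P : 'I_(k ^ B) -> {set T}),
  [/\ teeth e P D k s c, forall v, D <= #|P v| * k ^ 3,
      forall v w, ~~ e (ap v) (ap w) & forall v w t, t \in P w -> e (ap v) t = (v == w)].
Proof.
pose Ys := [set y in Y | D <= 4 * #|N y|].
have YsY y : y \in Ys -> y \in Y by rewrite inE => /andP[].
have cYs : k ^ B * (D * (2 * k ^ u + 2)) < #|Ys|.
  have h1 : k ^ (B + u + 2) * D < 2 * #|Ys| by apply: leq_ltn_trans half.
  have h2 u' : 2 * (k ^ B * (D * (2 * k ^ u' + 2))) <= k ^ (B + u' + 2) * D.
    rewrite !expnD; have := kx u'; have : 16 <= k ^ 2 by rewrite -[16]/(4 ^ 2) leq_exp2r.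
    move: (k ^ 2) (k ^ u') (k ^ B) => p2 pu pB h16 hu.
    have : 2 * (2 * pu + 2) <= pu * p2.
      have := leq_mul (leqnn pu) h16; move: (pu * p2) hu; clear; lia.
    move=> h; have := leq_mul (leqnn (pB * D)) h; congr (_ <= _); clear; lia.
  by have := leq_ltn_trans (h2 u) h1; rewrite ltn_pmul2l.
have [||a [aY an]] := @greedy_seq _ Ys bad (D * (2 * k ^ u + 2)) (k ^ B) _ _ cYs.
- by apply: leq_trans cYs.
- move=> a aY; apply: leq_trans (few_bad (YsY _ aY)); apply: subset_leq_card.
  by apply/subsetP => y; rewrite !inE => /andP[/andP[-> _] ->].
pose n := k ^ B.
pose ap (v : 'I_n) := a v.
have apY v : ap v \in Y by apply: YsY; apply: aY.
have apg v w : v != w -> [/\ ap v != ap w, ~~ e (ap v) (ap w), #|N (ap v) :&: N (ap w)| * k ^ u <= D & edge_count (N (ap v)) (N (ap w)) * k ^ u <= D * D].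
  wlog lt : v w / v < w.
    move=> h vw; case: (ltngtP v w) => [lt|lt|/val_inj eq]; [exact: h| |by rewrite eq eqxx in vw].
    have [|h1 h2 h3 h4] := h w v lt; first by rewrite eq_sym.
    by split; rewrite 1?eq_sym 1?sy 1?setIC // edge_countC.
  move=> _; have := an v w lt (ltn_ord w); rewrite /bad !negb_or -!leqNgt.
  by move=> /and4P[h1 h2 h3 h4].
pose P v := N (ap v) :\: \bigcup_(w | w != v) (N (ap w) :|: [set x in N (ap v) | D < #|[set z in N (ap w) | e x z]| * k ^ s]).
have PN v : P v \subset N (ap v) by apply: subsetDl.
have PY v x : x \in P v -> x \in Y by move=> /(subsetP (PN v)); rewrite inE => /andP[].
have Pno v w x : w != v -> x \in P v -> x \notin N (ap w) /\ #|[set z in N (ap w) | e x z]| * k ^ s <= D.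
  move=> wv /setDP[xN xB]; split.
    by apply: contra xB => h; apply/bigcupP; exists w => //; rewrite inE h.
  rewrite leqNgt; apply: contra xB => h; apply/bigcupP; exists w => //.
  by rewrite inE; apply/orP; right; rewrite inE xN.
have UY x : x \in \bigcup_v P v -> x \in Y by move=> /bigcupP[v _ /PY].
have apnon v w : ~~ e (ap v) (ap w).
  by case: (eqVneq v w) => [->|/apg[]//]; rewrite irr.
have kn : k <= n by rewrite -[k]expn1 leq_pexp2l.
exists ap, P; split=> //; first split=> //.
- by apply: leq_trans k4.
(* The singletons of [k] apexes are pairwise apart, so [crit] gives [k ^ c < D]; this yields
   [teeth_big] because [s <= c]. *)
- have [i ik|i j ij jk|i ik] := crit (X := fun i => [set a i]).
  + by rewrite sub1set; apply/YsY/aY/(leq_trans ik).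
  + have jn := leq_trans jk kn; split.
      by move=> x y /set1P-> /set1P->; have := apnon (Ordinal (ltn_trans ij jn)) (Ordinal jn).
    rewrite disjoints1 inE; have [] // := apg (Ordinal (ltn_trans ij jn)) (Ordinal jn).
    by rewrite -val_eqE /= (ltn_eqF ij).
  + rewrite cards1 mul1n => /ltnW; apply: leq_trans; by rewrite leq_pexp2l.
- move=> v w x xv xw; apply/eqP; apply: contraT => vw.
  by have [/negP[]] := Pno w v x vw xw; apply: subsetP xv.
- by move=> v; apply: leq_trans (degD (apY v)); apply: subset_leq_card.
- move=> x /UY xY; apply: leq_trans (degD xY); apply: subset_leq_card.
  by apply/subsetP => y; rewrite !inE => /andP[/UY -> ->].
- move=> v w x vw xv; have wv : w != v by rewrite eq_sym.
  have [_ h] := Pno v w x wv xv; apply: leq_trans h.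
  rewrite leq_mul2r; apply/orP; right; apply: subset_leq_card.
  by apply/subsetP => y; rewrite inE => /andP[/(subsetP (PN w)) yN exy]; rewrite inE yN.
- move=> X hX hA; apply: crit => // i ik; apply: subset_trans (hX i ik) _.
  by apply/subsetP => x /UY.
- move=> v.
  have hN : D <= 4 * #|N (ap v)| by have := aY v (ltn_ord v); rewrite inE => /andP[].
  (* Each of the fewer than [k ^ B] other apexes removes at most [2 * D * k ^ s / k ^ u], in total
     at most [2 * D / k ^ 3], which is small against [D / 4] since [k >= 4]. *)
  pose Bd := \bigcup_(w | w != v) (N (ap v) :&: N (ap w) :|: [set x in N (ap v) | D < #|[set z in N (ap w) | e x z]| * k ^ s]).
  have cB : #|Bd| * k ^ 3 <= 2 * D.
    rewrite -(leq_pmul2r (kx (B + s))) -mulnA -expnD.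
    have -> : 3 + (B + s) = u by rewrite addnC.
    apply: leq_trans (leq_mul (card_bigcup _ _) (leqnn _)) _; rewrite big_distrl /=.
    apply: (@leq_trans (k ^ B * (2 * D * k ^ s))); last by rewrite expnD mulnCA.
    apply: leq_trans (@leq_sum_const _ _ _ (2 * D * k ^ s) _) _; last first.
      by rewrite leq_mul2r; apply/orP; right; apply: leq_trans (max_card _) _; rewrite card_ord.
    move=> w wv; have vw : v != w by rewrite eq_sym.
    have [_ _ h3 h4] := apg v w vw.
    apply: leq_trans (leq_mul (leq_card_setU _ _) (leqnn _)) _.
    rewrite mulnDl mul2n -addnn mulnDl leq_add //.
      by apply: leq_trans h3 _; rewrite leq_pmulr.
    rewrite -(leq_pmul2r D0).
    apply: (@leq_trans (edge_count (N (ap v)) (N (ap w)) * k ^ s * k ^ u)).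
      by rewrite mulnAC leq_mul2r markov orbT.
    by rewrite mulnAC [X in _ <= X]mulnAC leq_mul2r h4 ?orbT.
  have cP : #|N (ap v)| <= #|P v| + #|Bd|.
    rewrite -(cardsID Bd (N (ap v))) addnC leq_add //; last by rewrite subset_leq_card ?subsetIr.
    apply: subset_leq_card; apply/subsetP => x /setDP[xN xB]; rewrite inE xN andbT.
    apply: contra xB => /bigcupP[w wv hw]; apply/bigcupP; exists w => //.
    by move: hw; rewrite in_setU => /orP[h|h]; rewrite in_setU; apply/orP; [left; rewrite in_setI xN|right].
  move: cB; rewrite !expnS muln1 => cB.
  have : 16 * (4 * #|Bd|) <= 2 * D.
    apply: leq_trans cB; rewrite mulnA mulnC leq_mul2l; apply/orP; right.
    by apply: (@leq_trans (4 * (4 * 4))) => //; rewrite !leq_mul.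
  have h64 : 64 <= k * (k * k) by apply: (@leq_trans (4 * (4 * 4))) => //; rewrite !leq_mul.
  move=> hB; apply: (@leq_trans (#|P v| * 64)); last by rewrite leq_mul2l h64 orbT.
  move: #|_| #|P v| #|Bd| hN cP hB => n1 n2 n3; clear; lia.
- move=> v w t tP; case: (eqVneq v w) => [->|vw]; first by have := subsetP (PN w) _ tP; rewrite inE => /andP[].
  have [h _] := Pno w v t vw tP; apply/negbTE; apply: contra h => h.
  by rewrite inE (PY _ _ tP).
Qed.
End Teeth.

(** The order of choice matters: [M], then [R] from [M] for [choose_hubs], then [G] from [R] for
    [sparse_chain]; then the exponents of the [G] rounds, [B], [z], [s] and [c]; finally the lower
    bound on [k], a sum dominating every fixed factor that has to be absorbed. None of these depends
    on the graph. *)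
Lemma teeth_model (V E : finType) (e1 e2 : E -> V) : (forall i, e1 i != e2 i) ->
  exists B s c K0, [/\ 0 < B, s <= c & forall (T L : finType) (e : rel T) (P : L -> {set T}) (D k : nat) (ap : L -> T),
    K0 <= k -> teeth e P D k s c -> #|L| = k ^ B -> (forall v, D <= #|P v| * k ^ 3) ->
    (forall u v, ~~ e (ap u) (ap v)) -> (forall u v t, t \in P v -> e (ap u) t = (u == v)) ->
    sub2_model e1 e2 e].
Proof.
move=> e12.
pose M := (#|V| + #|E|).+1; pose R := (#|V| * (M.+1 * #|E|)).+1.
pose G := (#|V| * (#|V| * 2 ^ R).+1).+1; pose a := G * R; pose n := M * 2 ^ a; pose r := #|E|.
pose Y := proc_pre r R n G.
pose B := proc_Lam r R n G + gc_lab r Y.+1 + gc_lab R Y + 3.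
pose z := gc_out R Y + B.+1.
exists B, (3 * z), (3 * z + (gc_exp R Y R + 2) + (gc_exp r Y.+1 r + 2)),
  (2 * (1 + a + a + a * a) + 2 * 2 ^ a + 2 * (R * M * (1 + a + a + a * a) + R + R * a) +
   2 * 2 ^ (R * M * a) + #|V| * #|E|.+1 + 2 * n).
split.
- by rewrite /B addn_gt0 orbT.
- by rewrite -addnA leq_addr.
move=> T L e P D k ap hk tP cL PL h1 h2.
have k_6 : 2 * n <= k by apply: leq_trans hk; apply: leq_addl.
have k_5 : #|V| * #|E|.+1 <= k.
  by apply: leq_trans hk; apply: leq_trans (leq_addr _ _); apply: leq_addl.
have k_4 : 2 * 2 ^ (R * M * a) <= k.
  by apply: leq_trans hk; do 2 apply: leq_trans (leq_addr _ _); apply: leq_addl.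
have k_3 : 2 * (R * M * (1 + a + a + a * a) + R + R * a) <= k.
  by apply: leq_trans hk; do 3 apply: leq_trans (leq_addr _ _); apply: leq_addl.
have k_2 : 2 * 2 ^ a <= k.
  by apply: leq_trans hk; do 4 apply: leq_trans (leq_addr _ _); apply: leq_addl.
have k_1 : 2 * (1 + a + a + a * a) <= k.
  by apply: leq_trans hk; do 4 apply: leq_trans (leq_addr _ _); apply: leq_addr.
have c1 : gc_exp R Y R + 2 <= 3 * z + (gc_exp R Y R + 2) + (gc_exp r Y.+1 r + 2).
  by apply: leq_trans (leq_addr _ _); apply: leq_addl.
have c2 : gc_exp r Y.+1 r + 2 <= 3 * z + (gc_exp R Y R + 2) + (gc_exp r Y.+1 r + 2) by apply: leq_addl.
have [//|[ap' [b [f [p [beta hs]]]]]] :=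
  process tP e12 (ltn0Sn _ : 0 < M) cL PL c1 c2 (leqnn B) (leqnn _) k_1 k_2 k_3 k_4 k_5 k_6 h1 h2.
apply: (selection hs (teeth_sym tP) (teeth_irr tP) e12) => //.
- by rewrite /M leqW // leq_addr.
- by rewrite /M leqW // leq_addl.
Qed.

(* Passing to the vertices of degree below D/4 preserves both t D <= |Y| and D m t <= |Y|^2; the descent
   stops either because most degrees are at least D/4 or because the new D is 0. *)
Lemma almost_regular (T : finType) (e : rel T) (Y : {set T}) D m t : 0 < t ->
  (forall y, y \in Y -> #|[set z in Y | e y z]| <= D) -> t * D <= #|Y| -> (0 < D) -> D * m * t <= #|Y| * #|Y| ->
  exists2 Y' : {set T}, Y' \subset Y &
  (exists D', [/\ 0 < D', forall y, y \in Y' -> #|[set z in Y' | e y z]| <= D', t * D' <= #|Y'|,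
    D' * m * t <= #|Y'| * #|Y'| & #|Y'| < 2 * #|[set y in Y' | D' <= 4 * #|[set z in Y' | e y z]|]|]) \/
  ((forall x y, x \in Y' -> y \in Y' -> ~~ e x y) /\ m <= 4 * (#|Y'| * #|Y'|)).
Proof.
move=> t0; elim/ltn_ind: D Y => D IH Y deg tD D0 mD.
case: (ltnP #|Y| (2 * #|[set y in Y | D <= 4 * #|[set z in Y | e y z]|]|)) => [h|h].
  by exists Y => //; left; exists D.
set H := [set y in Y | _] in h.
pose Y1 := Y :\: H.
have Y1Y : Y1 \subset Y by apply: subsetDl.
have cY1 : #|Y| <= 2 * #|Y1|.
  have := cardsID H Y; have : #|Y :&: H| <= #|H| by rewrite subset_leq_card ?subsetIr.
  by rewrite -/Y1; move: h; clear; lia.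
have deg1 y : y \in Y1 -> #|[set z in Y1 | e y z]| <= D %/ 4.
  move=> /setDP[yY]; rewrite inE yY /= -ltnNge => lt.
  have : #|[set z in Y1 | e y z]| <= #|[set z in Y | e y z]|.
    by apply: subset_leq_card; apply/subsetP => z; rewrite !inE -!andbA => /and3P[_ -> ->].
  by move=> le; rewrite leq_divRL // mulnC; apply: leq_trans (ltnW lt); rewrite leq_mul2l le.
have D4 : D %/ 4 * 4 <= D by apply: leq_divM.
have sq : #|Y| * #|Y| <= 4 * (#|Y1| * #|Y1|).
  apply: leq_trans (leq_mul cY1 cY1) _; by rewrite mulnACA.
case: (posnP (D %/ 4)) => [D40|D40].
  exists Y1 => //; right; split.
    move=> x y xY yY; apply/negP => exy; have := deg1 x xY; rewrite D40 leqn0 cards_eq0.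
    by move=> /eqP/setP/(_ y); rewrite in_set0 in_set yY exy.
  apply: leq_trans sq; apply: leq_trans mD.
  by rewrite mulnAC leq_pmull // muln_gt0 D0.
have [|||Y' Y'Y hY'] := IH (D %/ 4) _ Y1 deg1 _ D40.
- by rewrite ltn_Pdiv.
- rewrite -(@leq_pmul2l 2) //; apply: leq_trans cY1; apply: leq_trans tD.
  by rewrite mulnCA leq_mul2l; apply/orP; right; move: D4; clear; lia.
- rewrite -(@leq_pmul2l 4) //; apply: leq_trans sq; apply: leq_trans mD.
  by rewrite !mulnA leq_mul2r; apply/orP; right; rewrite leq_mul2r mulnC D4 orbT.
- by exists Y' => //; apply: subset_trans Y'Y Y1Y.
Qed.

Definition critical (T : finType) (e : rel T) (C : nat) (S : {set T}) : Prop :=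
  forall K (X : nat -> {set T}), 2 <= K -> (forall i, i < K -> X i \subset S) ->
   (forall i j, i < j -> j < K -> apart e (X i) (X j)) -> exists2 i, i < K & #|X i| * K ^ C < #|S|.

(** The singletons of [Z] are [#|Z|] pairwise apart sets. *)
Lemma critical_stable (T : finType) (e : rel T) C (S Z : {set T}) : critical e C S -> Z \subset S -> 2 <= #|Z| ->
  (forall x y, x \in Z -> y \in Z -> ~~ e x y) -> #|Z| ^ C < #|S|.
Proof.
move=> cr ZS Z2 st; case/card_gt0P: (ltnW Z2) => x0 _.
have zZ i : i < #|Z| -> nth x0 (enum Z) i \in Z by move=> iZ; rewrite -mem_enum mem_nth // -cardE.
have [||i iK] := cr #|Z| (fun i => [set nth x0 (enum Z) i]) Z2.
- by move=> i iZ; rewrite sub1set; apply: subsetP ZS _ (zZ i iZ).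
- move=> i j ij jZ; have iZ := ltn_trans ij jZ; split.
    by move=> x y /set1P-> /set1P->; apply: st; apply: zZ.
  by rewrite disjoints1 inE nth_uniq ?enum_uniq -?cardE // (ltn_eqF ij).
- by rewrite cards1 mul1n.
Qed.

(** The quantifiers follow the later use: Rödl's theorem turns the sparsity [t] into a proportion
    [q], so [t] must be independent of [q], while [C0] may depend on it. *)
Lemma sparse_model (V E : finType) (e1 e2 : E -> V) : (forall i, e1 i != e2 i) ->
  exists2 t, 0 < t & forall q, exists C0, forall C (T : finType) (e : rel T) (S Y : {set T}),
    symmetric e -> irreflexive e -> C0 <= C -> critical e C S -> Y \subset S -> #|S| <= q * #|Y| ->
    (forall y, y \in Y -> #|[set z in Y | e y z]| * t <= #|Y|) -> 4 * q < #|S| -> sub2_model e1 e2 e.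
Proof.
move=> e12; have [B [s [c [K0 [B0 sc hm]]]]] := teeth_model e12.
pose Q := B + (B + s + 3) + 2; pose k1 := K0 + 4.
have k10 : 0 < k1 by rewrite addn_gt0 orbT.
exists (k1 ^ Q); first by rewrite expn_gt0 k10.
move=> q; exists (c + 2 * Q + (q + 2 * Q) + (4 * q + 2)) => C T e S Y sy irr hC cr YS hq deg qS.
(* A stable set of size about the square root of [#|Y|] contradicts criticality, which settles the
   cases where the degree bound becomes 0. The factor [4 * q] is absorbed by [#|Z| ^ (4 * q)]. *)
have stab (Z : {set T}) : Z \subset Y -> (forall x y, x \in Z -> y \in Z -> ~~ e x y) -> #|Y| <= 4 * (#|Z| * #|Z|) -> False.
  move=> ZY st hZ.
  have Z2 : 2 <= #|Z|.
    rewrite leqNgt; apply/negP => Z1.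
    have : #|Y| <= 4 by apply: leq_trans hZ _; move: Z1; rewrite ltnS; case: #|Z| => // -[].
    move=> Y4; move: qS; rewrite ltnNge => /negP; apply; apply: leq_trans hq _.
    by rewrite mulnC leq_mul2r Y4 orbT.
  have := critical_stable cr (subset_trans ZY YS) Z2 st; apply/negP; rewrite -leqNgt.
  apply: leq_trans hq _; apply: leq_trans (leq_mul (leqnn q) hZ) _.
  have h1 : #|Z| ^ (4 * q + 2) <= #|Z| ^ C.
    by rewrite leq_pexp2l ?(ltnW Z2) //; apply: leq_trans hC; apply: leq_addl.
  apply: leq_trans h1; rewrite expnD mulnA -mulnn leq_mul2r mulnC; apply/orP; right.
  by apply: ltnW; apply: ltn_expl.
have [D0|D0] := posnP (#|Y| %/ k1 ^ Q).
  exfalso; apply: (stab Y) => //; last first.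
    case: (posnP #|Y|) => [->//|Y0]; by rewrite mulnA leq_pmull // muln_gt0.
  move=> x y xY yY; apply/negP => exy; have := deg x xY; apply/negP; rewrite -ltnNge.
  have : 0 < #|[set z in Y | e x z]| by apply/card_gt0P; exists y; rewrite inE yY.
  move=> h; apply: (@leq_trans (k1 ^ Q)); last by rewrite leq_pmull.
  by rewrite ltnNge -divn_gt0 ?expn_gt0 ?k10 // D0.
have t0 : 0 < k1 ^ Q by rewrite expn_gt0 k10.
have deg' y : y \in Y -> #|[set z in Y | e y z]| <= #|Y| %/ k1 ^ Q by move=> yY; rewrite leq_divRL // deg.
have tD : k1 ^ Q * (#|Y| %/ k1 ^ Q) <= #|Y| by rewrite mulnC leq_divM.
have mD : #|Y| %/ k1 ^ Q * #|Y| * k1 ^ Q <= #|Y| * #|Y|.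
  by rewrite mulnAC leq_mul2r leq_divM orbT.
have [Y' Y'Y [[D [Dp degD tD' mD' half]]|[st hst]]] := almost_regular t0 deg' tD D0 mD; last by case: (stab Y').
have ub k : k ^ Q * D <= #|Y'| -> k <= #|Y'|.
  apply: leq_trans; apply: leq_trans (leq_pmulr _ Dp); case: k => // k.
  by rewrite -{1}[k.+1]expn1 leq_pexp2l // /Q addn2.
have ex : exists k, k ^ Q * D <= #|Y'| by exists k1.
(* By maximality of [k], [#|Y'| < (2 * k) ^ Q * D]. The quadratic bound of [almost_regular], used
   with [m = #|Y|], then bounds the original [Y], and with it [S], by a fixed power of [k] times
   [D]. *)
case: (ex_maxnP ex ub) => k kQ kmax.
have k1k : k1 <= k by apply: kmax.
have k4 : 4 <= k by apply: leq_trans k1k; rewrite /k1 leq_addl.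
have Kk : K0 <= k by apply: leq_trans k1k; rewrite /k1 leq_addr.
have kp : 0 < k by apply: leq_trans k4.
have hY : #|Y| <= (2 * k) ^ (2 * Q) * D.
  have lt : #|Y'| < (2 * k) ^ Q * D.
    have : #|Y'| < k.+1 ^ Q * D by rewrite ltnNge; apply/negP => /kmax; rewrite ltnn.
    move/leq_trans; apply; rewrite leq_mul2r; apply/orP; right; rewrite leq_exp2r; last by rewrite /Q addn2.
    by rewrite mul2n -addnn -addn1 leq_add2l.
  rewrite -(leq_pmul2r Dp) mulnC; apply: leq_trans (leq_pmulr _ t0) _; apply: leq_trans mD' _.
  apply: leq_trans (leq_mul (ltnW lt) (ltnW lt)) _.
  by rewrite mulnACA -expnD addnn -mul2n mulnA.
(* This is criticality of [S] for [K = k]: the excess of [C] over [c] bridges the factor between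
   [#|S|] and [D], including the constants [q] and [2 ^ (2 * Q)], which are at most powers of
   [k]. *)
have crit (X : nat -> {set T}) : (forall i, i < k -> X i \subset Y') -> (forall i j, i < j -> j < k -> apart e (X i) (X j)) ->
    exists2 i, i < k & #|X i| * k ^ c < D.
  move=> hX hA; have [|||i ik hi] := cr k X.
  - by apply: leq_trans k4.
  - by move=> i ik; apply: subset_trans (hX i ik) (subset_trans Y'Y YS).
  - exact: hA.
  exists i => //.
  have h1 : k ^ c * (k ^ (2 * Q) * (2 ^ (2 * Q) * q)) <= k ^ C.
    apply: (@leq_trans (k ^ (c + 2 * Q + (q + 2 * Q)))).
      rewrite (expnD k (c + 2 * Q)) (expnD k c) (expnD k q) -mulnA; do 2 (apply: leq_mul => //).
      rewrite mulnC; apply: leq_mul; last by rewrite leq_exp2r ?(leq_trans _ k4) // /Q addn2.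
      by apply: ltnW; apply: ltn_expl; apply: leq_trans k4.
    by rewrite leq_pexp2l //; apply: leq_trans hC; apply: leq_addr.
  have h2 := leq_ltn_trans (leq_mul (leqnn #|X i|) h1) hi.
  have h3 : #|S| <= D * (k ^ (2 * Q) * (2 ^ (2 * Q) * q)).
    apply: leq_trans hq _; apply: leq_trans (leq_mul (leqnn q) hY) _.
    by rewrite expnMn; apply/eq_leq; move: (k ^ _) (2 ^ _) => p1 p2; clear; lia.
  have := leq_trans h2 h3; rewrite mulnA ltn_mul2r => /andP[_].
  by [].
have [ap [P [tP PL h1 h2]]] := exists_teeth sy irr degD half Dp k4 B0 kQ sc crit.
by apply: (hm T 'I_(k ^ B) e P D k ap Kk tP _ PL h1 h2); rewrite card_ord.
Qed.

(** * Rödl's theorem *)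

Definition signed_adj (T : finType) (e : rel T) (sg : bool) : rel T :=
  fun x z => if sg then e x z else (x != z) && ~~ e x z.

Section Rodl.
Variables (U : finType) (h : rel U).
Hypothesis hsy : symmetric h.

Section Graph.
Variables (T : finType) (e : rel T).
Hypothesis sy : symmetric e.
Local Notation adj := (signed_adj e).

Lemma adj_sym sg : symmetric (adj sg).
Proof. by move=> x y; rewrite /signed_adj sy eq_sym. Qed.

(** For irreflexive [e] both signed adjacencies are irreflexive, so the condition on distinct [x],
    [y] already forces [phi] to be injective. *)
Definition induced_copy (S : {set T}) : Prop := exists phi : U -> T,
  (forall x, phi x \in S) /\ forall x y, x != y -> adj (h x y) (phi x) (phi y).

Definition sparse_pair (d : nat) (sg : bool) (A B : {set T}) : Prop :=
  forall a, a \in A -> d * #|[set z in B | adj sg a z]| <= #|B|.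

(* Greedy embedding: each vertex of the pattern in turn is mapped to a vertex leaving a proportion [1/d] of every
   remaining candidate set; if this is impossible, some candidate set is sparse on a positive proportion. *)
Lemma copy_or_sparse_pair (t0 : T) d (us : seq U) (V : U -> {set T}) : 0 < d -> uniq us ->
  (forall x, x \in us -> 0 < #|V x|) ->
  (exists phi : U -> T, (forall x, x \in us -> phi x \in V x) /\
     forall x y, x \in us -> y \in us -> x != y -> adj (h x y) (phi x) (phi y)) \/
  (exists x y sg (A B : {set T}), [/\ x \in us, y \in us, A \subset V x /\ B \subset V y,
     #|V x| <= #|U| * d ^ size us * #|A| /\ #|V y| <= #|U| * d ^ size us * #|B| & sparse_pair d sg A B]).
Proof.
move=> d0; elim: us V => [|x us IH] V; first by left; exists (fun=> t0).
move=> /andP[xus uus] V0.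
pose nbh v y := [set z in V y | adj (h x y) v z].
have U0 : 0 < #|U| by apply/card_gt0P; exists x.
case: (boolP [exists v in V x, [forall y, (y \in us) ==> (#|V y| <= d * #|nbh v y|)]]) => [/exists_inP[v vV /forallP good]|].
  have gd y : y \in us -> #|V y| <= d * #|nbh v y| by move=> yus; apply: (implyP (good y)).
  have [|[phi [p1 p2]]|[x' [y' [sg [A [B [h1 h2 [h3 h3'] [h4 h5] h6]]]]]]] := IH (nbh v) uus.
  - move=> y yus; have := leq_trans (V0 y _) (gd y yus); rewrite inE yus orbT => /(_ isT).
    by rewrite muln_gt0 => /andP[].
  - left; exists (fun y => if y == x then v else phi y); split.
      move=> y; rewrite inE; case: eqP => [->//|_ /= yus].
      by have := p1 y yus; rewrite inE => /andP[].
    move=> y z; rewrite !inE; case: (eqVneq y x) => [->|yx] /=; case: (eqVneq z x) => [->|zx] //=.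
    + by move=> _ zus _; have := p1 z zus; rewrite inE => /andP[].
    + move=> yus _ _; have := p1 y yus; rewrite inE => /andP[_].
      by rewrite hsy adj_sym.
    + exact: p2.
  - right; exists x', y', sg, A, B.
    have nV w : nbh v w \subset V w by apply/subsetP => z; rewrite inE => /andP[].
    rewrite !inE h1 h2 !orbT /= expnS; split=> //; first by split; apply: subset_trans (nV _).
    have big w (E : {set T}) : w \in us -> #|nbh v w| <= #|U| * d ^ size us * #|E| -> #|V w| <= #|U| * (d * d ^ size us) * #|E|.
      move=> wus le; apply: leq_trans (gd w wus) _; rewrite mulnCA -mulnA leq_mul2l le orbT //.
    by split; apply: big.
rewrite negb_exists => /forallP nogood.
pose vec v := odflt x [pick y in us | d * #|nbh v y| < #|V y|].
have vecP v : v \in V x -> vec v \in us /\ d * #|nbh v (vec v)| < #|V (vec v)|.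
  move=> vV; rewrite /vec; case: pickP => [y /andP[]//|none].
  have := nogood v; rewrite vV /= => /negP[]; apply/forallP => y; apply/implyP => yus.
  by have := none y; rewrite yus /= ltnNge => /negbFE.
have Vx0 : 0 < #|V x| by apply: V0; rewrite inE eqxx.
have [y hy] := majority vec Vx0.
set A := [set v in _ | _] in hy.
have [v0 v0A] : exists v, v \in A.
  by apply/card_gt0P; move: hy; case: (#|A|) => //; rewrite muln0 leqNgt Vx0.
have AP v : v \in A -> y \in us /\ d * #|nbh v y| < #|V y|.
  by rewrite inE => /andP[/vecP + /eqP e']; rewrite e'.
have [yus _] := AP v0 v0A.
right; exists x, y, (h x y), A, (V y); split.
- by rewrite inE eqxx.
- by rewrite inE yus orbT.
- by split=> //; apply/subsetP => v; rewrite inE => /andP[].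
- have dp : 0 < d ^ size (x :: us) by rewrite expn_gt0 d0.
  split; first by apply: leq_trans hy _; rewrite leq_mul2r leq_pmulr ?orbT.
  by rewrite leq_pmull // muln_gt0 U0.
- by move=> v /AP[_ /ltnW].
Qed.

(** Sparsity is asked only from later blocks towards earlier ones, so that appending a block puts no
    condition on the vertices already chosen. *)
Definition blocks (n w d : nat) (sg : bool) (S : {set T}) (Bk : nat -> {set T}) : Prop :=
  [/\ forall i, i < n -> Bk i \subset S /\ #|Bk i| = w,
      forall i j v, i < j -> j < n -> v \in Bk i -> v \notin Bk j &
      forall i j v, i < j -> j < n -> v \in Bk j -> d * #|[set z in Bk i | adj sg v z]| <= w].

Lemma blocks0 w d sg S Bk : blocks 0 w d sg S Bk.
Proof. by split=> // i j v _; rewrite ltn0. Qed.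
End Graph.

(* Ramsey-style double induction on the numbers of blocks for the two signs. *)
Lemma exists_blocks d n : 0 < d -> forall a b, a + b <= n -> exists2 q, 0 < q &
  forall (T : finType) (e : rel T) (S : {set T}), symmetric e -> ~ induced_copy e S -> q <= #|S| ->
  exists w (sg : bool) Bk, [/\ 0 < w, w <= #|S|, #|S| <= q * w & blocks e (if sg then a else b) w d sg S Bk].
Proof.
move=> d0; elim: n => [|n IH] a b.
  rewrite leqn0 addn_eq0 => /andP[/eqP-> /eqP->]; exists 1 => // T e S sy _ S0.
  exists #|S|, true, (fun=> set0); by split; rewrite ?mul1n //; apply: blocks0.
case: a => [|a] hab.
  exists 1 => // T e S sy _ S0.
  exists #|S|, true, (fun=> set0); by split; rewrite ?mul1n //; apply: blocks0.
case: b hab => [|b] hab.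
  exists 1 => // T e S sy _ S0.
  exists #|S|, false, (fun=> set0); by split; rewrite ?mul1n //; apply: blocks0.
have [q1 q10 h1] := IH a b.+1 ltac:(move: hab; clear; lia).
have [q2 q20 h2] := IH a.+1 b ltac:(move: hab; clear; lia).
(* Through the factor [2 * N] in [D], the vertices of [B] that are bad for one of the at most [N]
   blocks make up at most half of [B]. The 4 in [4 * c0] leaves room to remove [A0] as well and
   still find a block in the rest. *)
pose N := a.+1 + b.+1; pose D := 2 * N * d; pose c0 := (#|U| * D ^ #|U|).+1.
exists (8 * c0 * (q1 + q2)); first by rewrite !muln_gt0 addn_gt0 q10.
move=> T e S sy nocopy hS.
have S0 : 0 < #|S| by apply: leq_trans hS; rewrite !muln_gt0 addn_gt0 q10.
have D0 : 0 < D by rewrite !muln_gt0 d0.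
case/card_gt0P: (S0) => t0 t0S.
have [|[phi [p1 p2]]|] := @copy_or_sparse_pair T e sy t0 D (enum U) (fun=> S) D0 (enum_uniq U).
- by move=> _ _.
- case: nocopy; exists phi; split=> [x|x y]; first by apply: p1; rewrite mem_enum.
  by apply: p2; rewrite mem_enum.
move=> [x [y [sg [A [B [_ _ [AS BS] [cA cB] spAB]]]]]].
rewrite -cardE in cA cB.
have cA' : #|S| <= c0 * #|A| by apply: leq_trans cA _; rewrite leq_mul2r leqnSn orbT.
have cB' : #|S| <= c0 * #|B| by apply: leq_trans cB _; rewrite leq_mul2r leqnSn orbT.
pose m0 := #|S| %/ (4 * c0).
have m0S : m0 * (4 * c0) <= #|S| by apply: leq_divM.
have m0A : m0 <= #|A|.
  rewrite -(@leq_pmul2l c0) //; apply: leq_trans cA'; apply: leq_trans m0S.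
  by rewrite mulnC leq_mul2l leq_pmull ?orbT.
have m0B : 4 * m0 <= #|B|.
  rewrite -(@leq_pmul2l c0) //; apply: leq_trans cB'; apply: leq_trans m0S.
  by rewrite mulnA mulnC [4 * c0]mulnC.
have m0q : q1 + q2 <= m0.
  rewrite leq_divRL //; apply: leq_trans hS; rewrite mulnC leq_mul2r leq_mul2r //=.
  by rewrite orbT.
have m00 : 0 < m0 by apply: leq_trans m0q; rewrite addn_gt0 q10.
have Sm0 : #|S| <= 8 * c0 * m0.
  have := ltn_ceil #|S| (_ : 0 < 4 * c0); rewrite -/m0 => /(_ isT)/ltnW/leq_trans; apply.
  apply: (@leq_trans (2 * m0 * (4 * c0))); last by rewrite mulnACA [m0 * c0]mulnC mulnA.
  by rewrite leq_mul2r; apply/orP; right; move: (m0) m00 => m1; clear; lia.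
have [A0 [A0A cA0]] := subset_of_card m0A.
have nocopy0 : ~ induced_copy e A0.
  move=> [phi [p1 p2]]; apply: nocopy; exists phi; split=> // z.
  exact: subsetP AS _ (subsetP A0A _ (p1 z)).
have [w [sg' [Bk [w0 wA hw hBk]]]] : exists w (sg' : bool) Bk, [/\ 0 < w, w <= #|A0|, #|A0| <= (q1 + q2) * w &
    blocks e (if sg' then (if sg then a else a.+1) else (if sg then b.+1 else b)) w d sg' A0 Bk].
  case: (sg); last first.
    have [|w [sg' [Bk [w0 wA hw hBk]]]] := h2 T e A0 sy nocopy0; first by rewrite cA0; apply: leq_trans m0q; apply: leq_addl.
    exists w, sg', Bk; split=> //; apply: leq_trans hw _; by rewrite leq_mul2r leq_addl orbT.
  have [|w [sg' [Bk [w0 wA hw hBk]]]] := h1 T e A0 sy nocopy0; first by rewrite cA0; apply: leq_trans m0q; apply: leq_addr.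
  exists w, sg', Bk; split=> //; apply: leq_trans hw _; by rewrite leq_mul2r leq_addr orbT.
have Sw : #|S| <= 8 * c0 * (q1 + q2) * w.
  by apply: leq_trans Sm0 _; rewrite -(mulnA (8 * c0)) leq_mul2l -cA0 hw orbT.
have A0S : A0 \subset S by apply: subset_trans A0A AS.
have wS : w <= #|S| by apply: leq_trans wA _; apply: subset_leq_card.
have [k1 k2 k3] := hBk.
(* If the blocks found inside [A0] have the other sign, their number already suffices; if they have
   the sign [sg], one more block is cut out of [B]. *)
have [ss|ss] := eqVneq sg' sg; last first.
  exists w, sg', Bk; split=> //.
  have -> : (if sg' then a.+1 else b.+1) = (if sg' then (if sg then a else a.+1) else (if sg then b.+1 else b)).
    by move: ss; case: (sg'); case: (sg).
  by split=> // i hi; have [s1 s2] := k1 i hi; split=> //; apply: subset_trans A0S.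
subst sg'.
pose nn := if sg then a else b.
have nnN : nn <= N by rewrite /nn /N; case: (sg); clear; lia.
have hBk' : blocks e nn w d sg A0 Bk by move: hBk; rewrite /nn; case: (sg).
have {k1 k2 k3 hBk} [k1 k2 k3] := hBk'.
pose bad (i : 'I_nn) := [set v in B | w < d * #|[set z in Bk i | signed_adj e sg v z]|].
have cbad i : #|bad i| * (2 * N) <= #|B|.
  have [_ cBk] := k1 i (ltn_ord i).
  have e1 : #|bad i| * w <= (\sum_(v in B) #|[set z in Bk i | signed_adj e sg v z]|) * d.
    have := markov B (fun v => #|[set z in Bk i | signed_adj e sg v z]|) d w.
    by rewrite (_ : [set y in B | _] = bad i) //; apply/setP => v; rewrite !inE mulnC.
  have e2 : \sum_(v in B) #|[set z in Bk i | signed_adj e sg v z]| = \sum_(z in Bk i) #|[set v in B | signed_adj e sg z v]|.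
    exact: edge_countC (adj_sym sy sg) _ _.
  have e3 : (\sum_(z in Bk i) #|[set v in B | signed_adj e sg z v]|) * D <= w * #|B|.
    rewrite big_distrl /= -cBk; apply: leq_sum_const => z zB; rewrite mulnC.
    by apply: spAB; have [sB _] := k1 i (ltn_ord i); apply: subsetP A0A _ (subsetP sB _ zB).
  rewrite -(leq_pmul2r w0) -(leq_pmul2r d0) [#|B| * w]mulnC.
  apply: leq_trans (leq_mul e3 (leqnn d)); rewrite -e2 /D.
  by rewrite -!mulnA [X in _ <= X]mulnCA; move: e1; move: (\sum_(v in B) _) #|bad i| => n1 n2 e1; have := leq_mul e1 (leqnn (2 * N * d)); congr (_ <= _); clear; lia.
have N0 : 0 < N by [].
pose B' := B :\: (A0 :|: \bigcup_i bad i).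
have cB'' : w <= #|B'|.
  apply: leq_trans wA _; rewrite cA0.
  have g1 : #|\bigcup_i bad i| * 2 <= #|B|.
    rewrite -(leq_pmul2r N0) -mulnA; apply: leq_trans (leq_mul (card_bigcup _ _) (leqnn _)) _.
    rewrite big_distrl /=; apply: leq_trans (leq_sum_ord cbad) _.
    by rewrite mulnC leq_mul2l nnN orbT.
  have g2 : #|A0 :|: \bigcup_i bad i| <= #|A0| + #|\bigcup_i bad i| by rewrite leq_card_setU.
  have g3 := cardsID (A0 :|: \bigcup_i bad i) B.
  have g4 : #|B :&: (A0 :|: \bigcup_i bad i)| <= #|A0 :|: \bigcup_i bad i| by rewrite subset_leq_card ?subsetIr.
  rewrite -/B' in g3; rewrite cA0 in g2; move: (m0) #|B'| m0B g1 g2 g3 g4 => m1 n1.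
  move: #|\bigcup_i bad i| #|A0 :|: _| #|B :&: _| #|B| => n2 n3 n4 n5; clear; lia.
have [Bn [BnB cBn]] := subset_of_card cB''.
exists w, sg, (fun i => if i == nn then Bn else Bk i); split=> //.
have -> : (if sg then a.+1 else b.+1) = nn.+1 by rewrite /nn; case: (sg).
split.
- move=> i; rewrite ltnS leq_eqVlt; case: eqP => [_ _|_ /= hi].
    by split=> //; apply: subset_trans BnB (subset_trans (subsetDl _ _) BS).
  by have [s1 s2] := k1 i hi; split=> //; apply: subset_trans A0S.
- move=> i j v ij; rewrite ltnS leq_eqVlt => /orP[/eqP jn|jn].
    subst j; rewrite eqxx (ltn_eqF ij) => vi; apply/negP => /(subsetP BnB)/setDP[_].
    by rewrite inE (subsetP (k1 i ij).1 _ vi).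
  by rewrite (ltn_eqF jn) (ltn_eqF (ltn_trans ij jn)); apply: k2.
- move=> i j v ij; rewrite ltnS leq_eqVlt => /orP[/eqP jn|jn].
    subst j; rewrite eqxx (ltn_eqF ij) => /(subsetP BnB)/setDP[vB]; rewrite inE negb_or => /andP[_ vb].
    rewrite leqNgt; apply: contra vb => hv; apply/bigcupP; exists (Ordinal ij) => //.
    by rewrite inE vB.
  by rewrite (ltn_eqF jn) (ltn_eqF (ltn_trans ij jn)); apply: k3.
Qed.
End Rodl.

Lemma sum_bigcup (I T : finType) (B : I -> {set T}) (F : T -> nat) :
  \sum_(v in \bigcup_i B i) F v <= \sum_i \sum_(v in B i) F v.
Proof.
rewrite [X in _ <= X](exchange_big_dep (mem (\bigcup_i B i))) /=; last first.
  by move=> i v _ vB; apply/bigcupP; exists i.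
by apply: leq_sum => v /bigcupP[i _ vi]; rewrite (bigD1 i) //= leq_addr.
Qed.

(** With [n = 8 * t] blocks, pairs inside blocks and pairs across blocks each contribute at most
    [n * (w * w)] to the degree sum. Hence at most half of the vertices have degree above
    [#|Y| / (2 * t)]; without them the set is still at least half as large, which gives the
    proportion [1 / t]. *)
Lemma blocks_union (T : finType) (e : rel T) t w sg (S : {set T}) Bk : symmetric e ->
  0 < t -> 0 < w -> blocks e (8 * t) w (8 * t) sg S Bk ->
  exists2 Y : {set T}, Y \subset S & w <= #|Y| /\ forall y, y \in Y -> #|[set z in Y | signed_adj e sg y z]| * t <= #|Y|.
Proof.
move=> sy t0 w0 [k1 k2 k3]; set n := 8 * t in k1 k2 k3 *.
have n0 : 0 < n by rewrite muln_gt0.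
pose Y := \bigcup_(i < n) Bk i.
have YS : Y \subset S by apply/bigcupsP => i _; have [] := k1 i (ltn_ord i).
have BY (i : 'I_n) : Bk i \subset Y by apply: (bigcup_sup i).
have dj (i j : 'I_n) v : v \in Bk i -> v \in Bk j -> i = j.
  move=> vi vj; apply/val_inj; case: (ltngtP i j) => [lt|lt|//].
    by have := k2 i j v lt (ltn_ord j) vi; rewrite vj.
  by have := k2 j i v lt (ltn_ord i) vj; rewrite vi.
have cBk (i : 'I_n) : #|Bk i| = w by have [] := k1 i (ltn_ord i).
have cY : n * w <= #|Y|.
  have := sum_cap dj setT Y; rewrite (eq_bigr (fun=> w)); last by move=> i _; rewrite (setIidPr (BY i)).
  by rewrite sum_nat_const cardsT card_ord.
have cY' : #|Y| <= n * w.
  by apply: leq_trans (card_bigcup _ _) _; apply: leq_sum_ord => i; rewrite cBk.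
pose E (i j : nat) := edge_count (signed_adj e sg) (Bk i) (Bk j).
have sy' := adj_sym sy sg.
have E1 (i j : 'I_n) : E i j <= w * w.
  rewrite /E /edge_count -{1}(cBk i); apply: leq_sum_const => v _; rewrite -(cBk j).
  by apply: subset_leq_card; apply/subsetP => z; rewrite inE => /andP[].
have E2 (i j : 'I_n) : i != j -> E i j * n <= w * w.
  wlog lt : i j / j < i.
    move=> h ij; case: (ltngtP i j) => [lt|lt|/val_inj eq].
    - by rewrite /E edge_countC //; apply: h; rewrite // eq_sym.
    - exact: h.
    - by rewrite eq eqxx in ij.
  move=> _; rewrite /E /edge_count big_distrl /= -{1}(cBk i); apply: leq_sum_const => v vi.
  by rewrite mulnC; apply: k3 vi.
have Esum : \sum_(v in Y) #|[set z in Y | signed_adj e sg v z]| <= 2 * (n * (w * w)).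
  apply: (@leq_trans (\sum_(i < n) \sum_(j < n) E i j)).
    apply: (@leq_trans (\sum_(i < n) \sum_(v in Bk i) #|[set z in Y | signed_adj e sg v z]|)).
      exact: sum_bigcup.
    apply: leq_sum => i _; rewrite exchange_big /=; apply: leq_sum => v vi.
    apply: leq_trans (card_bigcup xpredT (fun j : 'I_n => [set z in Bk j | signed_adj e sg v z])).
    apply: subset_leq_card; apply/subsetP => z; rewrite inE => /andP[/bigcupP[j _ zj] vz].
    by apply/bigcupP; exists j => //; rewrite inE zj.
  rewrite -(leq_pmul2r n0) big_distrl /=.
  apply: (@leq_trans (n * (2 * (n * (w * w))))); last by rewrite mulnC.
  apply: leq_sum_ord => i; rewrite big_distrl /= (bigD1 i) //= mul2n -addnn leq_add //.
    by rewrite mulnC leq_mul2l E1 orbT.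
  apply: leq_trans (@leq_sum_const _ _ _ (w * w) _) _.
    by move=> j ji; rewrite E2 // eq_sym.
  by rewrite leq_mul2r; apply/orP; right; apply: leq_trans (max_card _) _; rewrite card_ord.
pose Bd := [set v in Y | #|Y| < #|[set z in Y | signed_adj e sg v z]| * (2 * t)].
have cBd : 2 * #|Bd| <= #|Y|.
  have Y0 : 0 < #|Y| by apply: leq_trans cY; rewrite muln_gt0 n0.
  rewrite -(leq_pmul2r Y0) -mulnA.
  apply: leq_trans (leq_mul (leqnn 2) (markov Y (fun v => #|[set z in Y | signed_adj e sg v z]|) (2 * t) #|Y|)) _.
  apply: leq_trans (leq_mul (leqnn 2) (leq_mul Esum (leqnn _))) _.
  apply: leq_trans (leq_mul cY cY); rewrite /n; apply/eq_leq; clear; lia.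
pose Z := Y :\: Bd.
have cZ : #|Y| <= 2 * #|Z|.
  have := cardsID Bd Y; have : #|Y :&: Bd| <= #|Bd| by rewrite subset_leq_card ?subsetIr.
  rewrite -/Z; move: #|Z| #|Y| #|Bd| #|_| cBd => n1 n2 n3 n4; clear; lia.
exists Z; first by apply: subset_trans YS; apply: subsetDl.
split.
  rewrite -(@leq_pmul2l 2) //; apply: leq_trans cZ; apply: leq_trans cY.
  by rewrite leq_mul2r /n; apply/orP; right; move: t0; clear; lia.
move=> y /setDP[yY]; rewrite inE yY /= -leqNgt => hy.
rewrite -(@leq_pmul2l 2) //; apply: leq_trans cZ; apply: leq_trans hy; rewrite mulnCA leq_mul2r.
apply/orP; right; apply: subset_leq_card; apply/subsetP => z; rewrite !inE -!andbA => /and3P[_ -> ->]; by [].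
Qed.

Lemma rodl (U : finType) (h : rel U) t : symmetric h -> 0 < t -> exists2 q, 0 < q &
  forall (T : finType) (e : rel T) (S : {set T}), symmetric e -> irreflexive e -> ~ induced_copy h e S -> 0 < #|S| ->
  exists (Y : {set T}) sg, [/\ Y \subset S, #|S| <= q * #|Y| &
    forall y, y \in Y -> #|[set z in Y | signed_adj e sg y z]| * t <= #|Y|].
Proof.
move=> hsy t0; have d0 : 0 < 8 * t by rewrite muln_gt0.
have [q q0 hq] := exists_blocks hsy d0 (leqnn (8 * t + 8 * t)).
exists q => // T e S sy irr nc S0.
have [qS|Sq] := leqP q #|S|.
  have [w [sg [Bk [w0 _ hw hBk]]]] := hq T e S sy nc qS.
  have hBk' : blocks e (8 * t) w (8 * t) sg S Bk by move: hBk; case: (sg).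
  have [Y YS [wY hY]] := blocks_union sy t0 w0 hBk'.
  by exists Y, sg; split=> //; apply: leq_trans hw _; rewrite leq_mul2l wY orbT.
(* A set with fewer than [q] vertices is served by a singleton. *)
case/card_gt0P: S0 => x xS; exists [set x], true; split.
- by rewrite sub1set.
- by rewrite cards1 muln1 ltnW.
- move=> y /set1P->; rewrite (_ : [set z in _ | _] = set0) ?cards0 //.
  by apply/setP => z; rewrite !inE; case: eqP => //= ->; rewrite /signed_adj irr.
Qed.

(** * The minimal counterexample *)

Section Alpha.
Variables (T : finType).
Implicit Types (e : rel T) (S X Z : {set T}).

Definition stableb e Z := [forall x in Z, forall y in Z, ~~ e x y].
(** For the complement relation [co e] this is the clique number. *)
Definition alpha e S := \max_(Z : {set T} | (Z \subset S) && stableb e Z) #|Z|.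
Local Notation co e := (signed_adj e false).

Lemma stablebP e Z : reflect (forall x y, x \in Z -> y \in Z -> ~~ e x y) (stableb e Z).
Proof.
apply: (iffP forall_inP) => [h x y xZ yZ|h x xZ]; first exact: forall_inP (h x xZ) y yZ.
by apply/forall_inP => y; apply: h.
Qed.

Lemma alpha_ge e S Z : Z \subset S -> stableb e Z -> #|Z| <= alpha e S.
Proof. by move=> ZS st; apply: (bigmax_sup Z) => //; rewrite ZS. Qed.

Lemma alpha_ex e S : exists2 Z : {set T}, Z \subset S & stableb e Z /\ alpha e S = #|Z|.
Proof.
have p0 : (set0 \subset S) && stableb e set0.
  by rewrite sub0set; apply/stablebP => x y; rewrite inE.
by rewrite /alpha (@bigmax_eq_arg _ set0 (fun Z : {set T} => (Z \subset S) && stableb e Z) _ p0); case: arg_maxnP => // Z /andP[ZS st] _; exists Z.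
Qed.

Lemma alpha_mono e S X : X \subset S -> alpha e X <= alpha e S.
Proof. by move=> XS; have [Z ZX [st ->]] := alpha_ex e X; apply: alpha_ge => //; apply: subset_trans XS. Qed.

Lemma alpha_gt0 e S : irreflexive e -> 0 < #|S| -> 0 < alpha e S.
Proof.
move=> irr /card_gt0P[x xS]; apply: leq_trans (_ : #|[set x]| <= _); first by rewrite cards1.
by apply: alpha_ge; [rewrite sub1set | apply/stablebP => y z /set1P-> /set1P->; rewrite irr].
Qed.

Lemma alpha_ext e e' S : e =2 e' -> alpha e S = alpha e' S.
Proof.
move=> h; apply: eq_bigl => Z; congr (_ && _).
by apply/stablebP/stablebP => st x y xZ yZ; [rewrite -h | rewrite h]; apply: st.
Qed.

Lemma alpha_sum e S K (X : nat -> {set T}) : symmetric e -> (forall i, i < K -> X i \subset S) ->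
  (forall i j, i < j -> j < K -> apart e (X i) (X j)) -> \sum_(i < K) alpha e (X i) <= alpha e S.
Proof.
move=> sy XS ap; have : forall i : 'I_K, exists Z : {set T}, [/\ Z \subset X i, stableb e Z & alpha e (X i) = #|Z|].
  by move=> i; have [Z ZX [st eZ]] := alpha_ex e (X i); exists Z.
move=> /fin_all_exists[Z hZ].
have ZX i : Z i \subset X i by have [] := hZ i.
have ap' (i j : 'I_K) : i != j -> apart e (X i) (X j).
  move=> ij; case: (ltngtP i j) => [lt|lt|/val_inj eq]; last by rewrite eq eqxx in ij.
    exact: ap lt (ltn_ord j).
  by have [a1 a2] := ap _ _ lt (ltn_ord i); split; [apply: anti_sym | rewrite disjoint_sym].
apply: (@leq_trans #|\bigcup_i Z i|).
  rewrite (eq_bigr (fun i => #|Z i|)); last by move=> i _; have [] := hZ i.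
  have dj (i j : 'I_K) v : v \in Z i -> v \in Z j -> i = j.
    move=> vi vj; apply/eqP; apply: contraT => /ap'[_ /disjointFr h].
    by have := h v (subsetP (ZX i) _ vi); rewrite (subsetP (ZX j) _ vj).
  apply: leq_trans (sum_cap dj setT _).
  rewrite [X in _ <= X](eq_bigl xpredT); last by move=> i; rewrite inE.
  by apply: leq_sum => i _; rewrite (setIidPr _) //; apply: (bigcup_sup i).
apply: alpha_ge.
  by apply/bigcupsP => i _; apply: subset_trans (ZX i) (XS _ (ltn_ord i)).
apply/stablebP => x y /bigcupP[i _ xi] /bigcupP[j _ yj]; case: (eqVneq i j) => [ij|/ap'[an _]].
  by have [_ /stablebP st _] := hZ i; apply: st; rewrite // ij.
by apply: an; [apply: subsetP xi | apply: subsetP yj].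
Qed.

Lemma co_sym e : symmetric e -> symmetric (co e).
Proof. by move=> sy; apply: adj_sym. Qed.

Lemma co_irr e : irreflexive (co e).
Proof. by move=> x; rewrite /signed_adj eqxx. Qed.

Lemma coK e : irreflexive e -> co (co e) =2 e.
Proof.
move=> irr x y; rewrite /signed_adj; case: eqVneq => [->|_] /=; first by rewrite irr.
by rewrite negbK.
Qed.

(* For pairwise anticomplete X_i, the stability numbers add up while the clique numbers are at most that of S,
   so K min mu(X_i) <= mu(S), where mu is the product of the two. *)
Lemma critical_of_minimal e C k0 S : symmetric e -> irreflexive e ->
  (forall X : {set T}, #|X| < #|S| -> #|X| <= k0 * (alpha e X * alpha (co e) X) ^ C) ->
  k0 * (alpha e S * alpha (co e) S) ^ C < #|S| -> critical e C S.
Proof.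
move=> sy irr small big K X K2 XS ap.
case: (boolP [exists i : 'I_K, #|X i| * K ^ C < #|S|]) => [/existsP[i hi]|]; first by exists i.
rewrite negb_exists => /forallP large; exfalso.
have {}large i : i < K -> #|S| <= #|X i| * K ^ C.
  by move=> iK; have := large (Ordinal iK); rewrite -leqNgt.
have S0 : 0 < #|S| by apply: leq_ltn_trans big.
have X0 i : i < K -> 0 < #|X i|.
  by move=> /large; case: #|X i| => //; rewrite mul0n leqNgt S0.
have proper i : i < K -> #|X i| < #|S|.
  move=> iK; have [j jK ji] : exists2 j, j < K & j != i.
    by case: i iK => [|i] iK; [exists 1 | exists 0; rewrite // ltnW].
  have dj : [disjoint X i & X j].
    case: (ltngtP i j) ji => // lt _; first by have [] := ap _ _ lt jK.
    by have [_] := ap _ _ lt iK; rewrite disjoint_sym.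
  apply: proper_card; rewrite properE XS //=; apply/negP => SX.
  case/card_gt0P: (X0 j jK) => x xj.
  by have := disjointFl dj xj; rewrite (subsetP SX) // (subsetP (XS j jK)).
pose mu i := alpha e (X i) * alpha (co e) (X i).
have K0 : 0 < K by apply: leq_trans K2.
have [i0 _ hi0] := @arg_minnP _ (Ordinal K0) xpredT (fun i : 'I_K => mu i) isT.
have h1 : K * mu i0 <= alpha e S * alpha (co e) S.
  apply: (@leq_trans (\sum_(i < K) mu i)).
    by rewrite -{1}[K]card_ord -sum_nat_const; apply: leq_sum => i _; apply: hi0.
  apply: leq_trans (leq_mul (alpha_sum sy XS ap) (leqnn _)); rewrite big_distrl /=.
  by apply: leq_sum => i _; rewrite leq_mul2l alpha_mono ?orbT // XS.
have h2 := leq_trans (large i0 (ltn_ord i0)) (leq_mul (small _ (proper i0 (ltn_ord i0))) (leqnn _)).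
have h3 : #|S| <= k0 * (alpha e S * alpha (co e) S) ^ C.
  apply: leq_trans h2 _; rewrite -mulnA leq_mul2l -expnMn mulnC; apply/orP; right.
  by case: (C) => // C1; rewrite leq_exp2r.
by have := leq_ltn_trans h3 big; rewrite ltnn.
Qed.
End Alpha.

Section EH.
Variables (V E V' E' : finType) (e1 e2 : E -> V) (e1' e2' : E' -> V').
Hypothesis e12 : forall i, e1 i != e2 i.
Hypothesis e12' : forall i, e1' i != e2' i.
Variables (U : finType) (h : rel U).
Hypothesis hsy : symmetric h.
Hypothesis hmodel : forall (T : finType) (e : rel T) S, symmetric e -> irreflexive e -> induced_copy h e S -> sub2_model e1 e2 e.

(** Rödl's theorem does not tell which of the graph and its complement is sparse, so it is applied
    with [t * t'], which serves both; [q] and then the exponent are fixed afterwards. The leading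
    constant [4 * q] forces a counterexample to have more than [4 * q] vertices, as [sparse_model]
    requires. *)
Lemma size_le_mu : exists k0 C, forall (T : finType) (e : rel T) (S : {set T}), symmetric e -> irreflexive e ->
  ~ sub2_model e1 e2 e -> ~ sub2_model e1' e2' (signed_adj e false) ->
  #|S| <= k0 * (alpha e S * alpha (signed_adj e false) S) ^ C.
Proof.
have [t t0 ht] := sparse_model e12; have [t' t0' ht'] := sparse_model e12'.
have tt : 0 < t * t' by rewrite muln_gt0 t0.
have [q q0 hq] := rodl hsy tt.
have [C1 hC1] := ht q; have [C2 hC2] := ht' q.
exists (4 * q), (C1 + C2) => T e S sy irr nm nm'.
have [n] := ubnP #|S|; elim: n S => // n IH S; rewrite ltnS => Sn.
rewrite leqNgt; apply/negP => big.
have small (X : {set T}) : #|X| < #|S| -> #|X| <= 4 * q * (alpha e X * alpha (signed_adj e false) X) ^ (C1 + C2).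
  by move=> XS; apply: IH; apply: leq_trans XS Sn.
have S0 : 0 < #|S| by apply: leq_ltn_trans big.
have sy' := co_sym sy; have irr' := co_irr e.
have qS : 4 * q < #|S|.
  apply: leq_ltn_trans big; rewrite leq_pmulr // expn_gt0 muln_gt0.
  by rewrite alpha_gt0 // alpha_gt0.
have nc : ~ induced_copy h e S by move/(hmodel sy irr).
have [Y [sg [YS hY dY]]] := hq T e S sy irr nc S0.
case: sg dY => dY.
  apply: nm; apply: (hC1 (C1 + C2) T e S Y) => //; first exact: leq_addr.
    exact: critical_of_minimal big.
  by move=> y /dY; apply: leq_trans; rewrite leq_mul2l leq_pmulr ?orbT.
apply: nm'; apply: (hC2 (C1 + C2) T (signed_adj e false) S Y) => //; first exact: leq_addl.
  (* The product of stability and clique number is invariant under complementation, so [S] is also a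
     minimal counterexample for the complement. *)
  apply: (critical_of_minimal (k0 := 4 * q)) => // [X /small|].
    by rewrite (alpha_ext X (coK irr)) mulnC [alpha e X * _]mulnC mulnC.
  by rewrite (alpha_ext S (coK irr)) [alpha _ S * _]mulnC.
by move=> y /dY; apply: leq_trans; rewrite leq_mul2l leq_pmull ?orbT.
Qed.

Lemma homogeneous_set : exists2 c, 0 < c & forall (T : finType) (e : rel T), symmetric e -> irreflexive e ->
  ~ sub2_model e1 e2 e -> ~ sub2_model e1' e2' (signed_adj e false) ->
  exists2 Z : {set T}, stableb e Z \/ stableb (signed_adj e false) Z & #|T| <= #|Z| ^ c.
Proof.
have [k0 [C hC]] := size_le_mu.
exists (k0 + 2 * C).+1 => // T e sy irr nm nm'.
have hT := hC T e setT sy irr nm nm'; rewrite cardsT in hT.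
have [Z1 _ [st1 a1]] := alpha_ex e setT; have [Z2 _ [st2 a2]] := alpha_ex (signed_adj e false) setT.
have [Z hZ [le1 le2]] : exists2 Z : {set T}, stableb e Z \/ stableb (signed_adj e false) Z & #|Z1| <= #|Z| /\ #|Z2| <= #|Z|.
  by case: (leqP #|Z1| #|Z2|) => [le|/ltnW le]; [exists Z2 => //; right | exists Z1 => //; left].
have [T1|T2] := leqP #|T| 1.
  case: (posnP #|T|) => [->|T0]; first by exists Z.
  exists Z => //; apply: leq_trans T1 _; rewrite expn_gt0; apply/orP; left; apply: leq_trans le1.
  by rewrite -a1 alpha_gt0 // cardsT.
exists Z => //.
(* Two vertices form a clique or a stable set, so the base is at least 2 and the constant [k0] can
   be absorbed by [#|Z| ^ k0]. *)
have Z2' : 2 <= #|Z|.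
  case/card_gt1P: T2 => x [y [_ _ xy]].
  case: (boolP (e x y)) => exy.
    apply: leq_trans le2; rewrite -a2; apply: leq_trans (_ : #|[set x; y]| <= _); first by rewrite cards2 xy.
    apply: alpha_ge (subsetT _) _; apply/stablebP => u w; rewrite /signed_adj !inE.
    by move=> /orP[]/eqP-> /orP[]/eqP->; rewrite ?eqxx //= ?[e y x]sy exy ?andbF.
  apply: leq_trans le1; rewrite -a1; apply: leq_trans (_ : #|[set x; y]| <= _); first by rewrite cards2 xy.
  apply: alpha_ge (subsetT _) _; apply/stablebP => u w; rewrite !inE.
  by move=> /orP[]/eqP-> /orP[]/eqP->; rewrite ?irr // sy.
apply: leq_trans hT _; rewrite a1 a2 -addn1 expnD expn1; apply: leq_trans _ (leq_pmulr _ (ltnW Z2')).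
rewrite expnD leq_mul //; first by apply: ltnW; apply: ltn_expl.
rewrite expnM; case: C {hC} => // C; rewrite leq_exp2r // -mulnn; exact: leq_mul.
Qed.
End EH.

(** * Subdivisions as graphs *)

Section Subdivision2.
Variable M : multigraph.
Let i0 : 'I_2 := ord0.
Let i1 : 'I_2 := ord_max.
Local Notation sd := (@subdiv_adj 2 M).

Lemma subdiv2E u v : sd u v = [exists a : medge M,
  [|| (u == inl (end1 a)) && (v == inr (a, i0)), (u == inr (a, i0)) && (v == inr (a, i1)),
      (u == inr (a, i1)) && (v == inl (end2 a)), (v == inl (end1 a)) && (u == inr (a, i0)),
      (v == inr (a, i0)) && (u == inr (a, i1)) | (v == inr (a, i1)) && (u == inl (end2 a))]].
Proof.
apply: eq_existsb => a.
have p1 : @subdiv_path 2 M a 1 = inr (a, i0).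
  by rewrite /= insubT //; congr (inr (_, _)); apply: val_inj.
have p2 : @subdiv_path 2 M a 2 = inr (a, i1).
  by rewrite /= insubT //; congr (inr (_, _)); apply: val_inj.
have p3 : @subdiv_path 2 M a 3 = inl (end2 a) by rewrite /= insubF.
have p0 : @subdiv_path 2 M a 0 = inl (end1 a) by [].
apply/existsP/idP => [[[[|[|[|//]]] ?]]|]; rewrite -?p0 -?p1 -?p2 -?p3.
- by move=> /orP[->|->]; rewrite ?orbT.
- by move=> /orP[->|->]; rewrite ?orbT.
- by move=> /orP[->|->]; rewrite ?orbT.
- case/or4P => [h|h|h|/or3P[h|h|h]].
  + by exists (@Ordinal 3 0 isT); rewrite h.
  + by exists (@Ordinal 3 1 isT); rewrite h.
  + by exists (@Ordinal 3 2 isT); rewrite h.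
  + by exists (@Ordinal 3 0 isT); rewrite h orbT.
  + by exists (@Ordinal 3 1 isT); rewrite h orbT.
  + by exists (@Ordinal 3 2 isT); rewrite h orbT.
Qed.

Lemma sd_ll u w : sd (inl u) (inl w) = false.
Proof. by rewrite subdiv2E; apply/existsP => -[a]; rewrite /= !andbF. Qed.

Lemma sd_l0 u a : sd (inl u) (inr (a, i0)) = (u == end1 a).
Proof.
rewrite subdiv2E; apply/existsP/eqP => [[a']|->].
  case/or4P => [/andP[/eqP[->] /eqP[->]]|/andP[]|/andP[]|/or3P[/andP[]|/andP[]|/andP[/eqP[_ //]]]] //.
by exists a; rewrite !eqxx.
Qed.

Lemma sd_l1 u a : sd (inl u) (inr (a, i1)) = (u == end2 a).
Proof.
rewrite subdiv2E; apply/existsP/eqP => [[a']|->].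
  case/or4P => [/andP[_ /eqP[_ //]]|/andP[]|/andP[]|/or3P[/andP[]|/andP[/eqP[_ //]]|/andP[/eqP[->] /eqP[->]]]] //.
by exists a; rewrite !eqxx !orbT.
Qed.

Lemma sd_00 a a' : sd (inr (a, i0)) (inr (a', i0)) = false.
Proof.
rewrite subdiv2E; apply/existsP => -[b].
by case/or4P => [/andP[]|/andP[_ /eqP[_ //]]|/andP[]|/or3P[/andP[]|/andP[_ /eqP[_ //]]|/andP[]]].
Qed.

Lemma sd_11 a a' : sd (inr (a, i1)) (inr (a', i1)) = false.
Proof.
rewrite subdiv2E; apply/existsP => -[b].
by case/or4P => [/andP[]|/andP[/eqP[_ //]]|/andP[]|/or3P[/andP[]|/andP[/eqP[_ //]]|/andP[]]].
Qed.

Lemma sd_01 a a' : sd (inr (a, i0)) (inr (a', i1)) = (a == a').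
Proof.
rewrite subdiv2E; apply/existsP/eqP => [[b]|->].
  by case/or4P => [/andP[]|/andP[/eqP[->] /eqP[->]]|/andP[]|/or3P[/andP[]|/andP[/eqP[_ //]]|/andP[]]].
by exists a'; rewrite !eqxx !orbT.
Qed.

Lemma ord2_cases (j : 'I_2) : j = i0 \/ j = i1.
Proof. by case: j => [[|[|//]] ?]; [left|right]; apply: val_inj. Qed.

Variables (T : finType) (e : rel T).
Hypothesis sy : symmetric e.
Hypothesis irr : irreflexive e.

Lemma model_of_copy (S : {set T}) : induced_copy sd e S -> sub2_model (@end1 M) (@end2 M) e.
Proof.
case=> phi [_ hp].
have phi_inj : injective phi.
  move=> x y xy; apply/eqP; apply: contraT => ne; have := hp x y ne; rewrite /signed_adj xy irr eqxx.
  by case: ifP.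
have pe x y : e (phi x) (phi y) = sd x y.
  case: (eqVneq x y) => [->|/hp]; first by rewrite irr; apply/esym/subdiv_adj_irr.
  by rewrite /signed_adj; case: ifP => _ // /andP[_ /negbTE].
exists (fun u => phi (inl u)), (fun a => phi (inr (a, i0))), (fun a => phi (inr (a, i1))); split.
- by move=> u v /phi_inj[].
- by split=> [u w|u a]; rewrite !pe ?sd_ll ?sd_l0 ?sd_l1.
- by move=> a a'; rewrite !pe sd_00 sd_11.
- by move=> a a'; rewrite pe sd_01.
Qed.

Lemma copy_of_model : sub2_model (@end1 M) (@end2 M) e ->
  exists2 phi : subdivision 2 M -> T, injective phi & forall x y, e (phi x) (phi y) = sd x y.
Proof.
case=> b [p [q [binj [bb bpq] pp pq]]].
pose phi (x : subdiv_vertex 2 M) := match x with inl u => b u | inr (a, j) => if j == i0 then p a else q a end.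
have pe x y : e (phi x) (phi y) = sd x y.
  have sds := @subdiv_adj_sym 2 M.
  case: x => [u|[a j]]; case: y => [w|[a' j']]; rewrite /phi.
  - by rewrite sd_ll (negbTE (bb u w)).
  - by case: (ord2_cases j') => ->; rewrite ?sd_l0 ?sd_l1; have [h1 h2] := bpq u a'.
  - by rewrite sds sy; case: (ord2_cases j) => ->; rewrite ?sd_l0 ?sd_l1; have [h1 h2] := bpq w a.
  - have [/negbTE h1 /negbTE h2] := pp a a'; case: (ord2_cases j) => ->; case: (ord2_cases j') => -> /=.
    + by rewrite sd_00.
    + by rewrite sd_01.
    + by rewrite sy sds sd_01.
    + by rewrite sd_11.
exists phi => //.
have sds := @subdiv_adj_sym 2 M.
have sd_0l u a : sd (inr (a, i0)) (inl u) = (u == end1 a) by rewrite sds sd_l0.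
have sd_1l u a : sd (inr (a, i1)) (inl u) = (u == end2 a) by rewrite sds sd_l1.
have sd_10 a a' : sd (inr (a, i1)) (inr (a', i0)) = (a' == a) by rewrite sds sd_01.
(* Equal images have equal neighbours, but a new vertex is adjacent to a branch vertex and a branch
   vertex is not. *)
have lr u a j : phi (inl u) <> phi (inr (a, j)).
  move=> xy; have nb z : sd (inl u) z = sd (inr (a, j)) z by rewrite -!pe xy.
  case: (ord2_cases j) nb => -> nb.
    by have := nb (inl (end1 a)); rewrite sd_ll sd_0l eqxx.
  by have := nb (inl (end2 a)); rewrite sd_ll sd_1l eqxx.
move=> [u|[a j]] [w|[a' j']] xy; [by rewrite (binj _ _ xy) | by case: (lr _ _ _ xy) | by case: (lr _ _ _ (esym xy)) |].
have nb z : sd (inr (a, j)) z = sd (inr (a', j')) z by rewrite -!pe xy.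
case: (ord2_cases j) nb => ->; case: (ord2_cases j') => -> nb.
- by have := nb (inr (a, i1)); rewrite !sd_01 eqxx => /esym/eqP->.
- by have := nb (inr (a, i1)); rewrite sd_01 sd_11 eqxx.
- by have := nb (inr (a, i0)); rewrite sd_10 sd_00 eqxx.
- by have := nb (inr (a, i0)); rewrite !sd_10 eqxx => /esym/eqP->.
Qed.
End Subdivision2.

Lemma giso_sym G H : giso G H -> giso H G.
Proof.
case=> f [g fK gK] hf; exists g; first by exists f.
by move=> x y; rewrite -hf !gK.
Qed.

Lemma induced_of_embedding (K G : sgraph) (phi : K -> G) : injective phi ->
  (forall x y, sadj (phi x) (phi y) = sadj x y) -> exists S : {set G}, giso (induced S) K.
Proof.
move=> pinj pe; exists (phi @: [set: K]); apply: giso_sym.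
have pS x : phi x \in phi @: [set: K] by apply/imsetP; exists x.
exists (fun x => exist _ (phi x) (pS x) : induced (phi @: [set: K])).
  apply: inj_card_bij; first by move=> x y /(congr1 val) /pinj.
  by rewrite card_sig card_imset // cardsT.
by move=> x y; apply: pe.
Qed.

(** * Passage to a real exponent, and the conclusion *)

Import Order.TTheory GRing.Theory Num.Theory.

Lemma nat_powR_le (R : realType) (n z c : nat) : 0 < c -> n <= z ^ c ->
  (n%:R `^ (c%:R^-1 : R) <= z%:R :> R)%R.
Proof.
move=> c0 h.
have c0R : (c%:R != 0 :> R)%R by rewrite pnatr_eq0 -lt0n.
have hp : (n%:R `^ (c%:R^-1 : R) <= (z ^ c)%:R `^ (c%:R^-1 : R) :> R)%R.
  by apply: ge0_ler_powR; rewrite ?nnegrE ?ler0n ?ler_nat ?invr_ge0 ?ler0n.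
by apply: le_trans hp _; rewrite natrX -powR_mulrn ?ler0n // -powRrM mulfV // powRr1 ?ler0n.
Qed.

Theorem mainTheorem3 (R : realType) (H0 J0 : multigraph) (H J : sgraph)
    (hH : is_subdivision 2 H0 H) (hJ : is_subdivision 2 J0 J) :
  erdos_hajnal R (graph_pair H (compl J)).
Proof.
have [c c0 hc] := homogeneous_set (@end_neq H0) (@end_neq J0) (@subdiv_adj_sym 2 H0)
  (fun T e S sy irr => @model_of_copy H0 T e irr S).
exists (c%:R^-1)%R; first by rewrite invr_gt0 ltr0n.
move=> G hG.
have nH : ~ sub2_model (@end1 H0) (@end2 H0) (@sadj G).
  move=> /(copy_of_model (@sadj_sym G))[phi pinj pe].
  have [f [g fK gK] hf] := hH.
  have [|x y|S hS] := @induced_of_embedding H G (phi \o f); last by apply: (hG H _ S hS); left.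
    by apply: inj_comp => //; apply: can_inj fK.
  by rewrite /= pe; apply: hf.
have nJ : ~ sub2_model (@end1 J0) (@end2 J0) (signed_adj (@sadj G) false).
  move=> /(copy_of_model (co_sym (@sadj_sym G)))[phi pinj pe].
  have [f [g fK gK] hf] := hJ.
  have inj : injective (phi \o f) by apply: inj_comp => //; apply: can_inj fK.
  have [//|x y|S hS] := @induced_of_embedding (compl J) G (phi \o f); last by apply: (hG (compl J) _ S hS); right.
  (* The embedding of [J] goes into the complement of [G]; complementing both sides makes it an
     embedding of [compl J] into [G]. *)
  rewrite /= /compl_adj; case: (eqVneq x y) => [->|xy]; first by rewrite sadj_irr.
  have hf' : @subdiv_adj 2 J0 (f x) (f y) = @sadj J x y := hf x y.
  rewrite -hf' -pe /signed_adj.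
  by rewrite (inj_eq (f := phi \o f)) // xy /= negbK.
have [Z hZ cZ] := hc G (@sadj G) (@sadj_sym G) (@sadj_irr G) nH nJ.
exists Z; last exact: nat_powR_le.
case: hZ => /stablebP st; [right|left] => x y xZ yZ; first exact: st.
by move=> xy; have := st x y xZ yZ; rewrite /signed_adj xy /= negbK.
Qed.
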